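(* Let $1<p<N$ and let $u\in \mathcal D^{1,p}(\mathbb R^N)\setminus \{0\}$ be a possibly sign-changing radial weak solution to the equation $$-\Delta_p u = |u|^{p^*-2}u \quad \text{in } \mathbb R^N.$$ Then, necessarily, there exists $\lambda>0$ such that, for one of the two choices of sign $\pm$, $$u(x)=\pm\left[\frac{\lambda^{\frac{1}{p-1}}N^{\frac{1}{p}}\left(\frac{N-p}{p-1}\right)^{\frac{p-1}{p}}}{\lambda^{\frac{p}{p-1}}+|x|^{\frac{p}{p-1}}}\right]^{\frac{N-p}{p}}\qquad\text{for all }x\in\mathbb R^N.$$
   Context: Functions are real-valued. $\Delta_p u=\operatorname{div}(|\nabla u|^{p-2}\nabla u)$ and $p^*=Np/(N-p)$ for $1<p<N$. $\mathcal D^{1,p}(\mathbb R^N)=\{u\in L^{p^*}(\mathbb R^N):\nabla u\in L^p(\mathbb R^N;\mathbb R^N)\}$. Weak solution means $\int_{\mathbb R^N}|\nabla u|^{p-2}\nabla u\cdot\nabla h\,dx=\int_{\mathbb R^N}|u|^{p^*-2}u\,h\,dx$ for all $h\in\mathcal D^{1,p}(\mathbb R^N)$; $u$ is identified with its continuous representative. *)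

(* Defs.v *)
From HB Require Import structures.
From mathcomp Require Import all_boot all_order all_algebra.
From mathcomp Require Import all_classical all_reals all_analysis.

Set Implicit Arguments.
Unset Strict Implicit.
Unset Printing Implicit Defensive.
Import Order.TTheory GRing.Theory Num.Theory.
Import numFieldNormedType.Exports.
Local Open Scope classical_set_scope.
Local Open Scope ring_scope.

Definition rV_display : measure_display.
Proof. exact. Qed.

(* R^n carries the sigma-algebra generated by the coordinate maps, that is, the
   Borel sigma-algebra. *)
Section rV_measurable.
Context {R : realType} (n : nat).

Definition rV_coord (i : 'I_n) (x : 'rV[R]_n) : measurableTypeR R := x 0 i.

Let rV_set0 : g_sigma_preimage rV_coord set0.
Proof. exact: sigma_algebra0. Qed.

Let rV_setC A : g_sigma_preimage rV_coord A -> g_sigma_preimage rV_coord (~` A).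
Proof. exact: sigma_algebraC. Qed.

Let rV_bigcup (F : _^nat) : (forall i, g_sigma_preimage rV_coord (F i)) ->
  g_sigma_preimage rV_coord (\bigcup_i (F i)).
Proof. exact: sigma_algebra_bigcup. Qed.

HB.instance Definition _ := @isMeasurable.Build rV_display
  'rV[R]_n (g_sigma_preimage rV_coord) rV_set0 rV_setC rV_bigcup.

Lemma measurable_rV_coord (i : 'I_n) : measurable_fun setT (rV_coord i).
Proof.
move=> _ Y mY; rewrite setTI; apply: sub_sigma_algebra => /=.
rewrite -bigcup_seq/=; exists i => /=; first by rewrite mem_index_enum.
by exists Y => //; rewrite setTI.
Qed.

Lemma measurable_fun_rV d (T : measurableType d) (f : T -> 'rV[R]_n) :
  (forall i, measurable_fun setT (rV_coord i \o f)) -> measurable_fun setT f.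
Proof.
move=> mf; suff H : g_sigma_preimage (fun i => rV_coord i \o f) `<=` measurable.
  by move=> _ A mA; apply: H; rewrite g_sigma_preimage_comp; exists A.
apply: smallest_sub; first exact: sigma_algebra_measurable.
rewrite -bigcup_seq; apply: bigcup_sub => i _.
by move=> A [B mB <-]; exact: mf.
Qed.

End rV_measurable.

Section lebesgue_rV.
Context {R : realType}.

Definition rV_cons n (p : measurableTypeR R * 'rV[R]_n) : 'rV[R]_n.+1 :=
  \row_i (if unlift ord0 i is Some j then p.2 0 j else p.1).

Definition rV_uncons n (x : 'rV[R]_n.+1) : measurableTypeR R * 'rV[R]_n :=
  (x 0 ord0, \row_j x 0 (lift ord0 j)).

Lemma rV_consK n : cancel (@rV_cons n) (@rV_uncons n).
Proof.
case=> a y; rewrite /rV_uncons mxE unlift_none; congr pair.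
by apply/rowP => j; rewrite !mxE liftK.
Qed.

Lemma rV_unconsK n : cancel (@rV_uncons n) (@rV_cons n).
Proof.
move=> x; apply/rowP => i; rewrite mxE.
by case: unliftP => [j|] -> //=; rewrite mxE.
Qed.

Lemma measurable_rV_cons n : measurable_fun setT (@rV_cons n).
Proof.
apply: measurable_fun_rV => i.
case: (unliftP ord0 i) => [j|] ->.
  rewrite (_ : _ \o _ = rV_coord j \o snd).
    by apply: measurableT_comp => //; exact: measurable_rV_coord.
  by apply/funext => p /=; rewrite /rV_coord mxE liftK.
rewrite (_ : _ \o _ = fst) //.
by apply/funext => p /=; rewrite /rV_coord mxE unlift_none.
Qed.

Lemma measurable_rV_uncons n : measurable_fun setT (@rV_uncons n).
Proof.
apply/measurable_fun_pairP; split; first exact: (measurable_rV_coord ord0).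
apply: measurable_fun_rV => i.
rewrite (_ : _ \o _ = rV_coord (lift ord0 i)); first exact: measurable_rV_coord.
by apply/funext => x; rewrite /rV_coord /= mxE.
Qed.

Section lebesgue_rV_step.
Variables (n : nat) (m : {sigma_finite_measure set 'rV[R]_n -> \bar R}).

Local Notation prod_meas := (@lebesgue_measure R \x m)%E.

Definition lebesgue_rV_step : set 'rV[R]_n.+1 -> \bar R :=
  pushforward prod_meas (@rV_cons n).

Let step0 : lebesgue_rV_step set0 = 0%E.
Proof. by rewrite /lebesgue_rV_step /pushforward preimage_set0 measure0. Qed.

Let step_ge0 A : (0 <= lebesgue_rV_step A)%E.
Proof. by apply: measure_ge0; exact: measurable_rV_cons. Qed.

Let step_sigma_additive : semi_sigma_additive lebesgue_rV_step.
Proof.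
have mc := @measurable_rV_cons n.
move=> F mF tF mUF; rewrite /lebesgue_rV_step /pushforward preimage_bigcup.
apply: measure_semi_sigma_additive.
- by move=> k; rewrite -[X in measurable X]setTI; exact: mc.
- apply/trivIsetP => /= i j _ _ ij; rewrite -preimage_setI.
  by move/trivIsetP : tF => /(_ _ _ _ _ ij) ->//; rewrite preimage_set0.
- by rewrite -preimage_bigcup -[X in measurable X]setTI; exact: mc.
Qed.

HB.instance Definition _ := isMeasure.Build _ _ _
  lebesgue_rV_step step0 step_ge0 step_sigma_additive.

Let step_sigma_finite : sigma_finite setT lebesgue_rV_step.
Proof.
have /sigma_finiteP[F [FT ndF Foo]] := sigma_finiteT (@lebesgue_measure R).
have /sigma_finiteP[G [GT ndG Goo]] := sigma_finiteT m.
exists (fun k => @rV_uncons n @^-1` (F k `*` G k)).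
  apply/seteqP; split => // x _.
  have [k _ Fk] : (\bigcup_k F k) (rV_uncons x).1 by rewrite -FT.
  have [l _ Gl] : (\bigcup_k G k) (rV_uncons x).2 by rewrite -GT.
  exists (maxn k l) => //; split.
  - by move: Fk; exact/subsetPset/ndF/leq_maxl.
  - by move: Gl; exact/subsetPset/ndG/leq_maxr.
move=> k; have [mF Fk] := Foo k; have [mG Gk] := Goo k; split.
  rewrite -[X in measurable X]setTI; apply: measurable_rV_uncons => //.
  exact: measurableX.
rewrite /lebesgue_rV_step /pushforward -comp_preimage.
rewrite (_ : _ \o _ = id); last by apply/funext => p /=; rewrite rV_consK.
by rewrite preimage_id product_measure1E// lte_mul_pinfty// ge0_fin_numE.
Qed.

HB.instance Definition _ := Measure_isSigmaFinite.Build _ _ _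
  lebesgue_rV_step step_sigma_finite.

End lebesgue_rV_step.

(* n-dimensional Lebesgue measure on R^n, through R^(n+1) = R * R^n; R^0 is a
   point of mass 1. *)
Fixpoint lebesgue_rV (n : nat) : {sigma_finite_measure set 'rV[R]_n -> \bar R} :=
  match n with
  | 0%N => [the {sigma_finite_measure set 'rV[R]_0 -> \bar R} of
               @dirac _ 'rV[R]_0 (0 : 'rV[R]_0) R]
  | k.+1 => [the {sigma_finite_measure set 'rV[R]_k.+1 -> \bar R} of
               lebesgue_rV_step (lebesgue_rV k)]
  end.

Lemma lebesgue_rV_box n (A : 'I_n -> set (measurableTypeR R)) :
  (forall i, measurable (A i)) ->
  (lebesgue_rV n [set x | forall i, A i (rV_coord i x)] =
     \prod_(i < n) @lebesgue_measure R (A i))%E.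
Proof.
elim: n A => [|n IH] A mA.
  rewrite big_ord0 /= /dirac indicE mem_set//.
  by case.
rewrite big_ord_recl -IH//.
rewrite [LHS]/= /lebesgue_rV_step /pushforward -product_measure1E//; last first.
  rewrite (_ : mkset _ =
    \bigcap_(i in [set: 'I_n]) rV_coord i @^-1` (A (lift ord0 i))).
    apply: fin_bigcap_measurable => // i _.
    by rewrite -[X in measurable X]setTI; exact: measurable_rV_coord.
  by apply/seteqP; split => x /= H i; [move=> _|]; exact: H.
congr (_ _); apply/seteqP; split => -[a y] /=.
  move=> H; split; first by have := H ord0; rewrite /rV_coord mxE unlift_none.
  by move=> i; have := H (lift ord0 i); rewrite /rV_coord mxE liftK.
move=> [Aa Ay] i; rewrite /rV_coord mxE.
by case: unliftP => [j|] -> //=; exact: Ay.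
Qed.

End lebesgue_rV.

Section sobolev.
Context {R : realType} {N : nat}.
Implicit Types (u h phi : 'rV[R]_N -> R) (g k : 'rV[R]_N -> 'rV[R]_N).

Local Notation mu := (@lebesgue_rV R N).

Definition dotr (x y : 'rV[R]_N) : R := \sum_i x 0 i * y 0 i.

(* The library's norm on matrices is the sup norm. *)
Definition enorm (x : 'rV[R]_N) : R := Num.sqrt (dotr x x).

Definition partial (i : 'I_N) (phi : 'rV[R]_N -> R) : 'rV[R]_N -> R :=
  fun x => 'D_(delta_mx 0 i) phi x.

Definition smooth phi := forall s : seq 'I_N,
  let D := foldr partial phi s in
  continuous D /\ forall i x, derivable D x (delta_mx 0 i).

Definition test_function phi :=
  smooth phi /\ compact (closure [set x | phi x != 0]).

Definition L1loc u := measurable_fun setT u /\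
  forall K, compact K -> (\int[mu]_(x in K) `|u x|%:E < +oo)%E.

Definition weak_gradient u g :=
  [/\ L1loc u, forall i, L1loc (fun x => g x 0 i) &
   forall phi, test_function phi -> forall i,
     \int[mu]_x (u x * partial i phi x) = - \int[mu]_x (g x 0 i * phi x)].

Definition pstar (p : R) : R := N%:R * p / (N%:R - p).

Definition D1p_gradient (p : R) u g :=
  [/\ u \in Lfun mu (pstar p)%:E, weak_gradient u g &
   forall i, (fun x => g x 0 i) \in Lfun mu p%:E].

(* Functions are not quotiented by a.e. equality: a class of the homogeneous
   Sobolev space is represented by each of its Borel members. *)
Definition D1p (p : R) u := exists g, D1p_gradient p u g.

(* Weak solutions of - Delta_p u = |u|^(p* - 2) u. Weak gradients are unique
   a.e., so the choice of g and k is immaterial. *)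
Definition weak_solution (p : R) u := exists2 g, D1p_gradient p u g &
  forall h k, D1p_gradient p h k ->
    \int[mu]_x (enorm (g x) `^ (p - 2) * dotr (g x) (k x)) =
    \int[mu]_x (`|u x| `^ (pstar p - 2) * u x * h x).

Definition radial u := exists v : R -> R, forall x, u x = v (enorm x).

End sobolev.

(* Main.v *)
Require Import Defs.
From mathcomp Require Import all_boot all_order all_algebra.
From mathcomp Require Import all_classical all_reals all_analysis.
From mathcomp Require Import measurable_realfun.
From mathcomp Require Import ring lra.
Import Order.TTheory GRing.Theory Num.Theory.
Import numFieldNormedType.Exports.
Local Open Scope classical_set_scope.
Local Open Scope ring_scope.

(** A radial solution u(x) = v(|x|) is explicit as soon as its profile v is known
    to be C^1 and to solve the radial equation with a flux vanishing at the origin.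
    The weak formulation offers much less: the gradient g is an L^p field, known
    only through integrals against smooth functions.

    The flux comes first. With f = |v|^(p* - 2) v, the radial field X of profile
    w(r) = - r^(1-N) times the integral of s^(N-1) f(s) over [0, r] is continuous
    and satisfies - div X = f. Let G be the radial field with |G|^(p-2) G = X. Given
    a smooth radial cutoff zeta, the field zeta G + u grad zeta is radial and
    continuous, hence the gradient of a C^1 function E of compact support, and
    h = zeta u - E is an admissible test function with weak gradient zeta (g - G)
    (trunc_D1p): the gradient of the cutoff does not appear. Testing the equation
    of u and the identity - div X = f with h, and subtracting, gives a vanishing
    integral of zeta (|g|^(p-2) g - |G|^(p-2) G) . (g - G), so g = G almost
    everywhere by strict monotonicity (pflux_mono_eq, gradient_ae). Here h is only
    weakly differentiable and X only continuous; - div X = f is tested against h by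
    approximating f uniformly by polynomials in |x|^2, whose fluxes are polynomial
    fields (radial_flux_identity). Finally u and a radial primitive of G have the
    same weak gradient, so they differ by a constant (zero_weak_partial_cst), v is
    C^1 and w = |v'|^(p-2) v' (radial_solution_profile).

    Write q for the exponent p*. As it is critical, the Pohozaev quantity
      r^N ((p-1)/p |v'|^p + |v|^q / q) + (N-p)/p r^(N-1) w v
    is constant; it vanishes at r = 0, hence everywhere (pohozaev_eq0). Where v is
    positive, its vanishing says precisely that w v^(-N(p-1)/(N-p)) / r is locally
    constant (quotient_cst), and integrating once more, that v^(-p/(N-p)) is an
    affine function of r^(p/(p-1)) (inverse_power_affine). Such a function is
    bounded on bounded intervals, so v cannot reach 0 and has a constant sign
    (profile_gt0). The Pohozaev relation at r = 0 ties the two coefficients of the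
    affine function together, which leaves the one-parameter family of the
    statement (bubble_formula). *)

Set Implicit Arguments.
Unset Strict Implicit.
Unset Printing Implicit Defensive.

(** * Antiderivatives and signed powers *)

Section antiderivative.
Context {R : realType}.
Implicit Types (f F : R -> R).

Lemma is_derive_continuous f (df x : R) : is_derive x (1 : R) f df -> {for x, continuous f}.
Proof. by move=> [h _]; exact/differentiable_continuous/derivable1_diffP. Qed.

Lemma continuous_integrable_itv f (a b : R) : continuous f ->
  lebesgue_measure.-integrable `[a, b] (EFin \o f).
Proof.
move=> cf; apply: continuous_compact_integrable; first exact: segment_compact.
exact/continuous_subspaceT.
Qed.

(** The integral from a fixed base point is differentiable only to the right of
    that point. Integrating from a base point that moves with the argument, and
    subtracting the integral up to 0 from the same base point, gives one primitive
    on the whole line. *)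
Lemma continuous_antiderivative f : continuous f ->
  exists F : R -> R, F 0 = 0 /\ forall x : R, is_derive x (1 : R) F (f x).
Proof.
move=> cf.
pose J a x := \int[lebesgue_measure]_(t in `[a, x]) f t.
have JB a b x : a <= b -> b < x -> b < 0 -> J a x - J a 0 = J b x - J b 0.
  move=> ab bx b0.
  have K c y : c <= b -> b < y -> J c y = J c b + \int[lebesgue_measure]_(t in `]b, y]) f t.
    move=> cb byy; rewrite -(@Rintegral_itvB _ _ (BLeft c) (BRight y) b)//=.
    - by rewrite addrC subrK.
    - exact: continuous_integrable_itv.
    - by rewrite bnd_simp ltW.
  by rewrite (K a x)// (K a 0)// (K b x)// (K b 0)//; ring.
pose F x := J (- (`|x| + 1)) x - J (- (`|x| + 1)) 0.
exists F; split; first by rewrite /F subrr.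
move=> x0.
set a := - (`|x0| + 3).
have a_lt : a < x0 by rewrite /a; move: (ler_norm (- x0)); rewrite normrN; lra.
have Fa : \forall x \near x0, J a x - J a 0 = F x.
  near=> x; apply: JB.
  - rewrite lerN2 -lerBDr.
    have : `|x| < `|x0| + 1; last lra.
    by near: x; apply: (cvgr_lt _ (@norm_continuous _ _ x0)); lra.
  - by move: (ler_norm (- x)); rewrite normrN; lra.
  - by move: (normr_ge0 x); lra.
apply: near_eq_is_derive Fa _.
have [D1 D2] := @continuous_FTC1_closed R f a x0 (x0 + 1) (ltr_pwDr ltr01 (lexx _))
  (continuous_integrable_itv _ _ cf) a_lt (cf x0).
rewrite -[X in is_derive _ _ _ X]subr0; apply: is_deriveB.
by rewrite -D2 derive1E; exact: derivableP.
Unshelve. all: by end_near. Qed.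

End antiderivative.

Section spow.
Context {R : realType}.
Implicit Types (a e : R).

(** The odd extension of the power function: the map |a|^(e-1) a. *)
Definition spow e a : R := Num.sg a * `|a| `^ e.

Lemma spow0 e : spow e 0 = 0. Proof. by rewrite /spow sgr0 mul0r. Qed.

Lemma spow_pos e a : 0 < a -> spow e a = a `^ e.
Proof. by move=> a0; rewrite /spow gtr0_sg// mul1r gtr0_norm. Qed.

Lemma spowN e a : spow e (- a) = - spow e a.
Proof. by rewrite /spow sgrN normrN mulNr. Qed.

Lemma norm_spow e a : e != 0 -> `|spow e a| = `|a| `^ e.
Proof.
move=> e0; rewrite /spow normrM normr_sg.
have [->|a0] := eqVneq a 0; first by rewrite mul0r normr0 powR0.
by rewrite mul1r ger0_norm// powR_ge0.
Qed.

Lemma spow_mul e a : e + 1 != 0 -> spow e a * a = `|a| `^ (e + 1).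
Proof.
move=> e1; have [->|a0] := eqVneq a 0; first by rewrite mulr0 normr0 powR0.
rewrite /spow mulrAC -normrEsg mulrC powRD ?normr_eq0 ?a0 ?implybT//.
by rewrite powRr1.
Qed.

Lemma spow_powR e a : `|a| `^ (e - 1) * a = spow e a.
Proof.
have [->|a0] := eqVneq a 0; first by rewrite mulr0 spow0.
rewrite /spow {2}(numEsg a) mulrCA; congr (_ * _).
rewrite -{2}(subrK 1 e) [RHS]powRD ?normr_eq0 ?a0 ?implybT//.
by rewrite powRr1.
Qed.

Lemma spowK e a : e != 0 -> spow e (spow e^-1 a) = a.
Proof.
move=> e0; rewrite {1}/spow norm_spow ?invr_eq0// -powRrM mulVf// powRr1//.
have [->|a0] := eqVneq a 0; first by rewrite normr0 mulr0.
by rewrite /spow sgrM sgr_id (gtr0_sg (powR_gt0 _ _)) ?normr_gt0// mulr1 -numEsg.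
Qed.

Lemma powR_norm_cvg0 e : 0 < e -> `|x| `^ e @[x --> (0 : R)] --> (0 : R).
Proof.
move=> e0; apply/cvgrPdist_lt => d d0.
near=> x; rewrite sub0r normrN ger0_norm ?powR_ge0//.
have -> : d = (d `^ e^-1) `^ e by rewrite -powRrM mulVf ?gt_eqF// powRr1// ltW.
apply: gt0_ltr_powR; rewrite ?nnegrE ?powR_ge0//.
near: x; apply: (cvgr_lt _ (@norm_continuous _ _ (0 : R))).
by rewrite normr0 powR_gt0.
Unshelve. all: by end_near. Qed.

Lemma powR_continuous_pos e a : 0 < a -> {for a, continuous (fun x => x `^ e)}.
Proof. by move=> a0; apply: is_derive_continuous; exact: is_derive1_powR. Qed.

Lemma spow_continuous e : 0 < e -> continuous (spow e).
Proof.
move=> e0.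
have P a : 0 < a -> {for a, continuous (spow e)}.
  move=> a0; have := powR_continuous_pos (e:=e) a0.
  rewrite /prop_for /continuous_at spow_pos//; apply: cvg_trans.
  apply: near_eq_cvg; near=> x; rewrite spow_pos//.
  by near: x; exact: lt_nbhsr.
move=> a; have [a0|a0|->] := ltgtP a 0; last first.
- rewrite /continuous_at spow0; apply/norm_cvg0P.
  have := powR_norm_cvg0 e0; apply: cvg_trans.
  by apply: near_eq_cvg; near=> x; rewrite norm_spow ?gt_eqF.
- exact: P.
- have -> : spow e = (fun x => - spow e (- x)).
    by apply/funext => x; rewrite spowN opprK.
  apply: (@continuousN _ _ _ (fun x => spow e (- x)) a).
  apply: (@continuous_comp _ _ _ -%R (spow e)); first exact: opp_continuous.
  by apply: P; rewrite oppr_gt0.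
Unshelve. all: by end_near. Qed.

Lemma is_derive_norm_powR e a : 1 < e ->
  is_derive a (1 : R) (fun x : R => `|x| `^ e) (e * spow (e - 1) a).
Proof.
move=> e1.
have e0 : 0 < e by exact: lt_trans e1.
have P (b : R) : 0 < b -> is_derive b (1 : R) (fun x : R => `|x| `^ e) (e * spow (e - 1) b).
  move=> b0; rewrite spow_pos//.
  apply: (near_eq_is_derive _ (is_derive1_powR e b0)).
  near=> x; rewrite ger0_norm//; near: x.
  by apply: filterS (lt_nbhsr b0) => x /ltW.
have [a0|a0|->] := ltgtP a 0; last first.
- (* At the origin |z|^e = spow (e-1) z * z, so spow (e-1) is the slope. *)
  apply/is_derive1_caratheodory; exists (spow (e - 1)); split.
  + move=> z; rewrite subr0 spow_mul ?subrK ?gt_eqF//.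
    by rewrite normr0 powR0 ?subr0// gt_eqF.
  + by apply: spow_continuous; rewrite subr_gt0.
  + by rewrite spow0 mulr0.
- exact: P.
- rewrite (_ : (fun x => _) = (fun x : R => `|x| `^ e) \o -%R); last first.
    by apply/funext => x /=; rewrite normrN.
  have -> : e * spow (e - 1) a = e * spow (e - 1) (- a) * (-1).
    by rewrite spowN; ring.
  apply: is_derive1_comp; apply: P; by rewrite oppr_gt0.
Unshelve. all: by end_near. Qed.

Lemma spowMr e a b : 0 < b -> spow e (a * b) = spow e a * b `^ e.
Proof.
move=> b0; rewrite /spow sgrM (gtr0_sg b0) mulr1 normrM (gtr0_norm b0).
by rewrite powRM// ?(ltW b0)// mulrA.
Qed.

End spow.

(** * Rules of differentiation, smooth bumps and steps *)

Section derivation_rules.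
Context {R : realType} {V : normedModType R}.
Implicit Types (f g : V -> R) (x v : V).

Lemma is_derive_conv f x v (df dg : R) :
  is_derive x v f df -> df = dg -> is_derive x v f dg.
Proof. by move=> h <-. Qed.

Lemma is_derive_funD f g x v (df dg : R) :
  is_derive x v f df -> is_derive x v g dg ->
  is_derive x v (fun y => f y + g y) (df + dg).
Proof. by move=> hf hg; exact: is_deriveD. Qed.

Lemma is_derive_funB f g x v (df dg : R) :
  is_derive x v f df -> is_derive x v g dg ->
  is_derive x v (fun y => f y - g y) (df - dg).
Proof. by move=> hf hg; exact: is_deriveB. Qed.

Lemma is_derive_funN f x v (df : R) :
  is_derive x v f df -> is_derive x v (fun y => - f y) (- df).
Proof. by move=> hf; exact: is_deriveN. Qed.

Lemma is_derive_funM f g x v (df dg : R) :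
  is_derive x v f df -> is_derive x v g dg ->
  is_derive x v (fun y => f y * g y) (df * g x + f x * dg).
Proof.
move=> hf hg; apply: is_derive_conv (is_deriveM hf hg) _.
by rewrite addrC; congr (_ + _); exact: mulrC.
Qed.

(** Turns a directional derivative into a derivative on the line, where the
    one-variable chain rule applies; no differentiability in the sense of Frechet
    is required. *)
Lemma is_derive_line f x v (df : R) :
  is_derive x v f df <-> is_derive (0 : R) (1 : R) (fun h => f (h *: v + x)) df.
Proof.
have E : (fun h : R => h^-1 *: (((fun h => f (h *: v + x)) \o shift 0) (h *: 1) -
            f (0 *: v + x))) = (fun h : R => h^-1 *: ((f \o shift x) (h *: v) - f x)).
  by apply/funext => h /=; rewrite addr0 [h *: 1]mulr1 scale0r add0r.
split=> -[df1 df2]; split.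
- by rewrite /derivable E.
- by rewrite /derive E.
- by move: df1; rewrite /derivable E.
- by move: df2; rewrite /derive E.
Qed.

Lemma is_derive_fun_comp (F : R -> R) f x v (dF df : R) :
  is_derive (f x) (1 : R) F dF -> is_derive x v f df ->
  is_derive x v (fun y => F (f y)) (dF * df).
Proof.
move=> hF /is_derive_line hf; apply/is_derive_line.
by apply: (@is_derive1_comp _ F (fun h => f (h *: v + x))); rewrite ?scale0r ?add0r.
Qed.

Lemma is_derive_ext f g x v (df : R) :
  f =1 g -> is_derive x v f df -> is_derive x v g df.
Proof. by move=> /funext ->. Qed.

End derivation_rules.

Section flat.
Context {R : realType}.
Implicit Types (P Q : {poly R}) (x : R).

(** The functions P(1/x) exp(-1/x), extended by 0: a family closed under
    differentiation, which makes exp(-1/x) smooth at the origin. *)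
Definition flat P x : R := if 0 < x then P.[x^-1] * expR (- x^-1) else 0.

Lemma flatD P Q x : flat (P + Q) x = flat P x + flat Q x.
Proof. by rewrite /flat; case: ifP => _; rewrite ?addr0// hornerD mulrDl. Qed.

Lemma flat0 x : flat 0 x = 0.
Proof. by rewrite /flat horner0 mul0r if_same. Qed.

Lemma flat_sub0 P x : x <= 0 -> flat P x = 0.
Proof. by rewrite /flat leNgt => /negbTE ->. Qed.

(** The exponential series dominates its term of degree n + 1. *)
Lemma flatXn_le n x : `|flat 'X^n x| <= n.+1`!%:R * `|x|.
Proof.
rewrite /flat; case: ltP => x0; last by rewrite normr0 mulr_ge0.
rewrite hornerXn ger0_norm ?mulr_ge0 ?expR_ge0 ?exprn_ge0 ?invr_ge0 ?(ltW x0)//.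
rewrite gtr0_norm// expRN ler_pdivrMr ?expR_gt0//.
have := @expR_ge1Dxn R x^-1 n; rewrite invr_ge0 ltW// => /(_ isT) h.
have {}h : x^-1 ^+ n.+1 / n.+1`!%:R <= expR x^-1 by apply: le_trans h; rewrite lerDr.
rewrite ler_pdivrMr ?ltr0n ?fact_gt0// in h.
have -> : x^-1 ^+ n = x^-1 ^+ n.+1 * x by rewrite exprSr mulfVK ?gt_eqF.
by rewrite mulrAC ler_pM2r// mulrC.
Qed.

Lemma flat_cvg0 P : flat P x @[x --> (0 : R)] --> (0 : R).
Proof.
have Xn n : flat 'X^n x @[x --> (0 : R)] --> (0 : R).
  apply/norm_cvg0P.
  apply: (@squeeze_cvgr _ _ _ _ (cst 0) (fun x => n.+1`!%:R * `|x|)).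
  - by near=> x; rewrite flatXn_le normr_ge0.
  - exact: cvg_cst.
  - rewrite -[X in _ --> X](mulr0 (n.+1`!%:R)); apply: cvgMr.
    by rewrite -[X in _ --> X](normr0 R); exact: norm_continuous.
rewrite -(coefK P) poly_def.
elim/big_ind: _ => [|p q hp hq|i _].
- by under eq_fun do rewrite flat0; exact: cvg_cst.
- rewrite -[X in _ --> X](addr0 (0 : R)).
  by under eq_fun do rewrite flatD; exact: cvgD.
- rewrite -[X in _ --> X](mulr0 P`_i).
  under eq_fun do (rewrite /flat hornerZ -mulrA
    -[X in if _ then _ else X](mulr0 P`_i) -(fun_if ( *%R P`_i)) -/(flat _ _)).
  exact: cvgMr.
Unshelve. all: by end_near. Qed.

Lemma is_derive_flat P x :
  is_derive x (1 : R) (flat P) (flat ('X^2 * (P - P^`())) x).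
Proof.
have [x0|x0|->] := ltgtP x 0.
- rewrite flat_sub0 ?ltW//.
  apply: (@near_eq_is_derive _ _ _ (cst 0)).
  near=> y; rewrite flat_sub0//; near: y.
  by apply: filterS (lt_nbhsl x0) => y /ltW.
-
  have hV : is_derive x (1 : R) (fun y : R => y^-1) (- x ^- 2).
    have := @is_deriveV R id x 1 1 (lt0r_neq0 x0) (is_derive_id _ _).
    by rewrite [_ *: 1]mulr1.
  have hP : is_derive x^-1 (1 : R) (horner P) (P^`()).[x^-1].
    by rewrite derivE derive1E; apply: derivableP; exact: derivable_horner.
  have hE := is_derive_funM (is_derive_fun_comp hP hV)
    (is_derive_fun_comp (is_derive_expR _) (is_derive_funN hV)).
  have nE : \near x, P.[x^-1] * expR (- x^-1) = flat P x.
    near=> y; rewrite /flat ifT//; near: y; exact: lt_nbhsr.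
  apply: is_derive_conv (near_eq_is_derive nE hE) _.
  rewrite /flat x0 hornerM hornerXn hornerD hornerN exprVn.
  by ring.
- apply/is_derive1_caratheodory; exists (flat ('X * P)); split.
  + move=> z; rewrite [flat P 0]flat_sub0// !subr0 /flat; case: ltP => z0; last by rewrite mul0r.
    rewrite hornerM hornerX.
    by field; rewrite gt_eqF.
  + by have := flat_cvg0 ('X * P); rewrite -{2}(flat_sub0 ('X * P) (lexx 0)).
  + by rewrite !flat_sub0.
Unshelve. all: by end_near. Qed.

Lemma flat1_gt0 x : 0 < x -> 0 < flat 1 x.
Proof. by move=> x0; rewrite /flat x0 hornerC mul1r expR_gt0. Qed.

Lemma flat1_ge0 x : 0 <= flat 1 x.
Proof. by rewrite /flat; case: ifP => // _; rewrite hornerC mul1r expR_ge0. Qed.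

Lemma flat_continuous P : continuous (flat P).
Proof. by move=> x; apply: is_derive_continuous; exact: is_derive_flat. Qed.

Definition sbump x : R := flat 1 (1 - x ^+ 2).

Lemma sbump_continuous : continuous sbump.
Proof.
move=> x; apply: (@continuous_comp _ _ _ (fun x : R => 1 - x ^+ 2)); last exact: flat_continuous.
by apply: continuousB; [exact: cst_continuous|exact: exprn_continuous].
Qed.

Lemma sbump_ge0 x : 0 <= sbump x. Proof. exact: flat1_ge0. Qed.

Lemma sbump_gt0 x : `|x| < 1 -> 0 < sbump x.
Proof. by move=> x1; rewrite flat1_gt0// subr_gt0 -real_normK ?num_real// expr_lt1. Qed.

Lemma sbump_eq0 x : 1 <= `|x| -> sbump x = 0.
Proof. by move=> x1; apply: flat_sub0; rewrite subr_le0 -real_normK ?num_real// exprn_ege1. Qed.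


(** A primitive of the bump, normalised to go from 1 to 0. It serves as a radial
    cutoff and, as a difference of two translates, as the primitive of a
    difference of two bumps. *)
Lemma step_exists : exists (T : R -> R) (c : R), [/\ 0 < c,
  forall x, is_derive x (1 : R) T (- c * sbump x),
  forall x, x <= -1 -> T x = 1, forall x, 1 <= x -> T x = 0 &
  forall x, 0 <= T x <= 1].
Proof.
have [F [F0 dF]] := continuous_antiderivative sbump_continuous.
have cF : continuous F by move=> x; exact: is_derive_continuous (dF x).
have Fle : {homo F : x y / x <= y}.
  move=> x y xy; rewrite -subr_ge0.
  have [|c _ ->] := @MVT_segment _ F sbump x y xy (fun z _ => dF z).
    exact/continuous_subspaceT.
  by rewrite mulr_ge0 ?sbump_ge0 ?subr_ge0.
have Fcst x y : x <= y -> (forall z, z \in `]x, y[%R -> 1 <= `|z|) -> F x = F y.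
  rewrite le_eqVlt => /predU1P[->//|xy h].
  have [|c cxy /eqP] := @MVT _ F sbump x y xy (fun z _ => dF z).
    exact/continuous_subspaceT.
  by rewrite sbump_eq0 ?h// mul0r subr_eq0 => /eqP.
have F1 x : 1 <= x -> F x = F 1.
  move=> x1; apply/esym/Fcst => // z; rewrite in_itv/= => /andP[z1 _].
  by rewrite gtr0_norm ?(lt_trans ltr01 z1)// ltW.
have FN1 x : x <= -1 -> F x = F (-1).
  move=> x1; apply/Fcst => // z; rewrite in_itv/= => /andP[_ z1].
  by rewrite ltr0_norm; lra.
have Fpos : F (-1) < F 1.
  have [||c + Fc] := @MVT _ F sbump (-1) 1 _ (fun z _ => dF z).
  - by lra.
  - exact/continuous_subspaceT.
  - rewrite -subr_gt0 Fc in_itv/= => c1; apply: mulr_gt0; last lra.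
    by rewrite sbump_gt0// ltr_norml.
set D := F 1 - F (-1); have D0 : 0 < D by rewrite subr_gt0.
exists (fun x => (F 1 - F x) * D^-1), D^-1; split.
- by rewrite invr_gt0.
- move=> x; apply: is_derive_conv (is_derive_funM
    (is_derive_funB (is_derive_cst (F 1) x 1) (dF x)) (is_derive_cst D^-1 x 1)) _.
  by rewrite mulr0 addr0 sub0r !mulNr mulrC.
- by move=> x x1; rewrite (FN1 x)// mulfV// gt_eqF.
- by move=> x x1; rewrite (F1 x)// subrr mul0r.
- move=> x; rewrite divr_ge0 ?(ltW D0)//=; last first.
    rewrite subr_ge0; have [x1|/ltW /Fle//] := leP 1 x; by rewrite (F1 x).
  rewrite ler_pdivrMr// mul1r lerD2l lerN2.
  by have [x1|/ltW /Fle//] := leP x (-1); rewrite (FN1 x).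
Qed.

End flat.

(** * Weierstrass approximation *)

Section weierstrass.
Context {R : realType}.
Implicit Types (f g : R -> R) (phi psi : nat -> R) (x : R).

(** The Bernstein polynomial with values phi 0, ..., phi n: the expectation of
    phi under a binomial law, computed by conditioning on one trial. In this form
    positivity, linearity and the variance are immediate inductions. *)
Fixpoint bernstein n phi : {poly R} :=
  if n is m.+1 then 'X * bernstein m (phi \o succn) + (1 - 'X) * bernstein m phi
  else (phi 0%N)%:P.

Lemma bernsteinS n phi x : (bernstein n.+1 phi).[x] =
  x * (bernstein n (phi \o succn)).[x] + (1 - x) * (bernstein n phi).[x].
Proof. by rewrite /= !hornerE. Qed.

Lemma bernstein_le n phi psi x : 0 <= x <= 1 ->
  (forall k, (k <= n)%N -> phi k <= psi k) ->
  (bernstein n phi).[x] <= (bernstein n psi).[x].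
Proof.
move=> /andP[x0 x1]; elim: n phi psi => [|n IH] phi psi h.
  by rewrite /= !hornerC h.
rewrite !bernsteinS lerD// ler_wpM2l ?subr_ge0//.
  by apply: IH => k kn; exact: h.
by apply: IH => k kn; apply: h; exact: leqW.
Qed.

Lemma bernsteinD n phi psi x :
  (bernstein n (fun k => phi k + psi k)).[x] = (bernstein n phi).[x] + (bernstein n psi).[x].
Proof.
elim: n phi psi => [|n IH] phi psi; first by rewrite /= !hornerC.
by rewrite !bernsteinS -/(comp _ _) !IH; ring.
Qed.

Lemma bernsteinZ n c phi x :
  (bernstein n (fun k => c * phi k)).[x] = c * (bernstein n phi).[x].
Proof.
elim: n phi => [|n IH] phi; first by rewrite /= !hornerC.
by rewrite !bernsteinS !IH; ring.
Qed.

Lemma bernstein_cst n c x : (bernstein n (fun=> c)).[x] = c.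
Proof. by elim: n => [|n IH]; rewrite ?bernsteinS ?IH /= ?hornerC; [|ring]. Qed.

Lemma bernstein_var n a x :
  (bernstein n (fun k => (k%:R - a) ^+ 2)).[x] = n%:R * x * (1 - x) + (n%:R * x - a) ^+ 2.
Proof.
elim: n a => [|n IH] a; first by rewrite /= hornerC; ring.
rewrite bernsteinS IH.
have -> : (fun k => (k%:R - a) ^+ 2) \o succn = fun k => (k%:R - (a - 1)) ^+ 2.
  by apply/funext => k /=; rewrite -natr1; ring.
by rewrite IH -natr1; ring.
Qed.

Lemma itv_uniform_continuous f (a b e : R) :
  continuous f -> 0 < e ->
  exists2 d, 0 < d & forall s t, s \in `[a, b]%R -> `|t - s| < d -> `|f t - f s| < e.
Proof.
move=> cf e0.
have /compact_near_coveringP nc := @segment_compact R a b.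
have [|d /= d0 H] := nc R (0^'+) (fun d s => forall t, `|t - s| < d -> `|f t - f s| < e).
- move=> x _; have := cf x => /cvgrPdist_lt /(_ (e / 2)).
  rewrite divr_gt0// => /(_ isT) [r /= r0 hr].
  exists (ball x (r / 2), [set d | 0 < d < r / 2]); first split => //=.
  + by apply: nbhsx_ballx; rewrite divr_gt0.
  + near=> d; apply/andP; split; first by near: d; exact: nbhs_right_gt.
    by near: d; apply: nbhs_right_lt; rewrite divr_gt0.
  + move=> [y d] [/= xy /andP[d0 dr]] t ty.
    have h1 := hr t; have h2 := hr y.
    have {}h1 : `|f x - f t| < e / 2.
      apply: h1 => /=; rewrite (le_lt_trans (ler_distD y _ _))//.
      by rewrite [ltRHS](splitr r) ltrD// distrC (lt_trans ty).
    have {}h2 : `|f x - f y| < e / 2.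
      by apply: h2 => /=; rewrite (lt_le_trans xy)// ler_pdivrMr//; lra.
    rewrite (le_lt_trans (ler_distD (f x) _ _))//.
    by rewrite [ltRHS](splitr e) ltrD// distrC.
exists (d / 2); first by rewrite divr_gt0.
move=> s t sab ts; apply: (H (d / 2)) => //=.
- by rewrite sub0r normrN gtr0_norm ?divr_gt0// ltr_pdivrMr// ltr_pMr// ltr1n.
- by rewrite divr_gt0.
Unshelve. all: by end_near. Qed.

(** Chebyshev's argument: |f(k/n) - f(x)| is at most e/2 + D (k/n - x)^2, by
    uniform continuity when k/n is near x and by boundedness otherwise; the
    expectation of the square is of order 1/n. *)
Lemma weierstrass01 f (e : R) : continuous f -> 0 < e ->
  exists q : {poly R}, forall x, 0 <= x <= 1 -> `|q.[x] - f x| <= e.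
Proof.
move=> cf e0.
have e2 : 0 < e / 2 by rewrite divr_gt0.
have [d d0 hd] := @itv_uniform_continuous f 0 1 _ cf e2.
have [c1 _ hc1] := @EVT_max R (fun x => `|f x|) 0 1 ler01
  (continuous_subspaceT (fun x => continuous_comp (cf x) (@norm_continuous _ _ _))).
set C := `|f c1|.
have C0 : 0 <= C by exact: normr_ge0.
pose n := (Num.Def.truncn (4 * C / d ^+ 2 / e)).+1.
have n0 : 0 < n%:R :> R by rewrite ltr0n.
have nC : 4 * C / d ^+ 2 / e <= n%:R.
  by rewrite ltW// /n truncnS_gt.
exists (bernstein n (fun k => f (k%:R / n%:R))) => x x01.
set D := 2 * C / d ^+ 2.
have D0 : 0 <= D by rewrite divr_ge0 ?mulr_ge0 ?exprn_ge0// ltW.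
have key k : (k <= n)%N -> `|f (k%:R / n%:R) - f x| <= e / 2 + D / n%:R ^+ 2 * (k%:R - n%:R * x) ^+ 2.
  move=> kn; set s := k%:R / n%:R.
  have s01 : 0 <= s <= 1 by rewrite divr_ge0//= ler_pdivrMr// mul1r ler_nat.
  have -> : D / n%:R ^+ 2 * (k%:R - n%:R * x) ^+ 2 = D * (s - x) ^+ 2.
    by rewrite /s; field; rewrite gt_eqF.
  have [sx|sx] := ltP `|s - x| d.
    rewrite (le_trans (ltW (hd x s _ sx)))// ?in_itv//=.
    by rewrite lerDl mulr_ge0// sqr_ge0.
  rewrite (@le_trans _ _ (2 * C))//.
    rewrite (le_trans (ler_normB _ _))// mulr_natl mulr2n lerD// hc1// in_itv//=.
  rewrite -[leLHS]add0r lerD//; first exact: ltW.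
  rewrite /D -mulrA ler_peMr ?mulr_ge0//.
  rewrite ler_pdivlMl ?exprn_gt0// mulr1 -(@real_normK _ (s - x)) ?num_real//.
  by rewrite lerXn2r// nnegrE ltW.
have bound : (bernstein n (fun k => e / 2 + D / n%:R ^+ 2 * (k%:R - n%:R * x) ^+ 2)).[x] <= e.
  rewrite bernsteinD bernstein_cst bernsteinZ bernstein_var subrr expr0n/= addr0.
  rewrite [leRHS](splitr e) lerD2l.
  have -> : D / n%:R ^+ 2 * (n%:R * x * (1 - x)) = D * (x * (1 - x)) / n%:R.
    by field; rewrite gt_eqF.
  rewrite ler_pdivrMr//.
  have x1 : x * (1 - x) <= 1 by nra.
  rewrite (le_trans (ler_wpM2l D0 x1))// mulr1.
  rewrite ler_pdivrMr// in nC.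
  have -> : D = 4 * C / d ^+ 2 / 2 by rewrite /D; field; rewrite gt_eqF.
  lra.
rewrite -(bernstein_cst n (f x) x) ler_norml; apply/andP; split.
- rewrite lerNl opprB (le_trans _ bound)// lerBlDr -bernsteinD; apply: bernstein_le => // k kn.
  by have := key _ kn; rewrite ler_norml => /andP[]; lra.
- rewrite (le_trans _ bound)// lerBlDr -bernsteinD; apply: bernstein_le => // k kn.
  by have := key _ kn; rewrite ler_norml => /andP[]; lra.
Qed.

Lemma weierstrass f (M e : R) : continuous f -> 0 < M -> 0 < e ->
  exists q : {poly R}, forall x, 0 <= x <= M -> `|q.[x] - f x| <= e.
Proof.
move=> cf M0 e0.
have cfM : continuous (fun t => f (M * t)).
  by move=> t; apply: continuous_comp; [exact: mulrl_continuous|exact: cf].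
have [q hq] := weierstrass01 cfM e0.
exists (q \Po (M^-1 *: 'X)) => x /andP[x0 xM].
rewrite horner_comp hornerZ hornerX.
have := hq (M^-1 * x); rewrite mulVKf ?gt_eqF//; apply.
by rewrite mulr_ge0 ?invr_ge0 ?(ltW M0)//= ler_pdivrMl// mulr1.
Qed.

End weierstrass.

(** * Integration of partial derivatives over R^N *)

Section rV_topology.
Context {R : realType} {n : nat}.
Implicit Types (x y : 'rV[R]_n).

Lemma le_coord_norm x i : `|x 0 i| <= `|x|.
Proof.
rewrite [leRHS]/Num.norm /= mx_normrE; apply/bigmax_geP; right => /=.
by exists (0, i).
Qed.

Lemma norm_rV_lt x (e : R) : 0 < e -> (forall i, `|x 0 i| < e) -> `|x| < e.
Proof.
move=> e0 h; rewrite [ltLHS]/Num.norm /= mx_normrE.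
by apply/bigmax_ltP; split => // -[a i] _ /=; rewrite ord1.
Qed.

Lemma coord_continuous_rV i : continuous (fun x : 'rV[R]_n => x 0 i).
Proof. exact: coord_continuous. Qed.

Lemma measurable_coord i : measurable_fun setT (fun x : 'rV[R]_n => x 0 i).
Proof. exact: measurable_rV_coord. Qed.

Lemma measurable_box (A : 'I_n -> set R) : (forall i, measurable (A i)) ->
  measurable [set x : 'rV[R]_n | forall i, A i (x 0 i)].
Proof.
move=> mA; rewrite (_ : mkset _ =
    \bigcap_(i in [set: 'I_n]) (fun x : 'rV[R]_n => x 0 i) @^-1` (A i)).
  apply: fin_bigcap_measurable => // i _.
  by rewrite -[X in measurable X]setTI; exact: measurable_coord.
by apply/seteqP; split => x /= H i; [move=> _|]; exact: H.
Qed.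

(** The sigma-algebra is generated by the coordinates; an open set is the union
    of the countably many cubes with rational centre and radius 1/(m+1) inside
    it. *)
Lemma open_rV_measurable (O : set 'rV[R]_n) : open O -> measurable O.
Proof.
move=> oO.
pose B (q : 'rV[rat]_n * nat) := [set x : 'rV[R]_n |
  forall i, (ball (ratr (q.1 0 i) : R) q.2.+1%:R^-1) (x 0 i)].
rewrite (_ : O = \bigcup_(q : 'rV[rat]_n * nat) (if `[< B q `<=` O >] then B q else set0)).
  apply: countable_bigcupT_measurable => [|q]; first exact: countableP.
  case: ifP => // _.
  apply: (measurable_box (A := fun i => ball (ratr (q.1 0 i) : R) q.2.+1%:R^-1)) => i.
  by rewrite ball_itv; exact: measurable_itv.
apply/seteqP; split => [x Ox|x [q _]]; last first.
  by case: ifPn => // /asboolP; exact.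
have [e /= e0 xO] : exists2 e : R, 0 < e & ball x e `<=` O.
  by have /nbhs_ballP[e /= e0 h] := open_nbhs_nbhs (conj oO Ox); exists e.
pose m := Num.Def.truncn (2 / e).
have mlt : m.+1%:R^-1 < e / 2.
  by rewrite -[e / 2]invf_div ltf_pV2 ?posrE ?ltr0n ?divr_gt0// truncnS_gt.
have m0 : 0 < m.+1%:R^-1 :> R by rewrite invr_gt0 ltr0n.
have q_ex i : {q : rat | `|x 0 i - ratr q| < m.+1%:R^-1}.
  apply: cid.
  have [|q] := @rat_in_itvoo R (x 0 i - m.+1%:R^-1) (x 0 i + m.+1%:R^-1).
    by rewrite ltrBlDr -addrA ltrDl addr_gt0.
  rewrite in_itv/= => qx; exists q.
  by rewrite distrC ltr_distl.
pose q : 'rV[rat]_n := \row_i projT1 (q_ex i).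
exists (q, m) => //; rewrite ifT.
  by move=> i; rewrite /ball/= mxE distrC; exact: (projT2 (q_ex i)).
apply/asboolP => y Bqy; apply: xO; rewrite -ball_normE/=.
apply: norm_rV_lt => // i; rewrite !mxE.
have := Bqy i; rewrite /ball/= mxE => yq.
have xq := projT2 (q_ex i).
rewrite (le_lt_trans (ler_distD (ratr (projT1 (q_ex i))) _ _))//.
by rewrite [ltRHS](splitr e) ltrD ?(lt_trans xq)// (lt_trans yq).
Qed.

Lemma continuous_rV_measurable (f : 'rV[R]_n -> R) : continuous f -> measurable_fun setT f.
Proof.
move=> /continuousP cf; apply: (measurability _ (RGenOInfty.measurableE R)).
move=> _ [_ [a ->] <-]; rewrite setTI; apply: open_rV_measurable.
by apply: cf; exact: interval_open.
Qed.

(** Vanishing outside the cube of half-side M, coordinate by coordinate: the form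
    of compact support that passes to sections of a function. *)
Definition supp_box (M : R) (f : 'rV[R]_n -> R) :=
  forall x j, M < `|x 0 j| -> f x = 0.

Definition box (M : R) := [set x : 'rV[R]_n | forall i, `[- M, M]%classic (x 0 i)].

Lemma boxP M x : box M x <-> forall i, `|x 0 i| <= M.
Proof.
by split => h i; have := h i; rewrite /= in_itv/= ler_norml.
Qed.

Lemma notin_box M x : ~ box M x -> exists j, M < `|x 0 j|.
Proof.
move=> h; apply: contrapT => /forallNP k; apply: h; apply/boxP => i.
by rewrite leNgt; apply/negP/k.
Qed.

Lemma measurable_boxM M : measurable (box M).
Proof.
by apply: (measurable_box (A := fun=> `[- M, M]%classic)) => i; exact: measurable_itv.
Qed.

Lemma compact_box M : compact (box M).
Proof.
apply: (@rV_compact _ _ (fun=> `[- M, M]%classic)) => i; exact: segment_compact.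
Qed.

Lemma box_finite_measure M : (lebesgue_rV n (box M) < +oo)%E.
Proof.
rewrite (@lebesgue_rV_box R n (fun=> `[- M, M]%classic))//.
suff : (\prod_(i < n) @lebesgue_measure R `[(- M)%R, M]%classic \is a fin_num)%E.
  by move=> h; rewrite ltey_eq h.
elim/big_ind: _ => [//|a b ha hb|i _]; first exact: fin_numM.
by rewrite lebesgue_measure_itv/=; case: ifP.
Qed.

Lemma bounded_supp_integrable (M C : R) (f : 'rV[R]_n -> R) : measurable_fun setT f ->
  (forall x, `|f x| <= C) -> supp_box M f ->
  (lebesgue_rV n).-integrable setT (EFin \o f).
Proof.
move=> mf fC fM.
have -> : EFin \o f = (EFin \o f) \_ (box M).
  apply/funext => x; rewrite patchE; case: ifPn => // /negP; rewrite inE => /notin_box[j xj].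
  by rewrite /= (fM x j).
apply/(integrable_mkcond _ (measurable_boxM M)).
apply: measurable_bounded_integrable.
- exact: measurable_boxM.
- exact: box_finite_measure.
- exact: measurable_funTS.
- exists C; split; first exact: num_real.
  by move=> y Cy x _; apply: (le_trans (fC x)); exact: ltW.
Qed.

Lemma continuous_supp_bounded (M : R) (f : 'rV[R]_n -> R) : continuous f -> supp_box M f ->
  exists C, forall x, `|f x| <= C.
Proof.
move=> cf fM.
have [B [_ hB]] := compact_bounded (continuous_compact (continuous_subspaceT cf) (@compact_box M)).
exists (`|B| + 1) => x.
have [Bx|/notin_box[j xj]] := pselect (box M x).
  apply: (hB (`|B| + 1)); first by rewrite ltr_pwDr// ler_norm.
  by exists x.
by rewrite (fM x j)// normr0 addr_ge0.
Qed.

Lemma continuous_supp_integrable (M : R) (f : 'rV[R]_n -> R) : continuous f -> supp_box M f ->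
  (lebesgue_rV n).-integrable setT (EFin \o f).
Proof.
move=> cf fM; have [C fC] := continuous_supp_bounded cf fM.
exact: bounded_supp_integrable (continuous_rV_measurable cf) fC fM.
Qed.

End rV_topology.

Section integral_partial.
Context {R : realType}.

Lemma integral_derivative1 (g dg : R -> R) (M : R) :
  (forall t, is_derive t (1 : R) g (dg t)) -> continuous dg ->
  (forall t, M < `|t| -> g t = 0) ->
  (\int[lebesgue_measure]_t (dg t)%:E = 0)%E.
Proof.
move=> hg cdg gM.
set K := `|M| + 1.
have MK : M < K by rewrite ltr_pwDr// ler_norm.
have K0 : 0 < K by rewrite ltr_pwDr.
have dgM t : M < `|t| -> dg t = 0.
  move=> tM; have [_ <-] := hg t.
  rewrite -(derive_cst (0 : R) t (1 : R)); apply: near_eq_derive.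
  near=> s; rewrite /= gM//; near: s.
  by apply: (cvgr_gt _ (@norm_continuous _ _ t)).
have -> : (fun t => (dg t)%:E) = (fun t => (dg t)%:E) \_ `[- K, K].
  apply/funext => t; rewrite patchE; case: ifPn => // /negP; rewrite inE/= in_itv/= -ler_norml.
  by move=> /negP; rewrite -ltNge => Kt; rewrite dgM// (lt_trans MK).
rewrite -integral_mkcond (@continuous_FTC2 _ dg g).
- by rewrite !gM ?subee// ?normrN gtr0_norm.
- by rewrite gtrN.
- exact: continuous_subspaceT.
- split.
  + by move=> t _; have [] := hg t.
  + by apply: cvg_at_right_filter; exact: is_derive_continuous (hg _).
  + by apply: cvg_at_left_filter; exact: is_derive_continuous (hg _).
- by move=> t _; rewrite derive1E; have [] := hg t.
Unshelve. all: by end_near. Qed.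

Lemma rV_cons_line0 n (h t : R) (y : 'rV[R]_n) :
  rV_cons (h + t, y) = h *: delta_mx 0 ord0 + rV_cons (t, y).
Proof.
apply/rowP => i; rewrite !mxE eqxx/=.
case: unliftP => [j|] -> /=; last by rewrite mulr1.
by rewrite mulr0 add0r.
Qed.

Lemma rV_cons_lineS n (h t : R) (j : 'I_n) (y : 'rV[R]_n) :
  rV_cons (t, h *: delta_mx 0 j + y) = h *: delta_mx 0 (lift ord0 j) + rV_cons (t, y).
Proof.
apply/rowP => i; rewrite !mxE eqxx/=.
case: unliftP => [k|] -> /=; first by rewrite !mxE eqxx/= (inj_eq lift_inj).
by rewrite mulr0 add0r.
Qed.

Lemma rV_cons_continuous n : continuous (@rV_cons R n : R * 'rV[R]_n -> 'rV[R]_n.+1).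
Proof.
move=> p; apply/cvgrPdist_lt => e e0.
near=> q.
have pq : `|p - q| < e by near: q; have := nbhsx_ballx p e e0; rewrite -ball_normE.
apply: norm_rV_lt => // i; rewrite !mxE; apply: le_lt_trans pq.
rewrite [leRHS]prod_normE/= le_max.
case: unliftP => [j|] _ /=; last by rewrite lexx.
by have := le_coord_norm (p.2 - q.2) j; rewrite !mxE => ->; rewrite orbT.
Unshelve. all: by end_near. Qed.

Lemma pairr_continuous (T U : topologicalType) (t : T) : continuous (fun y : U => (t, y)).
Proof.
move=> y A [[P Q]/= [nP nQ] PQA]; apply: filterS nQ => z Qz; apply: PQA.
by split => //=; exact: nbhs_singleton.
Qed.

Lemma pairl_continuous (T U : topologicalType) (y : U) : continuous (fun t : T => (t, y)).
Proof.
move=> t A [[P Q]/= [nP nQ] PQA]; apply: filterS nP => z Pz; apply: PQA.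
by split => //=; exact: nbhs_singleton.
Qed.

Lemma supp_box_cons n (M : R) (f : 'rV[R]_n.+1 -> R) t : supp_box M f ->
  supp_box M (fun y => f (rV_cons (t, y))).
Proof.
by move=> fM y j yj; apply: (fM _ (lift ord0 j)); rewrite mxE liftK.
Qed.

Lemma supp_box_derive n (i : 'I_n) (M : R) (f df : 'rV[R]_n -> R) :
  (forall x, is_derive x (delta_mx 0 i) f (df x)) -> supp_box M f -> supp_box M df.
Proof.
move=> hf fM x j xj; have [_ <-] := hf x.
rewrite -(derive_cst (0 : R) x (delta_mx 0 i)); apply: near_eq_derive.
near=> y; rewrite /= (fM y j)//; near: y.
have h : `|y 0 j| @[y --> x] --> `|x 0 j|.
  by apply: cvg_norm; exact: coord_continuous_rV.
exact: (cvgr_gt _ h).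
Unshelve. all: by end_near. Qed.

Lemma integral_rV_cons n (f : 'rV[R]_n.+1 -> R) :
  (lebesgue_rV n.+1).-integrable setT (EFin \o f) ->
  let g := fun p => (f (rV_cons p))%:E in
  (lebesgue_measure \x lebesgue_rV n)%E.-integrable setT g /\
  (\int[lebesgue_rV n.+1]_x (f x)%:E = \int[lebesgue_measure \x lebesgue_rV n]_p g p)%E.
Proof.
move=> fi g; have mf := measurable_int _ fi.
have mc := @measurable_rV_cons R n.
have gi : (lebesgue_measure \x lebesgue_rV n)%E.-integrable setT g.
  apply/integrableP; split; first by apply: (measurableT_comp mf mc).
  move/integrableP : fi => [_].
  rewrite /= /lebesgue_rV_step ge0_integral_pushforward//.
  by apply/measurable_EFinP; apply: measurableT_comp => //; exact/measurable_EFinP.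
split => //.
by rewrite /= /lebesgue_rV_step integral_pushforward// preimage_setT.
Qed.

(** Induction on the dimension, following the recursive definition of Lebesgue
    measure: Fubini integrates first in the direction of differentiation when it
    is the first coordinate, and is otherwise the induction hypothesis on the
    sections. *)
Lemma integral_partial n (i : 'I_n) (M : R) (psi dpsi : 'rV[R]_n -> R) :
  (forall x, is_derive x (delta_mx 0 i) psi (dpsi x)) -> continuous dpsi ->
  supp_box M psi ->
  (\int[lebesgue_rV n]_x (dpsi x)%:E = 0)%E.
Proof.
elim: n i psi dpsi => [[]//|n IH] i psi dpsi hpsi cdpsi psiM.
have dpsiM := supp_box_derive hpsi psiM.
have [gi ->] := integral_rV_cons (continuous_supp_integrable cdpsi dpsiM).
case: (unliftP ord0 i) hpsi => [j|] -> hpsi.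
- rewrite -integral12_prod_meas1//; apply: integral0_eq => t _.
  rewrite /fubini_F; apply: (IH j (fun y => psi (rV_cons (t, y))) (fun y => dpsi (rV_cons (t, y)))).
  + move=> y; apply/is_derive_line; have /is_derive_line := hpsi (rV_cons (t, y)).
    by apply: is_derive_ext => h; rewrite rV_cons_lineS.
  + move=> y; apply: (continuous_comp (f := fun y => rV_cons (t, y))); last exact: cdpsi.
    apply: (continuous_comp (f := fun y : 'rV[R]_n => (t, y))); last exact: rV_cons_continuous.
    exact: pairr_continuous.
  + exact: supp_box_cons.
- rewrite -integral21_prod_meas1//; apply: integral0_eq => y _.
  rewrite /fubini_G; apply: (@integral_derivative1 (fun t => psi (rV_cons (t, y))) _ M).
  + move=> t; apply/is_derive_line; have /is_derive_line := hpsi (rV_cons (t, y)).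
    by apply: is_derive_ext => h; rewrite -rV_cons_line0 [_ *: 1]mulr1.
  + move=> t; apply: (continuous_comp (f := fun t => rV_cons (t, y))); last exact: cdpsi.
    apply: (continuous_comp (f := fun t : R => (t, y))); last exact: rV_cons_continuous.
    exact: pairl_continuous.
  + by move=> t Mt; apply: (psiM _ ord0); rewrite mxE unlift_none.
Qed.

End integral_partial.

(** * A class of smooth functions *)

Section smooth_class.
Context {R : realType} {N : nat}.
Implicit Types (f g phi : 'rV[R]_N -> R) (x : 'rV[R]_N).

(** Smoothness is a condition on all iterated partial derivatives, unpleasant to
    check on a composite function. Each function of this inductive class is
    continuous and has partial derivatives in the class, so the class consists of
    smooth functions; it contains those of the proof. *)
Inductive smooth_expr : ('rV[R]_N -> R) -> Prop :=
| SE_const c : smooth_expr (fun=> c)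
| SE_coord i : smooth_expr (fun x => x 0 i)
| SE_add f g : smooth_expr f -> smooth_expr g -> smooth_expr (fun x => f x + g x)
| SE_mul f g : smooth_expr f -> smooth_expr g -> smooth_expr (fun x => f x * g x)
| SE_flat P f : smooth_expr f -> smooth_expr (fun x => flat P (f x))
| SE_bump_prim (F : R -> R) c f :
    (forall t, is_derive t (1 : R) F (c * sbump t)) ->
    smooth_expr f -> smooth_expr (fun x => F (f x))
| SE_smooth phi : smooth phi -> smooth_expr phi.

Lemma SE_exp f n : smooth_expr f -> smooth_expr (fun x => f x ^+ n).
Proof.
move=> hf; elim: n => [|n IH].
  by rewrite (_ : (fun x => _) = fun=> 1); [exact: SE_const|apply/funext => x; rewrite expr0].
rewrite (_ : (fun x => _) = fun x => f x * f x ^+ n); first exact: SE_mul.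
by apply/funext => x; rewrite exprS.
Qed.

Lemma SE_sum n (F : 'I_n -> 'rV[R]_N -> R) : (forall i, smooth_expr (F i)) ->
  smooth_expr (fun x => \sum_i F i x).
Proof.
elim: n F => [|n IH] F hF.
  rewrite (_ : (fun x => _) = fun=> 0); first exact: SE_const.
  by apply/funext => x; rewrite big_ord0.
rewrite (_ : (fun x => _) = fun x => F ord0 x + \sum_i F (lift ord0 i) x).
  by apply: SE_add => //; exact: IH.
by apply/funext => x; rewrite big_ord_recl.
Qed.

Lemma SE_prod n (F : 'I_n -> 'rV[R]_N -> R) : (forall i, smooth_expr (F i)) ->
  smooth_expr (fun x => \prod_i F i x).
Proof.
elim: n F => [|n IH] F hF.
  rewrite (_ : (fun x => _) = fun=> 1); first exact: SE_const.
  by apply/funext => x; rewrite big_ord0.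
rewrite (_ : (fun x => _) = fun x => F ord0 x * \prod_i F (lift ord0 i) x).
  by apply: SE_mul => //; exact: IH.
by apply/funext => x; rewrite big_ord_recl.
Qed.

Lemma SE_bump f : smooth_expr f -> smooth_expr (fun x => sbump (f x)).
Proof.
move=> hf; apply: SE_flat.
rewrite (_ : (fun x => _) = fun x => 1 + (-1) * f x ^+ 2).
  by apply: SE_add; [exact: SE_const|apply: SE_mul; [exact: SE_const|exact: SE_exp]].
by apply/funext => x; rewrite mulN1r.
Qed.

Lemma SE_horner (q : {poly R}) f : smooth_expr f -> smooth_expr (fun x => q.[f x]).
Proof.
move=> hf.
rewrite (_ : (fun x => _) = fun x => \sum_(i < size q) q`_i * f x ^+ i).
  by apply: SE_sum => i; apply: SE_mul; [exact: SE_const|exact: SE_exp].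
by apply/funext => x; rewrite horner_coef.
Qed.

Lemma is_derive_coord (x : 'rV[R]_N) i j :
  is_derive x (delta_mx 0 i) (fun x : 'rV[R]_N => x 0 j) (j == i)%:R.
Proof.
apply/is_derive_line.
rewrite (_ : (fun h => _) = fun h : R => h * (j == i)%:R + x 0 j); last first.
  by apply/funext => h; rewrite !mxE eqxx.
apply: is_derive_conv (is_derive_funD (is_derive_funM (is_derive_id (0 : R) (1 : R))
  (is_derive_cst ((j == i)%:R : R) (0 : R) (1 : R))) (is_derive_cst (x 0 j) (0 : R) (1 : R))) _.
by rewrite mulr0 !addr0 mul1r.
Qed.

Lemma smooth_exprP f : smooth_expr f -> continuous f /\
  forall i, exists2 g, smooth_expr g & forall x, is_derive x (delta_mx 0 i) f (g x).
Proof.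
elim=> {f}.
- move=> c; split; first exact: cst_continuous.
  by move=> i; exists (fun=> 0); [exact: SE_const|move=> x; exact: is_derive_cst].
- move=> j; split; first exact: coord_continuous_rV.
  move=> i; exists (fun=> (j == i)%:R); first exact: SE_const.
  by move=> x; exact: is_derive_coord.
- move=> f g hf [cf df] hg [cg dg]; split.
    by move=> x; apply: continuousD; [exact: cf|exact: cg].
  move=> i; have [f' hf' df'] := df i; have [g' hg' dg'] := dg i.
  exists (fun x => f' x + g' x); first exact: SE_add.
  by move=> x; exact: is_derive_funD.
- move=> f g hf [cf df] hg [cg dg]; split.
    by move=> x; apply: continuousM; [exact: cf|exact: cg].
  move=> i; have [f' hf' df'] := df i; have [g' hg' dg'] := dg i.
  exists (fun x => f' x * g x + f x * g' x); first by apply: SE_add; exact: SE_mul.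
  by move=> x; exact: is_derive_funM.
- move=> P f hf [cf df]; split.
    by move=> x; apply: (continuous_comp (cf x)); exact: flat_continuous.
  move=> i; have [f' hf' df'] := df i.
  exists (fun x => flat ('X^2 * (P - P^`())) (f x) * f' x).
    by apply: SE_mul => //; exact: SE_flat.
  by move=> x; apply: is_derive_fun_comp => //; exact: is_derive_flat.
- move=> F c f dF hf [cf df]; split.
    by move=> x; apply: (continuous_comp (cf x)); exact: is_derive_continuous (dF _).
  move=> i; have [f' hf' df'] := df i.
  exists (fun x => c * sbump (f x) * f' x).
    by apply: SE_mul => //; apply: SE_mul; [exact: SE_const|exact: SE_bump].
  by move=> x; apply: is_derive_fun_comp.
- move=> phi hphi; have [cphi dphi] := hphi [::]; split=> // i.
  exists (partial i phi); last by move=> x; exact/derivableP/dphi.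
  by apply: SE_smooth => s; have := hphi (rcons s i); rewrite foldr_rcons.
Qed.

Lemma smooth_expr_continuous f : smooth_expr f -> continuous f.
Proof. by move=> /smooth_exprP[]. Qed.

Lemma smooth_expr_derive f i x : smooth_expr f ->
  is_derive x (delta_mx 0 i) f (partial i f x).
Proof.
move=> /smooth_exprP[_ /(_ i)[g _ /(_ x) h]].
by apply: derivableP; have [] := h.
Qed.

Lemma smooth_expr_partial f i : smooth_expr f -> smooth_expr (partial i f).
Proof.
move=> /smooth_exprP[_ /(_ i)[g hg dg]].
by rewrite (_ : partial i f = g)//; apply/funext => x; have [] := dg x.
Qed.

Lemma smooth_expr_smooth f : smooth_expr f -> smooth f.
Proof.
move=> hf s; have hD : smooth_expr (foldr partial f s).
  by elim: s => //= i s; exact: smooth_expr_partial.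
split; first exact: smooth_expr_continuous.
by move=> i x; have [] := smooth_expr_derive i x hD.
Qed.

Lemma test_functionP phi :
  test_function phi <-> smooth_expr phi /\ exists M, supp_box M phi.
Proof.
split=> [[sphi cphi]|[sphi [M phiM]]].
  split; first exact: SE_smooth.
  have [B [_ hB]] := compact_bounded cphi.
  exists (`|B| + 1) => x j xj; apply/eqP/negPn/negP => phix.
  have : `|x| <= `|B| + 1.
    apply: (hB (`|B| + 1)); first by rewrite ltr_pwDr// ler_norm.
    exact: subset_closure.
  by rewrite leNgt (lt_le_trans xj)// le_coord_norm.
split; first exact: smooth_expr_smooth.
apply: (subclosed_compact _ (@compact_box _ _ M)); first exact: closed_closure.
have cl : closed (@box R N M).
  by apply: compact_closed; [exact: norm_hausdorff|exact: compact_box].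
apply: subset_trans cl; apply: closureS => x /= phix.
apply: contrapT => /notin_box[j xj].
by move: phix; rewrite (phiM x j)// eqxx.
Qed.

End smooth_class.

(** * Integrable functions and weak gradients *)

Section integrable_functions.
Context {R : realType} {N : nat}.
Implicit Types (u f g phi : 'rV[R]_N -> R) (x : 'rV[R]_N) (M C : R).
Local Notation mu := (@lebesgue_rV R N).

Definition integ f := mu.-integrable setT (EFin \o f).

Lemma integ_measurable f : integ f -> measurable_fun setT f.
Proof. by move=> /integrableP[/measurable_EFinP]. Qed.

Lemma integD f g : integ f -> integ g -> integ (fun x => f x + g x).
Proof. by move=> hf hg; exact: (integrableD measurableT hf hg). Qed.

Lemma integB f g : integ f -> integ g -> integ (fun x => f x - g x).
Proof. by move=> hf hg; exact: (integrableB measurableT hf hg). Qed.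

Lemma integZ c f : integ f -> integ (fun x => c * f x).
Proof. by move=> hf; exact: (integrableZl measurableT c hf). Qed.

Lemma integ_le f g : measurable_fun setT f -> (forall x, `|f x| <= g x) ->
  integ g -> integ f.
Proof.
move=> mf fg hg; apply: le_integrable hg => //; first exact/measurable_EFinP.
by move=> x _; rewrite /= lee_fin (le_trans (fg x))// ler_norm.
Qed.

Lemma integ_norm f : integ f -> integ (fun x => `|f x|).
Proof.
move=> hf; apply: (@le_integrable _ _ _ _ _ measurableT _ (EFin \o f)) => //.
  by apply/measurable_EFinP; apply: measurableT_comp => //; exact: integ_measurable.
by move=> x _; rewrite /= lee_fin normr_id.
Qed.

Lemma integ_sum n (F : 'I_n -> 'rV[R]_N -> R) : (forall i, integ (F i)) ->
  integ (fun x => \sum_i F i x).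
Proof.
move=> hF; rewrite /integ (_ : EFin \o _ = fun x => (\sum_i (F i x)%:E)%E).
  by apply: integrable_sum => // i _; exact: hF.
by apply/funext => x /=; rewrite sumEFin.
Qed.

Lemma closed_rV_measurable (A : set 'rV[R]_N) : closed A -> measurable A.
Proof.
by move=> cA; rewrite -(setCK A); apply: measurableC; apply: open_rV_measurable; exact: closed_openC.
Qed.

Lemma compact_rV_measurable (A : set 'rV[R]_N) : compact A -> measurable A.
Proof.
by move=> cA; apply: closed_rV_measurable; apply: compact_closed => //; exact: norm_hausdorff.
Qed.

Lemma integ_L1loc f : integ f -> L1loc f.
Proof.
move=> hf; split; first exact: integ_measurable.
move=> K cK; have /integrableP[_] : mu.-integrable K (EFin \o f).
  by apply: integrableS hf => //; exact: compact_rV_measurable.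
by [].
Qed.

Lemma integ_ext f g : f =1 g -> integ f -> integ g.
Proof. by move=> /funext ->. Qed.

Lemma L1loc_integ u phi M C : L1loc u -> measurable_fun setT phi ->
  (forall x, box M x -> `|phi x| <= C) -> (forall x, ~ box M x -> u x * phi x = 0) ->
  integ (fun x => u x * phi x).
Proof.
move=> [mu_ hu] mphi phiC supp; rewrite /integ.
have -> : EFin \o (fun x => u x * phi x) = (EFin \o (fun x => u x * phi x)) \_ (box M).
  apply/funext => x; rewrite patchE; case: ifPn => // /negP; rewrite inE => h.
  by rewrite /= supp.
apply/(integrable_mkcond _ (measurable_boxM M)).
have ub : mu.-integrable (box M) (EFin \o u).
  apply/integrableP; split; first exact/measurable_EFinP/measurable_funTS.
  by apply: hu; exact: compact_box.
apply: le_integrable (integrableZl (measurable_boxM M) C ub).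
- exact: measurable_boxM.
- by apply/measurable_EFinP; apply: measurable_funM; exact: measurable_funTS.
- move=> x bx; rewrite /= lee_fin !normrM mulrC ler_wpM2r//.
  by rewrite (le_trans (phiC x bx))// ler_norm.
Qed.

Lemma box_bounded M f : continuous f -> exists C, forall x, box M x -> `|f x| <= C.
Proof.
move=> cf.
have [B [_ hB]] := compact_bounded (continuous_compact (continuous_subspaceT cf) (@compact_box R N M)).
exists (`|B| + 1) => x bx.
apply: (hB (`|B| + 1)); first by rewrite ltr_pwDr// ler_norm.
by exists x.
Qed.

Lemma L1locM_cont u phi M : L1loc u -> continuous phi ->
  (forall x, ~ box M x -> u x * phi x = 0) -> integ (fun x => u x * phi x).
Proof.
move=> hu cphi supp; have [C hC] := box_bounded M cphi.
by apply: L1loc_integ hC supp => //; exact: continuous_rV_measurable.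
Qed.

Lemma L1locM_supp u phi M : L1loc u -> continuous phi -> supp_box M phi ->
  integ (fun x => u x * phi x).
Proof.
move=> hu cphi phiM; apply: (@L1locM_cont _ _ M) => // x /notin_box[j xj].
by rewrite (phiM x j)// mulr0.
Qed.

Lemma continuous_L1loc f : continuous f -> L1loc f.
Proof.
move=> cf; split; first exact: continuous_rV_measurable.
move=> K cK.
have [B [_ hB]] := compact_bounded cK.
have KB : K `<=` box (`|B| + 1).
  move=> x Kx; apply/boxP => i; apply: (le_trans (le_coord_norm x i)).
  by apply: (hB (`|B| + 1)) => //; rewrite ltr_pwDr// ler_norm.
have [C hC] := box_bounded (`|B| + 1) cf.
have /integrableP[_] : mu.-integrable K (EFin \o f).
  apply: (integrableS (measurable_boxM _) (compact_rV_measurable cK) KB).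
  apply: measurable_bounded_integrable.
  - exact: measurable_boxM.
  - exact: box_finite_measure.
  - by apply: measurable_funTS; exact: continuous_rV_measurable.
  - exists C; split; first exact: num_real.
    by move=> y Cy x bx; apply: (le_trans (hC x bx)); exact: ltW.
by [].
Qed.

Lemma RintD f g : integ f -> integ g ->
  \int[mu]_x (f x + g x) = \int[mu]_x f x + \int[mu]_x g x.
Proof. by move=> hf hg; apply: RintegralD. Qed.

Lemma RintB f g : integ f -> integ g ->
  \int[mu]_x (f x - g x) = \int[mu]_x f x - \int[mu]_x g x.
Proof. by move=> hf hg; apply: RintegralB. Qed.

Lemma RintZ c f : integ f -> \int[mu]_x (c * f x) = c * \int[mu]_x f x.
Proof. by move=> hf; apply: RintegralZl. Qed.

Lemma Rint_sum n (F : 'I_n -> 'rV[R]_N -> R) : (forall i, integ (F i)) ->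
  \int[mu]_x (\sum_i F i x) = \sum_i \int[mu]_x F i x.
Proof.
elim: n F => [|n IH] F hF.
  rewrite big_ord0 (_ : (fun x => _) = cst 0); last by apply/funext => x; rewrite big_ord0.
  by rewrite /Rintegral integral0.
rewrite big_ord_recl -IH// -RintD//; last exact: integ_sum.
by apply: eq_Rintegral => x _; rewrite big_ord_recl.
Qed.

Lemma Rint_ext f g : f =1 g -> \int[mu]_x f x = \int[mu]_x g x.
Proof. by move=> fg; apply: eq_Rintegral => x _; exact: fg. Qed.

Lemma LfunE (p : R) f : 1 <= p ->
  f \in Lfun mu p%:E <->
  measurable_fun setT f /\ integ (fun x => `|f x| `^ p).
Proof.
move=> p1; have p0 : p != 0 by rewrite gt_eqF// (lt_le_trans ltr01).
split=> [fp|[mf hf]].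
  split; first by move: fp; rewrite inE => /andP[/[!inE]].
  exact: Lfun_integrable fp.
rewrite inE; apply/andP; split; rewrite inE//=.
rewrite /finite_norm unlock; apply: poweR_lty.
move/integrableP : hf => [_]; apply: le_lt_trans.
apply: ge0_le_integral => //.
- by move=> x _; exact: poweR_ge0.
- apply/measurable_EFinP; apply: (measurableT_comp (measurable_powR _)) => //.
  exact: measurableT_comp.
- apply/measurable_EFinP; apply: measurableT_comp => //.
  apply: (measurableT_comp (measurable_powR _)) => //.
  exact: measurableT_comp.
- by move=> x _; rewrite /= lee_fin (ger0_norm (powR_ge0 _ _)).
Qed.

Lemma test_partial phi i : test_function phi -> continuous (partial i phi).
Proof.
by move=> /test_functionP[h _]; exact/smooth_expr_continuous/smooth_expr_partial.
Qed.

Lemma classical_ibp (E dE : 'rV[R]_N -> R) i phi :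
  (forall x, is_derive x (delta_mx 0 i) E (dE x)) -> continuous E -> continuous dE ->
  test_function phi ->
  \int[mu]_x (E x * partial i phi x) = - \int[mu]_x (dE x * phi x).
Proof.
move=> hE cE cdE tphi; have cdphi := test_partial (i := i) tphi.
move: tphi => /test_functionP[sphi [M phiM]].
have cphi := smooth_expr_continuous sphi.
have hphi x := smooth_expr_derive i x sphi.
have dphiM := supp_box_derive hphi phiM.
have H : (\int[mu]_x (dE x * phi x + E x * partial i phi x)%:E = 0)%E.
  apply: (@integral_partial R N i M (fun x => E x * phi x)).
  - by move=> x; exact: is_derive_funM.
  - move=> x; apply: (continuousD (continuousM (cdE x) (cphi x))).
    exact: (continuousM (cE x) (cdphi x)).
  - by move=> x j xj; rewrite (phiM x j)// mulr0.
apply/eqP; rewrite -addr_eq0 addrC -RintD; last 2 first.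
- by apply: L1locM_supp phiM => //; exact: continuous_L1loc.
- by apply: L1locM_supp dphiM => //; exact: continuous_L1loc.
by rewrite /Rintegral H.
Qed.

(** Product rule for a weak gradient and a smooth factor zeta, with a classical
    C^1 term E subtracted. When grad E = zeta G + u grad zeta the right-hand side
    is the weak gradient zeta (g - G), without any term in grad zeta. *)
Lemma weak_gradient_cut (u : 'rV[R]_N -> R) (g : 'rV[R]_N -> 'rV[R]_N)
    (zeta E : 'rV[R]_N -> R) (dE : 'I_N -> 'rV[R]_N -> R) :
  weak_gradient u g -> smooth_expr zeta -> continuous E ->
  (forall i x, is_derive x (delta_mx 0 i) E (dE i x)) ->
  (forall i, continuous (dE i)) ->
  forall phi, test_function phi -> forall i,
  \int[mu]_x ((zeta x * u x - E x) * partial i phi x) =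
  - \int[mu]_x ((zeta x * g x 0 i + u x * partial i zeta x - dE i x) * phi x).
Proof.
move=> [hu hg ug] sz cE hE cdE phi tphi i.
have cdphi := test_partial (i := i) tphi.
have hED := classical_ibp (hE i) cE (cdE i) tphi.
move: (tphi) => /test_functionP[sphi [M phiM]].
have cphi := smooth_expr_continuous sphi.
have cz := smooth_expr_continuous sz.
have hphi x := smooth_expr_derive i x sphi.
have hz x := smooth_expr_derive i x sz.
have dphiM := supp_box_derive hphi phiM.
have cdz := smooth_expr_continuous (smooth_expr_partial i sz).
have tzphi : test_function (fun x => zeta x * phi x).
  apply/test_functionP; split; first exact: SE_mul.
  by exists M => x j xj; rewrite (phiM x j)// mulr0.
have dzphi x : partial i (fun x => zeta x * phi x) x =
    partial i zeta x * phi x + zeta x * partial i phi x.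
  by have [] := is_derive_funM (hz x) (hphi x).
have := ug _ tzphi i.
have i1 : integ (fun x => u x * (partial i zeta x * phi x)).
  apply: (@L1locM_supp _ _ M) => //.
    by move=> x; apply: continuousM; [exact: cdz|exact: cphi].
  by move=> x j xj; rewrite (phiM x j)// mulr0.
have i2 : integ (fun x => u x * (zeta x * partial i phi x)).
  apply: (@L1locM_supp _ _ M) => //.
    by move=> x; apply: continuousM; [exact: cz|exact: cdphi].
  by move=> x j xj; rewrite (dphiM x j)// mulr0.
have i3 : integ (fun x => g x 0 i * (zeta x * phi x)).
  apply: (@L1locM_supp (fun x => g x 0 i) _ M) => //.
    by move=> x; apply: continuousM; [exact: cz|exact: cphi].
  by move=> x j xj; rewrite (phiM x j)// mulr0.
have i4 : integ (fun x => dE i x * phi x).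
  by apply: L1locM_supp phiM => //; exact: continuous_L1loc.
have i5 : integ (fun x => E x * partial i phi x).
  by apply: L1locM_supp dphiM => //; exact: continuous_L1loc.
rewrite (@Rint_ext (fun x => u x * partial i (fun x => zeta x * phi x) x)
  (fun x => u x * (partial i zeta x * phi x) + u x * (zeta x * partial i phi x))); last first.
  by move=> x; rewrite dzphi; ring.
rewrite RintD// => H.
rewrite (@Rint_ext _ (fun x => u x * (zeta x * partial i phi x) - E x * partial i phi x)); last first.
  by move=> x; ring.
rewrite RintB//.
rewrite (@Rint_ext (fun x => (zeta x * g x 0 i + _ - _) * _) (fun x =>
  (g x 0 i * (zeta x * phi x) + u x * (partial i zeta x * phi x)) - dE i x * phi x)); last first.
  by move=> x; ring.
rewrite RintB// ?RintD//; last exact: integD.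
by rewrite hED; move: H; lra.
Qed.

End integrable_functions.

(** * Euclidean structure and radial fields *)

Section euclidean.
Context {R : realType} {N : nat}.
Implicit Types (x y z : 'rV[R]_N) (a b : R).

Lemma dotrC x y : dotr x y = dotr y x.
Proof. by apply: eq_bigr => i _; rewrite mulrC. Qed.

Lemma dotrZl a x y : dotr (a *: x) y = a * dotr x y.
Proof. by rewrite /dotr mulr_sumr; apply: eq_bigr => i _; rewrite mxE mulrA. Qed.

Lemma dotrZr a x y : dotr x (a *: y) = a * dotr x y.
Proof. by rewrite dotrC dotrZl dotrC. Qed.

Lemma dotrBl x y z : dotr (x - y) z = dotr x z - dotr y z.
Proof. by rewrite /dotr -sumrB; apply: eq_bigr => i _; rewrite !mxE mulrBl. Qed.

Lemma dotrBr x y z : dotr x (y - z) = dotr x y - dotr x z.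
Proof. by rewrite dotrC dotrBl !(dotrC x). Qed.

Lemma dotr_ge0 x : 0 <= dotr x x.
Proof. by apply: sumr_ge0 => i _; rewrite -expr2 sqr_ge0. Qed.

Lemma enorm_ge0 x : 0 <= enorm x. Proof. exact: sqrtr_ge0. Qed.

Lemma enorm_sqr x : enorm x ^+ 2 = dotr x x.
Proof. by rewrite sqr_sqrtr// dotr_ge0. Qed.

Lemma coord_le_enorm x i : `|x 0 i| <= enorm x.
Proof.
rewrite -(@ler_pXn2r _ 2)// ?nnegrE ?enorm_ge0// enorm_sqr real_normK ?num_real//.
rewrite /dotr (bigD1 i)//= expr2 lerDl.
by apply: sumr_ge0 => j _; rewrite -expr2 sqr_ge0.
Qed.

Lemma enorm0 : enorm (0 : 'rV[R]_N) = 0.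
Proof. by rewrite /enorm /dotr big1 ?sqrtr0// => i _; rewrite mxE mul0r. Qed.

Lemma enorm_eq0 x : enorm x = 0 -> x = 0.
Proof.
move=> x0; apply/rowP => i; rewrite mxE; apply/eqP; rewrite -normr_le0 -x0.
exact: coord_le_enorm.
Qed.

Lemma enormZ a x : enorm (a *: x) = `|a| * enorm x.
Proof.
by rewrite /enorm dotrZl dotrZr mulrA -expr2 sqrtrM ?sqr_ge0// sqrtr_sqr.
Qed.

Lemma dotr_le x y : dotr x y <= enorm x * enorm y.
Proof.
have [/enorm_eq0 ->|x0] := eqVneq (enorm x) 0.
  by rewrite enorm0 mul0r /dotr big1// => i _; rewrite mxE mul0r.
have [/enorm_eq0 ->|y0] := eqVneq (enorm y) 0.
  by rewrite enorm0 mulr0 /dotr big1// => i _; rewrite mxE mulr0.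
have xy : 0 < enorm x * enorm y.
  by rewrite mulr_gt0// lt0r ?x0 ?y0 enorm_ge0.
have := dotr_ge0 (enorm y *: x - enorm x *: y).
rewrite !dotrBl !dotrBr !dotrZl !dotrZr (dotrC y x) -!enorm_sqr => h.
suff : 0 <= enorm x * enorm y * (enorm x * enorm y - dotr x y).
  by rewrite pmulr_rge0// subr_ge0.
by move: h; lra.
Qed.

Lemma norm_dotr_le x y : `|dotr x y| <= enorm x * enorm y.
Proof.
rewrite ler_norml dotr_le andbT lerNl.
have := dotr_le (-1 *: x) y.
by rewrite dotrZl enormZ normrN normr1 mul1r mulN1r.
Qed.

Lemma enorm_axis (s : R) i : enorm (s *: delta_mx 0 i : 'rV[R]_N) = `|s|.
Proof.
rewrite enormZ /enorm /dotr (bigD1 i)//= big1 ?addr0; last first.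
  by move=> j ji; rewrite mxE (negbTE ji) andbF mulr0.
by rewrite mxE !eqxx mulr1 sqrtr1 mulr1.
Qed.

Lemma smooth_dotr : smooth_expr (fun x : 'rV[R]_N => dotr x x).
Proof. by apply: SE_sum => i; apply: SE_mul; exact: SE_coord. Qed.

Lemma is_derive_dotr x i :
  is_derive x (delta_mx 0 i) (fun x : 'rV[R]_N => dotr x x) (2 * x 0 i).
Proof.
apply/is_derive_line.
rewrite (_ : (fun h => _) = fun h : R => dotr x x + h * (2 * x 0 i + h)).
  apply: is_derive_conv (is_derive_funD (is_derive_cst (dotr x x) (0 : R) (1 : R))
    (is_derive_funM (is_derive_id (0 : R) (1 : R))
       (is_derive_funD (is_derive_cst (2 * x 0 i) (0 : R) (1 : R)) (is_derive_id (0 : R) (1 : R))))) _.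
  by rewrite mul0r addr0 add0r mul1r addr0.
apply/funext => h; rewrite /dotr (bigD1 i)//= [in RHS](bigD1 i)//= !mxE !eqxx/= mulr1.
rewrite (eq_bigr (fun j => x 0 j * x 0 j)); first by ring.
by move=> j ji; rewrite !mxE (negbTE ji) andbF mulr0 add0r.
Qed.

Lemma enorm_continuous : continuous (@enorm R N).
Proof.
move=> x; have cd : {for x, continuous (fun x : 'rV[R]_N => dotr x x)}.
  exact: (smooth_expr_continuous smooth_dotr).
exact: (@continuous_comp _ _ _ (fun x => dotr x x) Num.sqrt x cd (@sqrt_continuous _ _)).
Qed.

Lemma is_derive_enorm x i : x != 0 ->
  is_derive x (delta_mx 0 i) (@enorm R N) (x 0 i / enorm x).
Proof.
move=> x0.
have ex : 0 < enorm x.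
  by rewrite lt0r enorm_ge0 andbT; apply: contra x0 => /eqP/enorm_eq0 ->.
have dx : 0 < dotr x x by rewrite -enorm_sqr exprn_gt0.
apply: (@is_derive_ext _ _ (fun x : 'rV[R]_N => Num.sqrt (dotr x x))) => //.
apply: is_derive_conv (is_derive_fun_comp (F := Num.sqrt)
  (f := fun x : 'rV[R]_N => dotr x x) (is_derive1_sqrt dx) (is_derive_dotr x i)) _.
by rewrite -/(enorm x); field; rewrite gt_eqF.
Qed.

Definition rfield (h : R -> R) x : 'rV[R]_N := (h (enorm x) / enorm x) *: x.

Lemma enorm_rfield h x : h 0 = 0 -> enorm (rfield h x) = `|h (enorm x)|.
Proof.
move=> h0; rewrite enormZ normrM normfV (ger0_norm (enorm_ge0 _)).
have [->|x0] := eqVneq (enorm x) 0; first by rewrite h0 normr0 !mul0r.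
by rewrite mulfVK.
Qed.

Lemma dotr_rfield h x y : dotr (rfield h x) y = h (enorm x) / enorm x * dotr x y.
Proof. exact: dotrZl. Qed.

Lemma rfield_continuous (h : R -> R) i : continuous h -> h 0 = 0 ->
  continuous (fun x => rfield h x 0 i).
Proof.
move=> ch h0 x; have che : {for x, continuous (fun x => h (enorm x))}.
  exact: (@continuous_comp _ _ _ (@enorm R N) h x (@enorm_continuous x) (ch _)).
have [x0|x0] := eqVneq x 0.
  have rx : rfield h x 0 i = 0 by rewrite x0 mxE enorm0 h0 mul0r mul0r.
  have hd d : 0 < d -> \forall y \near x, `|h (enorm x) - h (enorm y)| < d.
    by move=> d0; move/cvgrPdist_lt : che => /(_ d d0).
  suff : rfield h y 0 i @[y --> x] --> (0 : R) by rewrite /continuous_at rx.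
  apply/(@cvgrPdist_lt _ _ _ _ (nbhs_filter x)) => d d0.
  near=> y; have : `|h (enorm x) - h (enorm y)| < d by near: y; exact: hd.
  rewrite x0 enorm0 h0 !sub0r !normrN -enorm_rfield//.
  by apply: le_lt_trans; exact: coord_le_enorm.
have -> : (fun x => rfield h x 0 i) = (fun x => h (enorm x) * (enorm x)^-1 * x 0 i).
  by apply/funext => y; rewrite mxE.
have ex0 : enorm x != 0 by apply: contra x0 => /eqP/enorm_eq0 ->.
apply: (continuousM _ (@coord_continuous_rV _ _ i x)).
apply: (continuousM che).
exact: (continuousV ex0 (@enorm_continuous x)).
Unshelve. all: by end_near. Qed.

(** Evenness is what makes a radial function differentiable at the origin, where
    the norm is not: on a coordinate axis e(|h|) = e(h). *)
Lemma is_derive_radial (e de : R -> R) : (forall t, is_derive t (1 : R) e (de t)) ->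
  (forall t, e (- t) = e t) ->
  forall x i, is_derive x (delta_mx 0 i) (fun x => e (enorm x)) (rfield de x 0 i).
Proof.
move=> he even x i.
have [->|x0] := eqVneq x 0; last first.
  apply: is_derive_conv (is_derive_fun_comp (he _) (is_derive_enorm i x0)) _.
  by rewrite mxE mulrAC mulrA.
have de0 : de 0 = 0.
  have h1 := he 0.
  have : is_derive (0 : R) (1 : R) e (- de 0).
    apply: (@is_derive_ext _ _ (fun t => e (- t))) => //.
    have h2 : is_derive (- (0 : R)) (1 : R) e (de 0) by rewrite oppr0.
    apply: is_derive_conv (is_derive_fun_comp h2 (is_derive_funN (is_derive_id (0 : R) (1 : R)))) _.
    by rewrite mulrN1.
  case: h1 => _ e1 [_ e2]; move: e2; rewrite e1; lra.
have -> : rfield de 0 0 i = de 0 by rewrite mxE mxE mulr0 de0.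
apply/is_derive_line.
apply: (is_derive_ext _ (he 0)) => h.
rewrite addr0 enorm_axis.
have [h0|h0] := leP 0 h; first by rewrite ger0_norm.
by rewrite ltr0_norm.
Qed.

Variable p : R.
Hypothesis p1 : 1 < p.

(** The vector |x|^(p-2) x whose divergence is the p-Laplacian. *)
Definition pflux x : 'rV[R]_N := (enorm x `^ (p - 2)) *: x.

Lemma enorm_pflux x : enorm (pflux x) = enorm x `^ (p - 1).
Proof.
rewrite enormZ ger0_norm ?powR_ge0//.
have [->|x0] := eqVneq (enorm x) 0; first by rewrite mulr0 powR0// subr_eq0 gt_eqF.
rewrite -{2}(powRr1 (enorm_ge0 x)) -powRD; first by congr (_ `^ _); ring.
by rewrite x0 implybT.
Qed.

(** Both summands are nonnegative: powers are monotone and Cauchy-Schwarz. *)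
Lemma pflux_dotr x y : dotr (pflux x - pflux y) (x - y) =
  (enorm x `^ (p - 1) - enorm y `^ (p - 1)) * (enorm x - enorm y)
  + (enorm x `^ (p - 2) + enorm y `^ (p - 2)) * (enorm x * enorm y - dotr x y).
Proof.
have E z : enorm z `^ (p - 1) = enorm z `^ (p - 2) * enorm z.
  by rewrite -enorm_pflux enormZ ger0_norm ?powR_ge0.
rewrite !dotrBl !dotrBr !dotrZl (dotrC y x) -!enorm_sqr !E.
by ring.
Qed.

Lemma powR_mono_ge0 a b : 0 <= a -> 0 <= b -> 0 <= (a `^ (p - 1) - b `^ (p - 1)) * (a - b).
Proof.
have p10 : 0 <= p - 1 by rewrite subr_ge0 ltW.
wlog ab : a b / a <= b.
  move=> h a0 b0; have [ab|/ltW ba] := leP a b; first exact: h.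
  by rewrite -mulrNN !opprB; exact: h.
move=> a0 b0; rewrite -mulrNN !opprB mulr_ge0 ?subr_ge0//.
exact: ge0_ler_powR.
Qed.

Lemma pflux_mono x y : 0 <= dotr (pflux x - pflux y) (x - y).
Proof.
rewrite pflux_dotr addr_ge0 ?powR_mono_ge0 ?enorm_ge0//.
by apply: mulr_ge0; [rewrite addr_ge0 ?powR_ge0|rewrite subr_ge0 dotr_le].
Qed.

Lemma pflux_mono_eq x y : dotr (pflux x - pflux y) (x - y) = 0 -> x = y.
Proof.
rewrite pflux_dotr => /eqP.
rewrite paddr_eq0 ?powR_mono_ge0 ?enorm_ge0//; last first.
  by apply: mulr_ge0; [rewrite addr_ge0 ?powR_ge0|rewrite subr_ge0 dotr_le].
move=> /andP[h1 h2].
have xy : enorm x = enorm y.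
  move: h1; rewrite mulf_eq0 !subr_eq0 => /orP[/eqP|/eqP//].
  by apply: powR_injective; rewrite ?nnegrE ?enorm_ge0// subr_gt0.
have [x0|x0] := eqVneq (enorm x) 0.
  by rewrite (enorm_eq0 x0) (@enorm_eq0 y)// -xy.
have xp : 0 < enorm x `^ (p - 2) by rewrite powR_gt0// lt0r x0 enorm_ge0.
move: h2; rewrite -xy mulf_eq0 gt_eqF ?addr_gt0//= subr_eq0 => /eqP c.
apply/eqP; rewrite -subr_eq0; apply/eqP/enorm_eq0/eqP.
rewrite -sqrf_eq0 enorm_sqr dotrBl !dotrBr (dotrC y x) -!enorm_sqr -xy -c.
by apply/eqP; ring.
Qed.

End euclidean.

(** * The radial flux of a source *)

Section one_variable.
Context {R : realType}.
Implicit Types (f W e de : R -> R).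

Lemma is_derive_comp_opp f (df t : R) : is_derive (- t) (1 : R) f df ->
  is_derive t (1 : R) (fun s => f (- s)) (- df).
Proof.
move=> h; apply: is_derive_conv (is_derive_fun_comp h (is_derive_funN (is_derive_id t (1 : R)))) _.
by rewrite mulrN1.
Qed.

Lemma primitive_even e de : (forall t, is_derive t (1 : R) e (de t)) ->
  (forall t, de (- t) = - de t) -> forall t, e (- t) = e t.
Proof.
move=> he odd t; apply/eqP; rewrite -subr_eq0; apply/eqP.
rewrite -[RHS](subrr (e 0)) -{1}oppr0.
apply: (@is_derive_0_is_cst R (fun t => e (- t) - e t)) => s.
apply: is_derive_conv (is_derive_funB (is_derive_comp_opp (he _)) (he s)) _.
by rewrite odd opprK subrr.
Qed.

Lemma is_derive_expn (n : nat) (t : R) :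
  is_derive t (1 : R) (fun s => s ^+ n) (n%:R * t ^+ n.-1).
Proof.
by split; [exact: exprn_derivable|rewrite exp_derive [_ *: 1]mulr1].
Qed.

Variables (n : nat) (f W : R -> R).
Hypotheses (W0 : W 0 = 0) (dW : forall t, is_derive t (1 : R) W (t ^+ n * f t)).

Lemma primitive_weight_le (C t : R) : 0 <= t -> (forall s, 0 <= s <= t -> `|f s| <= C) ->
  `|W t| <= C * t ^+ n.+1 / n.+1%:R.
Proof.
move=> t0 fC.
have n0 : n.+1%:R != 0 :> R by rewrite pnatr_eq0.
have dP s : is_derive s (1 : R) (fun s => C / n.+1%:R * s ^+ n.+1) (C * s ^+ n).
  apply: is_derive_conv (is_derive_funM (is_derive_cst (C / n.+1%:R) s (1 : R)) (is_derive_expn n.+1 s)) _.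
  by rewrite /=; field.
have key a : `|a| = 1 -> a * W t <= C * t ^+ n.+1 / n.+1%:R.
  move=> a1.
  have dD s : is_derive s (1 : R) (fun s => C / n.+1%:R * s ^+ n.+1 - a * W s)
      (s ^+ n * (C - a * f s)).
    apply: is_derive_conv (is_derive_funB (dP s)
      (is_derive_funM (is_derive_cst a s (1 : R)) (dW s))) _.
    by rewrite /=; ring.
  have [|c ct] := @MVT_segment R _ _ 0 t t0 (fun s _ => dD s).
    by apply: continuous_subspaceT => s; exact: is_derive_continuous (dD s).
  rewrite W0 expr0n/= !mulr0 !subr0 => E.
  rewrite -subr_ge0 mulrAC E; move: ct; rewrite in_itv/= => /andP[c0 ct].
  rewrite mulr_ge0// mulr_ge0 ?exprn_ge0// subr_ge0.
  rewrite (le_trans (ler_norm _))// normrM a1 mul1r.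
  by apply: fC; rewrite c0.
rewrite ler_norml lerNl -mulN1r !key ?normrN ?normr1//=.
by rewrite -[W t]mul1r key ?normr1.
Qed.

Hypotheses (cf : continuous f) (fE : forall t, f (- t) = f t).

Lemma primitive_weight_parity t : W (- t) = (-1) ^+ n.+1 * W t.
Proof.
apply/eqP; rewrite -subr_eq0; apply/eqP.
have -> : 0 = W (- 0) - (-1) ^+ n.+1 * W 0 by rewrite oppr0 W0 mulr0 subr0.
apply: (@is_derive_0_is_cst R (fun t => W (- t) - (-1) ^+ n.+1 * W t)) => s.
apply: is_derive_conv (is_derive_funB (is_derive_comp_opp (dW _))
  (is_derive_funM (is_derive_cst ((-1) ^+ n.+1 : R) s (1 : R)) (dW s))) _.
by rewrite /= mul0r add0r fE -[- s]mulN1r exprMn exprS; ring.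
Qed.

(** The solution of (t^n w)' = - t^n f that is regular at the origin: the radial
    component of a field with divergence - f(|x|) in dimension n + 1. Since W and
    0^-1 vanish at 0, the formula is right there too, and for an even source f it
    defines an odd function on the whole line. *)
Definition flux_profile (t : R) : R := - (W t / t ^+ n).

Lemma flux_profile0 : flux_profile 0 = 0.
Proof. by rewrite /flux_profile W0 mul0r oppr0. Qed.

Lemma flux_profileN t : flux_profile (- t) = - flux_profile t.
Proof.
rewrite /flux_profile primitive_weight_parity -[- t]mulN1r exprMn exprS.
have [->|t0] := eqVneq t 0; first by rewrite W0 !(mulr0, mul0r, oppr0).
have h : (-1) ^+ n != 0 :> R by rewrite signr_eq0.
by field; rewrite h expf_neq0.
Qed.

Lemma flux_profile_le (C t : R) : 0 <= t -> (forall s, 0 <= s <= t -> `|f s| <= C) ->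
  `|flux_profile t| <= C * t / n.+1%:R.
Proof.
rewrite le_eqVlt => /predU1P[<- _|t0 h].
  by rewrite flux_profile0 normr0 mulr0 mul0r.
rewrite normrN normrM normfV (gtr0_norm (exprn_gt0 n t0)).
rewrite ler_pdivrMr ?exprn_gt0//.
rewrite (le_trans (primitive_weight_le (ltW t0) h))//.
by rewrite exprS le_eqVlt; apply/orP; left; apply/eqP; ring.
Qed.

Lemma flux_profile_continuous : continuous flux_profile.
Proof.
move=> t; have cW := is_derive_continuous (dW t).
have [->|t0] := eqVneq t 0.
  rewrite /continuous_at flux_profile0.
  have [c _ hc] := @EVT_max R (fun x => `|f x|) 0 1 ler01
    (continuous_subspaceT (fun x => continuous_comp (@cf x) (@norm_continuous _ _ _))).
  set C := `|f c| + 1.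
  have C0 : 0 < C by rewrite ltr_pwDr.
  have bnd s : `|s| <= 1 -> `|flux_profile s| <= C * `|s|.
    move=> s1; have -> : `|flux_profile s| = `|flux_profile `|s| |.
      by have [s0|s0] := leP 0 s; [rewrite (ger0_norm s0)|rewrite (ltr0_norm s0) flux_profileN [RHS]normrN].
    apply: (@le_trans _ _ (C * `|s| / n.+1%:R)).
      apply: flux_profile_le => // r /andP[r0 rs].
      rewrite (le_trans (hc r _)) ?lerDl// in_itv/= r0/=.
      exact: le_trans s1.
    by rewrite ler_pdivrMr ?ltr0n// ler_peMr ?ler1n// mulr_ge0// ltW.
  apply/cvgrPdist_lt => d d0; near=> s.
  have s1 : `|s| < 1.
    by near: s; apply: (cvgr_lt _ (@norm_continuous _ _ (0 : R))); rewrite normr0.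
  have sd : `|s| < C^-1 * d.
    near: s; apply: (cvgr_lt _ (@norm_continuous _ _ (0 : R))).
    by rewrite normr0 mulr_gt0 ?invr_gt0.
  rewrite sub0r normrN (le_lt_trans (bnd s (ltW s1)))//.
  by rewrite -ltr_pdivlMl.
apply: (@continuousN _ _ _ (fun t => W t / t ^+ n)).
apply: continuousM cW _; apply: continuousV; first by rewrite expf_neq0.
exact: exprn_continuous.
Unshelve. all: by end_near. Qed.

Lemma is_derive_flux_profile t : t != 0 ->
  is_derive t (1 : R) flux_profile (- f t - n%:R * flux_profile t / t).
Proof.
move=> t0.
have tn : t ^+ n != 0 by rewrite expf_neq0.
have dV : is_derive t (1 : R) (fun s => (s ^+ n)^-1) (- (t ^+ n) ^- 2 * (n%:R * t ^+ n.-1)).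
  exact: (is_deriveV (f := fun s : R => s ^+ n) tn (is_derive_expn n t)).
apply: is_derive_conv (is_derive_funN (is_derive_funM (dW t) dV)) _.
rewrite /flux_profile /=.
case: n tn => [|m] tn /=; first by rewrite expr0 invr1; field.
by rewrite exprS; field; rewrite t0 expf_neq0.
Qed.

End one_variable.

(** * Lebesgue spaces *)

Lemma pstar_gt1 {R : realType} {N : nat} (p : R) :
  1 < p -> p < N%:R -> 1 < @pstar R N p.
Proof.
move=> p1 pN; rewrite /pstar ltr_pdivlMr ?subr_gt0// mul1r.
have : 0 < N%:R * (p - 1) :> R.
  by rewrite mulr_gt0 ?subr_gt0// (lt_trans _ pN)// (lt_trans ltr01).
by move: p1 pN; nra.
Qed.

Section Lp_functions.
Context {R : realType} {N : nat}.
Implicit Types (f g : 'rV[R]_N -> R) (x : 'rV[R]_N).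
Local Notation mu := (@lebesgue_rV R N).
Variable p : R.
Hypothesis p1 : 1 < p.
Let p0 : 0 < p. Proof. exact: lt_trans p1. Qed.

Lemma measurable_norm_powR f : measurable_fun setT f ->
  measurable_fun setT (fun x => `|f x| `^ p).
Proof.
move=> mf; apply: (measurableT_comp (measurable_powR _)) => //.
exact: measurableT_comp.
Qed.

Lemma Lfun_le f g : measurable_fun setT f -> (forall x, `|f x| <= `|g x|) ->
  g \in Lfun mu p%:E -> f \in Lfun mu p%:E.
Proof.
move=> mf fg /(LfunE _ (ltW p1))[mg hg]; apply/(LfunE _ (ltW p1)); split => //.
apply: integ_le hg; first exact: measurable_norm_powR.
move=> x; rewrite ger0_norm ?powR_ge0//.
by apply: ge0_ler_powR; rewrite ?nnegrE// ltW.
Qed.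

Lemma powR_add_le (a b : R) : 0 <= a -> 0 <= b ->
  (a + b) `^ p <= 2 `^ p * (a `^ p + b `^ p).
Proof.
wlog ab : a b / a <= b.
  move=> h a0 b0; have [ab|/ltW ba] := leP a b; first exact: h.
  by rewrite addrC [X in _ * X]addrC; exact: h.
move=> a0 b0; apply: (@le_trans _ _ ((2 * b) `^ p)).
  apply: ge0_ler_powR; rewrite ?nnegrE ?addr_ge0 ?mulr_ge0//; first exact: ltW.
  by rewrite mulr_natl mulr2n lerD2r.
by rewrite powRM// ler_wpM2l ?powR_ge0// lerDr powR_ge0.
Qed.

Lemma LfunD f g : f \in Lfun mu p%:E -> g \in Lfun mu p%:E ->
  (fun x => f x + g x) \in Lfun mu p%:E.
Proof.
move=> /(LfunE _ (ltW p1))[mf hf] /(LfunE _ (ltW p1))[mg hg].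
have mfg : measurable_fun setT (fun x => f x + g x) by exact: measurable_funD.
apply/(LfunE _ (ltW p1)); split => //.
apply: integ_le (integZ (2 `^ p) (integD hf hg)); first exact: measurable_norm_powR.
move=> x; rewrite ger0_norm ?powR_ge0//.
apply: le_trans (powR_add_le _ _) => //.
apply: ge0_ler_powR; rewrite ?nnegrE ?addr_ge0//; first exact: ltW.
exact: ler_normD.
Qed.

Lemma Lfun_sum m (F : 'I_m -> 'rV[R]_N -> R) : (forall i, F i \in Lfun mu p%:E) ->
  (fun x => \sum_i F i x) \in Lfun mu p%:E.
Proof.
elim: m F => [|m IH] F hF.
  have -> : (fun x => \sum_i F i x) = fun=> 0 by apply/funext => x; rewrite big_ord0.
  apply/(LfunE _ (ltW p1)); split; first exact: measurable_cst.
  have z : `|0 : R| `^ p = 0 by rewrite normr0 powR0// gt_eqF.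
  apply: (@bounded_supp_integrable _ _ 0 0); first exact: measurable_cst.
  - by move=> x; rewrite z normr0.
  - by move=> x j _; exact: z.
rewrite (_ : (fun x => _) = fun x => F ord0 x + \sum_i F (lift ord0 i) x).
  by apply: LfunD => //; exact: IH.
by apply/funext => x; rewrite big_ord_recl.
Qed.

Lemma Lfun_supp M f : continuous f -> supp_box M f -> f \in Lfun mu p%:E.
Proof.
move=> cf fM; have [C hC] := continuous_supp_bounded cf fM.
have mf := continuous_rV_measurable cf.
apply/(LfunE _ (ltW p1)); split => //.
apply: (@bounded_supp_integrable _ _ M (C `^ p)).
- exact: measurable_norm_powR.
- move=> x; rewrite ger0_norm ?powR_ge0//.
  apply: ge0_ler_powR; rewrite ?nnegrE//; first exact: ltW.
  exact: le_trans (hC x).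
- by move=> x j xj; rewrite (fM x j)// normr0 powR0// gt_eqF.
Qed.

Variable g : 'rV[R]_N -> 'rV[R]_N.
Hypothesis gp : forall i, (fun x => g x 0 i) \in Lfun mu p%:E.

Lemma measurable_coord_Lp i : measurable_fun setT (fun x => g x 0 i).
Proof. by have /(LfunE _ (ltW p1))[] := gp i. Qed.

Lemma measurable_enorm_field : measurable_fun setT (fun x => enorm (g x)).
Proof.
apply: (measurableT_comp (continuous_measurable_fun (@sqrt_continuous R))).
apply: measurable_sum => i; apply: measurable_funM; exact: measurable_coord_Lp.
Qed.

Lemma enorm_le_sum x : @enorm R N x <= \sum_i `|x 0 i|.
Proof.
have s0 (P : pred 'I_N) : 0 <= \sum_(i | P i) `|x 0 i| by exact: sumr_ge0.
rewrite -(@ler_pXn2r _ 2)// ?nnegrE ?enorm_ge0 ?s0// enorm_sqr.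
rewrite expr2 mulr_suml; apply: ler_sum => i _.
rewrite (bigD1 i)//= mulrDr -normrM (le_trans (ler_norm _))// lerDl.
by rewrite mulr_ge0.
Qed.

Lemma integ_enorm_powR : integ (fun x => enorm (g x) `^ p).
Proof.
have h : (fun x => \sum_i `|g x 0 i|) \in Lfun mu p%:E.
  apply: Lfun_sum => i; apply: Lfun_le (gp i).
    by apply: measurableT_comp => //; exact: measurable_coord_Lp.
  by move=> x; rewrite normr_id.
have [_ hi] := (LfunE _ (ltW p1)).1 h.
apply: integ_le hi.
  by apply: (measurableT_comp (measurable_powR _)) => //; exact: measurable_enorm_field.
move=> x; rewrite ger0_norm ?powR_ge0//.
apply: ge0_ler_powR; rewrite ?nnegrE ?enorm_ge0//; first exact: ltW.
exact: le_trans (enorm_le_sum _) (ler_norm _).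
Qed.

End Lp_functions.

(** A crude form of Young's inequality, enough for integrability. *)
Lemma powR_mul_le {R : realType} (p a b : R) : 1 < p -> 0 <= a -> 0 <= b ->
  a `^ (p - 1) * b <= a `^ p + b `^ p.
Proof.
move=> p1 a0 b0; have p0 : 0 < p by exact: lt_trans p1.
have h (c : R) : 0 <= c -> c `^ (p - 1) * c = c `^ p.
  by move=> c0; rewrite mulrC mulr_powRB1.
have [ab|/ltW ba] := leP a b.
  apply: (@le_trans _ _ (b `^ p)); last by rewrite lerDr powR_ge0.
  rewrite -h// ler_wpM2r//; apply: ge0_ler_powR; rewrite ?nnegrE//.
  by rewrite subr_ge0 ltW.
apply: (@le_trans _ _ (a `^ p)); last by rewrite lerDl powR_ge0.
by rewrite -h// ler_wpM2l// powR_ge0.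
Qed.

Section pflux_integrable.
Context {R : realType} {N : nat}.
Local Notation mu := (@lebesgue_rV R N).
Variable p : R.
Hypothesis p1 : 1 < p.

Lemma integ_pflux_dotr (g k : 'rV[R]_N -> 'rV[R]_N) :
  (forall i, (fun x => g x 0 i) \in Lfun mu p%:E) ->
  (forall i, (fun x => k x 0 i) \in Lfun mu p%:E) ->
  integ (fun x => dotr (pflux p (g x)) (k x)).
Proof.
move=> gp kp.
apply: integ_le (integD (integ_enorm_powR p1 gp) (integ_enorm_powR p1 kp)).
  rewrite (_ : (fun x => _) = fun x => enorm (g x) `^ (p - 2) * \sum_i g x 0 i * k x 0 i).
    apply: measurable_funM.
      apply: (measurableT_comp (measurable_powR _)) => //.
      exact: (measurable_enorm_field p1 gp).
    apply: measurable_sum => i; apply: measurable_funM.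
      exact: (measurable_coord_Lp p1 gp).
    exact: (measurable_coord_Lp p1 kp).
  by apply/funext => x; rewrite dotrZl.
move=> x; apply: le_trans (norm_dotr_le _ _) _; rewrite enorm_pflux//.
by apply: powR_mul_le => //; exact: enorm_ge0.
Qed.

End pflux_integrable.

(** * Radial truncation of a weakly differentiable function *)

Section cutoff.
Context {R : realType} {N : nat}.
Variables (T : R -> R) (c : R).
Hypotheses (dT : forall t, is_derive t (1 : R) T (- c * sbump t))
  (T1 : forall t, t <= -1 -> T t = 1) (T0 : forall t, 1 <= t -> T t = 0)
  (T01 : forall t, 0 <= T t <= 1).
Implicit Types (x : 'rV[R]_N) (t rho : R).

(** A smooth function of |x|^2, equal to 1 for |x| <= rho and to 0 for
    |x| >= 2 rho. *)
Definition cutoff rho x := T (dotr x x * rho ^- 2 + -2).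
Definition cutoff1 rho t := T (t ^+ 2 * rho ^- 2 + -2).
Definition dcutoff1 rho t := - c * sbump (t ^+ 2 * rho ^- 2 + -2) * (2 * t * rho ^- 2).

Lemma cutoffE rho x : cutoff rho x = cutoff1 rho (enorm x).
Proof. by rewrite /cutoff1 enorm_sqr. Qed.

Lemma smooth_cutoff rho : smooth_expr (cutoff rho).
Proof.
apply: SE_bump_prim dT _; apply: SE_add; last exact: SE_const.
by apply: SE_mul; [exact: smooth_dotr|exact: SE_const].
Qed.

Lemma is_derive_cutoff1 rho t : is_derive t (1 : R) (cutoff1 rho) (dcutoff1 rho t).
Proof.
have h : is_derive t (1 : R) (fun t => t ^+ 2 * rho ^- 2 + -2) (2 * t * rho ^- 2).
  apply: is_derive_conv (is_derive_funD (is_derive_funM (is_derive_expn 2 t)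
    (is_derive_cst (rho ^- 2 : R) t (1 : R))) (is_derive_cst (-2 : R) t (1 : R))) _.
  by rewrite /= mulr0 !addr0 expr1.
exact: (is_derive_fun_comp (F := T) (f := fun t => t ^+ 2 * rho ^- 2 + -2) (dT _) h).
Qed.

Lemma cutoff1_even rho t : cutoff1 rho (- t) = cutoff1 rho t.
Proof. by rewrite /cutoff1 sqrrN. Qed.

Lemma dcutoff1_odd rho t : dcutoff1 rho (- t) = - dcutoff1 rho t.
Proof. by rewrite /dcutoff1 sqrrN; ring. Qed.

Lemma partial_cutoff rho x i : partial i (cutoff rho) x = rfield (dcutoff1 rho) x 0 i.
Proof.
have := is_derive_radial (is_derive_cutoff1 rho) (cutoff1_even rho) x i.
rewrite (_ : (fun x => cutoff1 rho (enorm x)) = cutoff rho); first by case.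
by apply/funext => y; rewrite cutoffE.
Qed.

Lemma cutoff1_continuous rho : continuous (cutoff1 rho).
Proof. by move=> t; exact: is_derive_continuous (is_derive_cutoff1 rho t). Qed.

Lemma dcutoff1_continuous rho : continuous (dcutoff1 rho).
Proof.
move=> t.
have cX2 : {for t, continuous (fun t : R => t ^+ 2)} by exact: exprn_continuous.
have c1 : {for t, continuous (fun t => t ^+ 2 * rho ^- 2 + -2)}.
  exact: (continuousD (continuousM cX2 (@cst_continuous _ _ (rho ^- 2) t))
    (@cst_continuous _ _ (-2 : R) t)).
have c2 : {for t, continuous (fun t => - c * sbump (t ^+ 2 * rho ^- 2 + -2))}.
  apply: (continuousM (@cst_continuous _ _ (- c) t)).
  exact: (@continuous_comp _ _ _ (fun t => t ^+ 2 * rho ^- 2 + -2) _ t c1 (@sbump_continuous _ _)).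
have c3 : {for t, continuous (fun t : R => 2 * t * rho ^- 2)}.
  apply: (@continuousM _ _ (fun t : R => 2 * t) _ t _ (@cst_continuous _ _ (rho ^- 2) t)).
  exact: mulrl_continuous.
exact: (continuousM c2 c3).
Qed.

Lemma cutoff_arg_in rho t : 0 < rho -> `|t| <= rho -> t ^+ 2 * rho ^- 2 + -2 <= -1.
Proof.
move=> r0 tr; have : t ^+ 2 * rho ^- 2 <= 1; last lra.
rewrite ler_pdivrMr ?exprn_gt0// mul1r -(@real_normK _ t) ?num_real//.
by rewrite lerXn2r// nnegrE ltW.
Qed.

Lemma cutoff_arg_out rho t : 0 < rho -> 2 * rho <= `|t| -> 1 <= t ^+ 2 * rho ^- 2 + -2.
Proof.
move=> r0 tr; have : 4 <= t ^+ 2 * rho ^- 2; last lra.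
rewrite ler_pdivlMr ?exprn_gt0// -(@real_normK _ t) ?num_real//.
have -> : 4 * rho ^+ 2 = (2 * rho) ^+ 2 by ring.
by rewrite lerXn2r// nnegrE// mulr_ge0// ltW.
Qed.

Lemma cutoff1_in rho t : 0 < rho -> `|t| <= rho -> cutoff1 rho t = 1.
Proof. by move=> r0 tr; apply/T1/cutoff_arg_in. Qed.

Lemma dcutoff1_in rho t : 0 < rho -> `|t| <= rho -> dcutoff1 rho t = 0.
Proof.
move=> r0 tr; have h := cutoff_arg_in r0 tr.
by rewrite /dcutoff1 sbump_eq0 ?mulr0 ?mul0r// ler0_norm; lra.
Qed.

Lemma cutoff1_out rho t : 0 < rho -> 2 * rho <= `|t| -> cutoff1 rho t = 0.
Proof. by move=> r0 tr; apply/T0/cutoff_arg_out. Qed.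

Lemma dcutoff1_out rho t : 0 < rho -> 2 * rho <= `|t| -> dcutoff1 rho t = 0.
Proof.
move=> r0 tr; have h := cutoff_arg_out r0 tr.
by rewrite /dcutoff1 sbump_eq0 ?mulr0 ?mul0r// ger0_norm//; lra.
Qed.

Lemma supp_cutoff rho : 0 < rho -> supp_box (2 * rho) (cutoff rho).
Proof.
move=> r0 x j xj; rewrite cutoffE cutoff1_out// ger0_norm ?enorm_ge0//.
by rewrite (le_trans (ltW xj))// coord_le_enorm.
Qed.

Lemma cutoff_ge0 rho x : 0 <= cutoff rho x.
Proof. by have /andP[] := T01 (dotr x x * rho ^- 2 + -2). Qed.

Lemma cutoff_le1 rho x : `|cutoff rho x| <= 1.
Proof. by rewrite ger0_norm ?cutoff_ge0//; have /andP[] := T01 (dotr x x * rho ^- 2 + -2). Qed.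

End cutoff.

Section truncation.
Context {R : realType} {N : nat}.
Variables (T : R -> R) (c : R).
Hypotheses (dT : forall t, is_derive t (1 : R) T (- c * sbump t))
  (T1 : forall t, t <= -1 -> T t = 1) (T0 : forall t, 1 <= t -> T t = 0)
  (T01 : forall t, 0 <= T t <= 1).
Variables (p rho : R) (v Gs : R -> R) (u : 'rV[R]_N -> R) (g : 'rV[R]_N -> 'rV[R]_N).
Hypotheses (p1 : 1 < p) (pN : p < N%:R) (rho0 : 0 < rho).
Hypotheses (cv : continuous v) (vE : forall t, v (- t) = v t) (uE : forall x, u x = v (enorm x)).
Hypotheses (cG : continuous Gs) (GsN : forall t, Gs (- t) = - Gs t).
Hypothesis ug : D1p_gradient p u g.
Local Notation mu := (@lebesgue_rV R N).
Local Notation zeta := (@cutoff R N T rho).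

Let Gs0 : Gs 0 = 0.
Proof. by have := GsN 0; rewrite oppr0; lra. Qed.

(** The radial derivative of the term E to be subtracted from zeta u: the profile
    of zeta G + u grad zeta, a field that is again radial, hence a gradient. *)
Definition trunc_slope t := cutoff1 T rho t * Gs t + v t * dcutoff1 c rho t.

Lemma trunc_slopeN t : trunc_slope (- t) = - trunc_slope t.
Proof. by rewrite /trunc_slope cutoff1_even dcutoff1_odd GsN vE; ring. Qed.

Lemma trunc_slope_continuous : continuous trunc_slope.
Proof.
move=> t; exact: (continuousD
  (continuousM (@cutoff1_continuous _ _ _ dT rho t) (@cG t))
  (continuousM (@cv t) (@dcutoff1_continuous _ c rho t))).
Qed.

Lemma trunc_slope_out t : 2 * rho <= `|t| -> trunc_slope t = 0.
Proof.
by move=> h; rewrite /trunc_slope (cutoff1_out T0)// (dcutoff1_out _ rho0)// mul0r mulr0 addr0.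
Qed.

Lemma truncation_primitive : exists e : R -> R,
  [/\ forall t, is_derive t (1 : R) e (trunc_slope t),
      forall t, e (- t) = e t &
      forall t, 2 * rho <= `|t| -> e t = 0].
Proof.
have [F [_ dF]] := continuous_antiderivative trunc_slope_continuous.
pose e t := F t - F (2 * rho).
have de t : is_derive t (1 : R) e (trunc_slope t).
  by apply: is_derive_conv (is_derive_funB (dF t) (is_derive_cst (F (2 * rho)) t (1 : R))) _; rewrite subr0.
have ee : forall t, e (- t) = e t by exact: primitive_even de trunc_slopeN.
exists e; split => // t.
have ot s : 2 * rho <= s -> e s = 0.
  move=> rs; have [|s0 + Es] := @MVT_segment R e trunc_slope _ _ rs (fun s _ => de s).
    by apply: continuous_subspaceT => r; exact: is_derive_continuous (de r).
  rewrite in_itv/= => /andP[rs0 _].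
  have : e s - e (2 * rho) = 0.
    by rewrite Es trunc_slope_out ?mul0r// (le_trans rs0)// ler_norm.
  by rewrite {2}/e subrr subr0.
have [t0|t0] := leP 0 t; first by rewrite ger0_norm//; exact: ot.
by rewrite ltr0_norm// -ee; exact: ot.
Qed.

Variable e : R -> R.
Hypotheses (de : forall t, is_derive t (1 : R) e (trunc_slope t))
  (ee : forall t, e (- t) = e t) (e0 : forall t, 2 * rho <= `|t| -> e t = 0).

(** Formally the radial primitive, vanishing for |x| >= 2 rho, of the field
    zeta (g - G). *)
Definition trunc x := zeta x * u x - e (enorm x).
Definition trunc_grad x : 'rV[R]_N := zeta x *: (g x - rfield Gs x).

Lemma trunc_out x : 2 * rho <= enorm x -> trunc x = 0.
Proof.
move=> h; rewrite /trunc cutoffE (cutoff1_out T0)// ?e0 ?mul0r ?subr0//;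
  by rewrite ger0_norm ?enorm_ge0.
Qed.

Lemma trunc_grad_out x : 2 * rho <= enorm x -> trunc_grad x = 0.
Proof.
move=> h; rewrite /trunc_grad cutoffE (cutoff1_out T0)// ?scale0r//;
  by rewrite ger0_norm ?enorm_ge0.
Qed.

Lemma supp_trunc : supp_box (2 * rho) trunc.
Proof.
by move=> x j xj; apply: trunc_out; rewrite (le_trans (ltW xj))// coord_le_enorm.
Qed.

Lemma trunc_continuous : continuous trunc.
Proof.
have ce : continuous (fun x : 'rV[R]_N => e (enorm x)).
  move=> x; apply: (@continuous_comp _ _ _ (@enorm R N) e).
    exact: enorm_continuous.
  exact: is_derive_continuous (de _).
have cu : continuous (fun x : 'rV[R]_N => u x).
  rewrite (_ : (fun x => _) = fun x => v (enorm x)); last exact/funext.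
  move=> x; apply: (@continuous_comp _ _ _ (@enorm R N) v); last exact: cv.
  exact: enorm_continuous.
have cz := smooth_expr_continuous (@smooth_cutoff R N T c dT rho).
by move=> x; exact: (continuousB (continuousM (cz x) (cu x)) (ce x)).
Qed.

Lemma trunc_weak phi : test_function phi -> forall i,
  \int[mu]_x (trunc x * partial i phi x) = - \int[mu]_x (trunc_grad x 0 i * phi x).
Proof.
move=> tphi i; have [_ wug _] := ug.
have cs := trunc_slope_continuous.
have s0 : trunc_slope 0 = 0 by have := trunc_slopeN 0; rewrite oppr0; lra.
have ce : continuous (fun x : 'rV[R]_N => e (enorm x)).
  move=> x; apply: (@continuous_comp _ _ _ (@enorm R N) e).
    exact: enorm_continuous.
  exact: is_derive_continuous (de _).
rewrite (weak_gradient_cut wug (@smooth_cutoff R N T c dT rho) ce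
  (fun i x => is_derive_radial de ee x i) (fun i => @rfield_continuous R N _ i cs s0) tphi i).
congr (- _); apply: Rint_ext => x; congr (_ * _).
rewrite (partial_cutoff dT) !mxE /trunc_slope -cutoffE uE; ring.
Qed.

Lemma rfield_Gs_continuous i : continuous (fun x : 'rV[R]_N => rfield Gs x 0 i).
Proof. exact: rfield_continuous cG Gs0. Qed.

Lemma trunc_grad_Lp i : (fun x => trunc_grad x 0 i) \in Lfun mu p%:E.
Proof.
have [_ _ gp] := ug.
have cz := smooth_expr_continuous (@smooth_cutoff R N T c dT rho).
rewrite (_ : (fun x => _) = fun x => zeta x * g x 0 i + - (zeta x * rfield Gs x 0 i)); last first.
  by apply/funext => x; rewrite [LHS]mxE [X in _ * X]mxE [X in _ * (_ + X)]mxE mulrDr mulrN.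
apply: (LfunD p1).
  apply: (Lfun_le p1 _ _ (gp i)).
    apply: measurable_funM; first exact: continuous_rV_measurable.
    exact: (measurable_coord_Lp p1 gp).
  by move=> x; rewrite normrM ler_piMl// (cutoff_le1 T01).
apply: (Lfun_supp p1 (M := 2 * rho)).
  by move=> x; exact: (continuousN (continuousM (cz x) (@rfield_Gs_continuous i x))).
by move=> x j xj; rewrite (supp_cutoff T0 rho0 xj) mul0r oppr0.
Qed.

Lemma trunc_D1p : D1p_gradient p trunc trunc_grad.
Proof.
have ct := trunc_continuous.
have ps : 1 < @pstar R N p by exact: pstar_gt1.
split.
- exact: (Lfun_supp ps ct supp_trunc).
- split; [exact: continuous_L1loc| |exact: trunc_weak].
  move=> i; apply: integ_L1loc.
  have cz := smooth_expr_continuous (@smooth_cutoff R N T c dT rho).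
  have [_ [_ gl _] _] := ug.
  rewrite (_ : (fun x => _) = fun x => g x 0 i * zeta x - rfield Gs x 0 i * zeta x); last first.
    by apply/funext => x; rewrite [LHS]mxE [X in _ * X]mxE [X in _ * (_ + X)]mxE mulrC mulrBl.
  apply: integB; apply: (@L1locM_supp _ _ _ _ (2 * rho)) => //; try exact: (supp_cutoff T0 rho0).
  exact/continuous_L1loc/rfield_Gs_continuous.
- exact: trunc_grad_Lp.
Qed.

End truncation.

(** * The divergence of the radial flux *)

Section polynomial_flux.
Context {R : realType}.

(** The polynomial P for which x P(|x|^2) has divergence q(|x|^2) in dimension
    n + 1. *)
Definition flux_poly (n : nat) (q : {poly R}) : {poly R} :=
  \poly_(j < size q) (q`_j / (n.+1 + 2 * j)%:R).

Lemma flux_polyE n q s :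
  n.+1%:R * (flux_poly n q).[s] + 2 * s * (flux_poly n q)^`().[s] = q.[s].
Proof.
set P := flux_poly n q.
suff <- : n.+1%:R%:P * P + 2%:P * ('X * P^`()) = q.
  by rewrite hornerD !hornerM !hornerC hornerX mulrA.
have cP j : P`_j = q`_j / (n.+1 + 2 * j)%:R.
  by rewrite coef_poly; case: ltnP => // h; rewrite (nth_default _ h) mul0r.
apply/polyP => j; rewrite coefD !coefCM coefXM.
have n0 m : (n.+1 + m)%:R != 0 :> R by rewrite pnatr_eq0.
case: j => [|j] /=; first by rewrite cP mulr0 addr0 muln0 addn0 mulrCA divff ?mulr1// pnatr_eq0.
rewrite coef_deriv cP -[X in 2 * X]mulr_natr.
have := n0 (2 * j.+1)%N; rewrite (natrD _ n.+1) natrM.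
by move: n.+1%:R j.+1%:R => a b h; field.
Qed.

End polynomial_flux.

Section radial_flux.
Context {R : realType} {n : nat}.
Local Notation N := n.+1.
Local Notation mu := (@lebesgue_rV R N).
Variables (T : R -> R) (c : R).
Hypotheses (dT : forall t, is_derive t (1 : R) T (- c * sbump t))
  (T1 : forall t, t <= -1 -> T t = 1) (T0 : forall t, 1 <= t -> T t = 0).
Variables (f W : R -> R) (r0 : R) (h : 'rV[R]_N -> R) (k : 'rV[R]_N -> 'rV[R]_N).
Hypotheses (cf : continuous f) (fE : forall t, f (- t) = f t) (W0 : W 0 = 0)
  (dW : forall t, is_derive t (1 : R) W (t ^+ n * f t)).
Hypotheses (r0_gt0 : 0 < r0) (hk : weak_gradient h k) (ch : continuous h)
  (h0 : forall x, r0 <= enorm x -> h x = 0) (k0 : forall x, r0 <= enorm x -> k x = 0).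
Local Notation w := (flux_profile n W).

Let out_ball (x : 'rV[R]_N) : ~ box r0 x -> r0 <= enorm x.
Proof. by move=> /notin_box[j xj]; rewrite (le_trans (ltW xj))// coord_le_enorm. Qed.

Let kM (i : 'I_N) (phi : 'rV[R]_N -> R) : continuous phi -> integ (fun x => k x 0 i * phi x).
Proof.
move=> cphi; have [_ hki _] := hk.
apply: (@L1locM_cont _ _ (fun x => k x 0 i) phi r0) => // x /out_ball/k0 ->.
by rewrite mxE mul0r.
Qed.

Let hM (phi : 'rV[R]_N -> R) : continuous phi -> integ (fun x => h x * phi x).
Proof.
move=> cphi; apply: (@L1locM_cont _ _ h phi r0) => //; first exact: continuous_L1loc.
by move=> x /out_ball/h0 ->; rewrite mul0r.
Qed.

Let integ_enorm_k : integ (fun x => enorm (k x)).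
Proof.
have ki i : integ (fun x => k x 0 i).
  by apply: integ_ext (@kM i (fun=> 1) (@cst_continuous _ _ _)) => x; rewrite mulr1.
apply: (@integ_le _ _ _ (fun x => \sum_i `|k x 0 i|)).
- apply: (measurableT_comp (continuous_measurable_fun (@sqrt_continuous R))).
  by apply: measurable_sum => i; apply: measurable_funM; exact: integ_measurable.
- by move=> x; rewrite ger0_norm ?enorm_ge0//; exact: enorm_le_sum.
- by apply: integ_sum => i; exact: integ_norm.
Qed.

Lemma integ_rfield_dotr (b : R -> R) : continuous b -> b 0 = 0 ->
  integ (fun x => dotr (rfield b x) (k x)).
Proof.
move=> cb b0; apply: integ_sum => i.
apply: integ_ext (kM i (@rfield_continuous R N b i cb b0)) => x.
by rewrite mulrC.
Qed.

(** Multiplied by a cutoff equal to 1 where h and k live, the components of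
    x P(|x|^2) are test functions, so the definition of the weak gradient applies
    to each of them. *)
Lemma poly_flux_identity (q : {poly R}) :
  \int[mu]_x (h x * q.[dotr x x]) =
  - \int[mu]_x (dotr (k x) x * (flux_poly n q).[dotr x x]).
Proof.
set P := flux_poly n q.
have sP (Q : {poly R}) : smooth_expr (fun x : 'rV[R]_N => Q.[dotr x x]).
  exact: SE_horner smooth_dotr.
have cP Q := smooth_expr_continuous (sP Q).
pose D i (x : 'rV[R]_N) := P.[dotr x x] + x 0 i * (P^`().[dotr x x] * (2 * x 0 i)).
have cD i : continuous (D i).
  apply: smooth_expr_continuous; apply: SE_add => //; apply: SE_mul; first exact: SE_coord.
  by apply: SE_mul => //; apply: SE_mul; [exact: SE_const|exact: SE_coord].
have dP i x : is_derive x (delta_mx 0 i) (fun x : 'rV[R]_N => x 0 i * P.[dotr x x]) (D i x).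
  have hP : is_derive (dotr x x) (1 : R) (horner P) (P^`()).[dotr x x].
    by rewrite derivE derive1E; apply: derivableP; exact: derivable_horner.
  apply: is_derive_conv (is_derive_funM (is_derive_coord x i i)
    (is_derive_fun_comp (F := horner P) (f := fun x : 'rV[R]_N => dotr x x) hP (is_derive_dotr x i))) _.
  by rewrite eqxx mul1r.
have comp i : \int[mu]_x (h x * D i x) = - \int[mu]_x (k x 0 i * (x 0 i * P.[dotr x x])).
  pose phi (x : 'rV[R]_N) := cutoff T r0 x * (x 0 i * P.[dotr x x]).
  have sc := @smooth_cutoff R N T c dT r0.
  have sphi : smooth_expr phi.
    by apply: SE_mul => //; apply: SE_mul => //; exact: SE_coord.
  have tphi : test_function phi.
    apply/test_functionP; split => //; exists (2 * r0) => x j xj.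
    by rewrite /phi (supp_cutoff T0 r0_gt0 xj) mul0r.
  have [_ _ wk] := hk; have := wk phi tphi i.
  have dphi x : partial i phi x =
      rfield (dcutoff1 c r0) x 0 i * (x 0 i * P.[dotr x x]) + cutoff T r0 x * D i x.
    rewrite -(partial_cutoff dT).
    by have [] := is_derive_funM (smooth_expr_derive i x sc) (dP i x).
  rewrite (@Rint_ext _ _ (fun x => h x * partial i phi x) (fun x => h x * D i x)); last first.
    move=> x; rewrite dphi.
    have [rx|/ltW xr] := leP r0 (enorm x); first by rewrite h0// !mul0r.
    have xr' : `|enorm x| <= r0 by rewrite ger0_norm ?enorm_ge0.
    by rewrite mxE cutoffE (cutoff1_in T1)// (dcutoff1_in _ r0_gt0)// !mul0r add0r mul1r.
  move=> ->; congr (- _); apply: Rint_ext => x; rewrite /phi.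
  have [rx|/ltW xr] := leP r0 (enorm x); first by rewrite k0// mxE !mul0r.
  have xr' : `|enorm x| <= r0 by rewrite ger0_norm ?enorm_ge0.
  by rewrite cutoffE (cutoff1_in T1)// mul1r.
transitivity (\sum_i \int[mu]_x (h x * D i x)).
  rewrite -Rint_sum; last by move=> i; exact: hM.
  apply: Rint_ext => x; rewrite -mulr_sumr; congr (_ * _).
  rewrite big_split/= sumr_const card_ord -mulr_natl.
  rewrite (eq_bigr (fun i => 2 * P^`().[dotr x x] * (x 0 i * x 0 i))); last by move=> i _; ring.
  by rewrite -mulr_sumr -/(dotr x x) -(flux_polyE n q) -/P; ring.
rewrite (eq_bigr _ (fun i _ => comp i)) sumrN -Rint_sum; last first.
  move=> i; apply: kM; apply: smooth_expr_continuous.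
  by apply: SE_mul => //; exact: SE_coord.
congr (- _); apply: Rint_ext => x; rewrite /dotr mulr_suml.
by apply: eq_bigr => i _; rewrite mulrA.
Qed.

(** Weakly, the radial field of profile w has divergence - f. It is merely
    continuous and h merely weakly differentiable, so neither can be a test
    function: f is replaced by polynomials in |x|^2, and an error d in f costs at
    most d |x| / N in the flux. *)
Lemma radial_flux_identity :
  \int[mu]_x (dotr (rfield w x) (k x)) = \int[mu]_x (f (enorm x) * h x).
Proof.
set A := LHS; set B := RHS.
have cw := flux_profile_continuous W0 dW cf fE.
have w0 := flux_profile0 n W0.
have cfe : continuous (fun x : 'rV[R]_N => f (enorm x)).
  move=> x; apply: (@continuous_comp _ _ _ (@enorm R N) f); last exact: cf.
  exact: enorm_continuous.
have iA : integ (fun x => dotr (rfield w x) (k x)).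
  exact: integ_rfield_dotr cw w0.
have iB : integ (fun x => f (enorm x) * h x).
  rewrite (_ : (fun x => _) = fun x => h x * f (enorm x)); first exact: hM.
  by apply/funext => x; rewrite mulrC.
have iH : integ (fun x => `|h x|).
  apply: integ_norm.
  by apply: integ_ext (@hM (fun=> 1) (@cst_continuous _ _ _)) => x; rewrite mulr1.
set K := \int[mu]_x `|h x| + r0 * \int[mu]_x enorm (k x).
have K0 : 0 <= K.
  apply: addr_ge0; first exact: Rintegral_ge0.
  apply: mulr_ge0; first exact: ltW.
  by apply: Rintegral_ge0 => x _; exact: enorm_ge0.
suff H d : 0 < d -> `|A - B| <= d * K.
  apply/eqP; rewrite -subr_eq0 -normr_le0; apply/ler_addgt0Pr => d d0; rewrite add0r.
  apply: le_trans (H (d / (K + 1)) _) _; first by rewrite divr_gt0// ltr_pwDr.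
  rewrite mulrAC ler_pdivrMr ?ltr_pwDr//; nra.
move=> d0.
have cfs : continuous (fun s => f (Num.sqrt s)).
  move=> s; apply: (@continuous_comp _ _ _ Num.sqrt f); last exact: cf.
  exact: sqrt_continuous.
have [q hq] := weierstrass cfs (exprn_gt0 2 r0_gt0) d0.
have hq' t : 0 <= t <= r0 -> `|f t - q.[t ^+ 2]| <= d.
  move=> /andP[t0 tr]; have := hq (t ^+ 2); rewrite sqrtr_sqr (ger0_norm t0) distrC; apply.
  by rewrite exprn_ge0//= lerXn2r// nnegrE// ltW.
set P := flux_poly n q.
have wP t : 0 < t -> t <= r0 -> `|w t + t * P.[t ^+ 2]| <= d * t.
  move=> t0 tr.
  pose W1 s := W s - s ^+ N * P.[s ^+ 2].
  have W10 : W1 0 = 0 by rewrite /W1 W0 expr0n mul0r subr0.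
  have dW1 s : is_derive s (1 : R) W1 (s ^+ n * (f s - q.[s ^+ 2])).
    have hP : is_derive (s ^+ 2) (1 : R) (horner P) (P^`()).[s ^+ 2].
      by rewrite derivE derive1E; apply: derivableP; exact: derivable_horner.
    apply: is_derive_conv (is_derive_funB (dW s) (is_derive_funM (is_derive_expn N s)
      (is_derive_fun_comp (F := horner P) (f := fun s : R => s ^+ 2) hP (is_derive_expn 2 s)))) _.
    by rewrite -(flux_polyE n q) -/P /= (exprS s n) expr1; ring.
  have -> : w t + t * P.[t ^+ 2] = flux_profile n W1 t.
    by rewrite /flux_profile /W1 (exprS t n); field; rewrite expf_neq0// gt_eqF.
  apply: le_trans (flux_profile_le W10 dW1 (ltW t0) (C := d) _) _.
    by move=> s /andP[s0 st]; apply: hq'; rewrite s0 (le_trans st).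
  by rewrite ler_pdivrMr ?ltr0n// ler_peMr ?ler1n// mulr_ge0// ltW.
have cPs (Q : {poly R}) : continuous (fun x : 'rV[R]_N => Q.[dotr x x]).
  by apply: smooth_expr_continuous; exact: SE_horner smooth_dotr.
have iq : integ (fun x => h x * q.[dotr x x]) by exact: hM.
have iP : integ (fun x => dotr (k x) x * P.[dotr x x]).
  rewrite (_ : (fun x => _) = fun x => \sum_i k x 0 i * (x 0 i * P.[dotr x x])).
    apply: integ_sum => i; apply: kM => x.
    exact: (continuousM (@coord_continuous_rV R N i x) (cPs P x)).
  by apply/funext => x; rewrite /dotr mulr_suml; apply: eq_bigr => i _; rewrite mulrA.
have E := poly_flux_identity q.
have -> : A - B = \int[mu]_x (dotr (rfield w x) (k x) + dotr (k x) x * P.[dotr x x])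
    - \int[mu]_x (f (enorm x) * h x - h x * q.[dotr x x]).
  by rewrite RintD// RintB// E -/A -/B -/P; ring.
apply: le_trans (ler_normB _ _) _; rewrite addrC mulrDr; apply: lerD.
- apply: le_trans (le_normr_Rintegral measurableT (integB iB iq)) _.
  rewrite -RintZ//; apply: le_Rintegral => //; first exact: integ_norm (integB iB iq).
    exact: integZ.
  move=> x _; rewrite (mulrC (f _)) -mulrBr normrM [leRHS]mulrC.
  have [rx|/ltW xr] := leP r0 (enorm x); first by rewrite h0// normr0 !mul0r.
  by rewrite ler_wpM2l// -enorm_sqr; apply: hq'; rewrite enorm_ge0.
- apply: le_trans (le_normr_Rintegral measurableT (integD iA iP)) _.
  rewrite mulrA -RintZ//; apply: le_Rintegral => //; first exact: integ_norm (integD iA iP).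
    exact: integZ.
  move=> x _; rewrite dotr_rfield (dotrC (k x)) mulrC -mulrDr normrM.
  have [rx|/ltW xr] := leP r0 (enorm x).
    by rewrite k0// enorm0 mulr0 /dotr big1 ?normr0 ?mul0r// => i _; rewrite mxE mulr0.
  have [/enorm_eq0 ->|x0] := eqVneq (enorm x) 0.
    rewrite /dotr big1; last by move=> i _; rewrite mxE mul0r.
    by rewrite normr0 mul0r !mulr_ge0 ?enorm_ge0// ltW.
  have ex : 0 < enorm x by rewrite lt0r x0 enorm_ge0.
  have hx := wP _ ex xr.
  rewrite -enorm_sqr.
  have -> : w (enorm x) / enorm x + P.[enorm x ^+ 2] =
      (w (enorm x) + enorm x * P.[enorm x ^+ 2]) / enorm x by field; rewrite gt_eqF.
  rewrite normrM normfV (gtr0_norm ex).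
  apply: (@le_trans _ _ (enorm x * enorm (k x) * (d * enorm x / enorm x))).
    apply: ler_pM => //; first by rewrite divr_ge0// ltW.
      exact: norm_dotr_le.
    by rewrite ler_pM2r ?invr_gt0.
  rewrite mulfK ?gt_eqF//.
  have -> : enorm x * enorm (k x) * d = d * enorm x * enorm (k x) by ring.
  by rewrite ler_wpM2r ?enorm_ge0// ler_wpM2l// ltW.
Qed.

End radial_flux.

(** * Functions with a vanishing weak derivative *)

Section vanishing_integral.
Context {R : realType} {N : nat}.
Local Notation mu := (@lebesgue_rV R N).
Implicit Types f : 'rV[R]_N -> R.

Lemma ge0_Rintegral_eq0_ae f : integ f -> (forall x, 0 <= f x) ->
  \int[mu]_x f x = 0 -> \forall x \ae mu, f x = 0.
Proof.
move=> fi f0 If.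
have mf := measurable_int _ fi.
have I0 : (\int[mu]_x (f x)%:E = 0)%E.
  have := integrable_fin_num measurableT fi => /fineK <-.
  by rewrite -[RHS]/(0%:E); congr (_%:E).
have [/(_ _) h _] := ae_eq_integral_abs mu measurableT mf.
have : ae_eq mu setT (EFin \o f) (cst 0%E).
  apply: h; rewrite -[RHS]I0; apply: eq_integral => x _.
  by rewrite /= ger0_norm.
by apply: filterS => x /(_ I)/= [].
Qed.

Lemma open_box_measure_gt0 (e : R) : 0 < e ->
  (0 < mu [set x : 'rV[R]_N | forall i, `](- e)%R, e[%classic (x 0%R i)])%E.
Proof.
move=> e0; rewrite (@lebesgue_rV_box R N (fun=> `](- e), e[%classic))//.
elim/big_ind: _ => [//|a b a0 b0|i _]; first exact: mule_gt0.
by rewrite lebesgue_measure_itv/= lte_fin gtrN// lte_fin; lra.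
Qed.

End vanishing_integral.

Section constancy.
Context {R : realType} {n : nat}.
Local Notation N := n.+1.
Local Notation mu := (@lebesgue_rV R N).

(** The bumps b s concentrate at s e_0, and b t - b 0 is a multiple of the partial
    derivative of a test function. So D and the constant 1 have the same integrals
    against b t and b 0: the mean values of D near t e_0 and near 0 agree. *)
Lemma zero_weak_partial_cst (D : 'rV[R]_N -> R) (t : R) : continuous D ->
  (forall phi, test_function phi -> \int[mu]_x (D x * partial ord0 phi x) = 0) ->
  D (t *: delta_mx 0 ord0) = D 0.
Proof.
move=> cD hD.
have [T [c [c0 dT T1 T0 T01]]] := @step_exists R.
set a := t *: delta_mx 0 ord0.
suff H d : 0 < d -> `|D a - D 0| <= d * 2.
  apply/eqP; rewrite -subr_eq0 -normr_le0; apply/ler_addgt0Pr => d d0; rewrite add0r.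
  by have := H (d / 2) (divr_gt0 d0 (ltr0n _ 2)); rewrite divfK// pnatr_eq0.
move=> d0.
have near_D y : exists2 e : R, 0 < e & forall x, `|y - x| < e -> `|D y - D x| < d.
  have /cvgrPdist_lt /(_ _ d0) /nbhs_ballP[e /= e0 he] := cD y.
  by exists e => // x yx; apply: he; rewrite -ball_normE.
have [e1 e10 h1] := near_D a; have [e2 e20 h2] := near_D 0.
pose e := Num.min e1 e2.
have e0 : 0 < e by rewrite lt_min e10.
have {}h1 x : `|a - x| < e -> `|D a - D x| < d.
  by rewrite lt_min => /andP[/h1].
have {}h2 x : `|0 - x| < e -> `|D 0 - D x| < d.
  by rewrite lt_min => /andP[_ /h2].
(* Along the first axis, a primitive of the difference of two bumps, at t and at
   0: it vanishes far out on both sides because the bumps have equal mass. *)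
pose S (x : 'rV[R]_N) := T ((x 0 ord0 + - t) * e^-1) + (-1) * T (x 0 ord0 * e^-1).
pose Q (x : 'rV[R]_N) := \prod_(i < n) sbump (x 0 (lift ord0 i) * e^-1).
pose b s (x : 'rV[R]_N) := sbump ((x 0 ord0 + - s) * e^-1) * Q x.
have sQ : smooth_expr Q.
  by apply: SE_prod => i; apply: SE_bump; apply: SE_mul; [exact: SE_coord|exact: SE_const].
have sl s : smooth_expr (fun x : 'rV[R]_N => (x 0 ord0 + - s) * e^-1).
  apply: SE_mul; last exact: SE_const.
  by apply: SE_add; [exact: SE_coord|exact: SE_const].
have sb s : smooth_expr (b s) by apply: SE_mul => //; exact: SE_bump.
have cb s := smooth_expr_continuous (sb s).
have b_ge0 s x : 0 <= b s x.
  by rewrite mulr_ge0 ?sbump_ge0// prodr_ge0// => i _; exact: sbump_ge0.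
have bump_out s : e <= `|s| -> sbump (s * e^-1) = 0.
  by move=> es; rewrite sbump_eq0// normrM normfV (gtr0_norm e0) ler_pdivlMr// mul1r.
have Q_out (x : 'rV[R]_N) (i : 'I_n) : e <= `|x 0 (lift ord0 i)| -> Q x = 0.
  by move=> xi; rewrite /Q (bigD1 i)//= bump_out// mul0r.
have b_in s x : b s x != 0 -> `|s *: delta_mx 0 ord0 - x| < e.
  rewrite mulf_eq0 negb_or => /andP[bs Qx]; apply: norm_rV_lt => // i.
  rewrite !mxE eqxx/=; case: (unliftP ord0 i) => [j|] ->.
    rewrite /= mulr0 sub0r normrN ltNge; apply: contra Qx => xj.
    by rewrite (Q_out _ _ xj).
  rewrite eqxx mulr1 distrC ltNge; apply: contra bs => xs.
  by rewrite bump_out.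
have b_supp s : supp_box (`|s| + e) (b s).
  move=> x j xj; apply/eqP/negPn/negP => /b_in.
  apply/negP; rewrite -leNgt.
  have h : `|(s *: delta_mx 0 ord0 - x) 0 j| <= `|s *: delta_mx 0 ord0 - x| by exact: le_coord_norm.
  apply: le_trans h; rewrite !mxE.
  have sj : `|s * ((0 == 0 :> 'I_1) && (j == ord0))%:R| <= `|s|.
    by rewrite normrM ler_piMr//; case: (_ && _); rewrite ?normr1 ?normr0.
  have := ler_distD 0 (x 0 j) (s * ((0 == 0 :> 'I_1) && (j == ord0))%:R).
  have := lerB_dist (x 0 j) (s * ((0 == 0 :> 'I_1) && (j == ord0))%:R).
  by rewrite distrC; lra.
have ib s : integ (b s) by exact: continuous_supp_integrable (b_supp s).
have iDb s : integ (fun x => D x * b s x).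
  by apply: (L1locM_supp _ _ (b_supp s)) => //; exact: continuous_L1loc.
pose phi x := S x * Q x.
have sS : smooth_expr S.
  have ST s : smooth_expr (fun x : 'rV[R]_N => T ((x 0 ord0 + - s) * e^-1)).
    exact: SE_bump_prim dT _.
  apply: SE_add => //; apply: SE_mul; first exact: SE_const.
  by apply: SE_bump_prim dT _; apply: SE_mul; [exact: SE_coord|exact: SE_const].
have S_supp (x : 'rV[R]_N) : `|t| + e < `|x 0 ord0| -> S x = 0.
  rewrite /S; set s := x 0 ord0 => hs.
  have [s0|s0] := leP 0 s.
    rewrite (ger0_norm s0) in hs.
    rewrite !T0 ?mulr0 ?addr0//; rewrite ler_pdivlMr// mul1r; move: (ler_norm t) (normr_ge0 t); lra.
  rewrite (ltr0_norm s0) in hs.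
  rewrite !T1 ?mulr1 ?subrr//; rewrite ler_pdivrMr// mulN1r;
    move: (ler_norm (- t)) (normr_ge0 t); rewrite normrN; lra.
have phi_supp : supp_box (`|t| + e) phi.
  move=> x j xj; rewrite /phi; case: (unliftP ord0 j) xj => [i|] -> xj.
    rewrite (Q_out x i) ?mulr0//; rewrite (le_trans _ (ltW xj))// lerDr//.
  by rewrite S_supp ?mul0r.
have tphi : test_function phi.
  by apply/test_functionP; split; [exact: SE_mul|exists (`|t| + e)].
have dphi x : is_derive x (delta_mx 0 ord0) phi (- c * e^-1 * (b t x - b 0 x)).
  have dx s : is_derive x (delta_mx 0 ord0) (fun x : 'rV[R]_N => (x 0 ord0 + - s) * e^-1) e^-1.
    apply: is_derive_conv (is_derive_funM (is_derive_funD (is_derive_coord x ord0 ord0)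
      (is_derive_cst (- s) x (delta_mx 0 ord0))) (is_derive_cst e^-1 x (delta_mx 0 ord0))) _.
    by rewrite eqxx /= addr0 mul1r mulr0 addr0.
  have dTs s : is_derive x (delta_mx 0 ord0) (fun x : 'rV[R]_N => T ((x 0 ord0 + - s) * e^-1))
      (- c * sbump ((x 0 ord0 + - s) * e^-1) * e^-1).
    exact: (is_derive_fun_comp (F := T) (f := fun x : 'rV[R]_N => (x 0 ord0 + - s) * e^-1)) (dT _) (dx s).
  have dS : is_derive x (delta_mx 0 ord0) S
      (- c * sbump ((x 0 ord0 + - t) * e^-1) * e^-1 - (- c * sbump ((x 0 ord0 + - 0) * e^-1) * e^-1)).
    apply: is_derive_ext (is_derive_funB (dTs t) (dTs 0)) => y.
    by rewrite /S oppr0 addr0 mulN1r.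
  have dQ : is_derive x (delta_mx 0 ord0) Q 0.
    apply/is_derive_line.
    have -> : (fun h : R => Q (h *: delta_mx 0 ord0 + x)) = cst (Q x).
      apply/funext => h; apply: eq_bigr => i _.
      by rewrite !mxE eqxx /= mulr0 add0r.
    exact: is_derive_cst.
  apply: is_derive_conv (is_derive_funM dS dQ) _.
  by rewrite /b; ring.
have Ephi x : partial ord0 phi x = - c * e^-1 * (b t x - b 0 x) by have [] := dphi x.
have ce : - c * e^-1 != 0.
  by rewrite mulf_neq0// ?invr_eq0 ?oppr_eq0 gt_eqF.
have D_eq : \int[mu]_x (D x * b t x) = \int[mu]_x (D x * b 0 x).
  apply/eqP; rewrite -subr_eq0 -RintB//.
  have := hD _ tphi.
  rewrite (@Rint_ext _ _ _ (fun x => - c * e^-1 * (D x * b t x - D x * b 0 x))); last first.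
    by move=> x; rewrite Ephi; ring.
  by rewrite RintZ; [move/eqP; rewrite mulf_eq0 (negbTE ce)|exact: integB].
have b_eq : \int[mu]_x b t x = \int[mu]_x b 0 x.
  apply/eqP; rewrite -subr_eq0 -RintB//.
  have cdphi : continuous (fun x => - c * e^-1 * (b t x - b 0 x)).
    apply: smooth_expr_continuous; apply: SE_mul; first exact: SE_const.
    rewrite (_ : (fun x => _) = fun x => b t x + (-1) * b 0 x); last first.
      by apply/funext => x; rewrite mulN1r.
    by apply: SE_add => //; apply: SE_mul => //; exact: SE_const.
  have := integral_partial dphi cdphi phi_supp => /(congr1 fine).
  rewrite -/(Rintegral _ _ _) RintZ; last exact: integB.
  by move/eqP; rewrite mulf_eq0 (negbTE ce).
set J := \int[mu]_x b 0 x in b_eq.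
have J0 : 0 < J.
  rewrite lt0r; apply/andP; split; last by apply: Rintegral_ge0 => x _; exact: b_ge0.
  apply/negP => /eqP /(ge0_Rintegral_eq0_ae (ib 0) (b_ge0 0)) [A [mA A0 hA]].
  have := open_box_measure_gt0 (N := N) e0.
  rewrite ltNge => /negP; apply; rewrite -A0; apply: le_measure.
  - rewrite inE; apply: (measurable_box (A := fun=> `](- e), e[%classic)) => i; exact: measurable_itv.
  - by rewrite inE.
  - move=> x /= xe; apply: hA => /= /eqP; apply/negP; rewrite gt_eqF//.
    have pos j : 0 < sbump (x 0 j * e^-1).
      apply: sbump_gt0; rewrite normrM normfV (gtr0_norm e0) ltr_pdivrMr// mul1r.
      by have := xe j; rewrite in_itv/= ltr_norml.
    rewrite /b oppr0 addr0 mulr_gt0//; by apply: prodr_gt0 => i _.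
have ibZ s r : integ (fun x => r * b s x) by exact: integZ.
have bound s : (forall x, `|s *: delta_mx 0 ord0 - x| < e -> `|D (s *: delta_mx 0 ord0) - D x| < d) ->
    \int[mu]_x b s x = J ->
    `|D (s *: delta_mx 0 ord0) * J - \int[mu]_x (D x * b s x)| <= d * J.
  move=> hs <-; rewrite -!RintZ// -RintB//.
  have iB := integB (ibZ s (D (s *: delta_mx 0 ord0))) (iDb s).
  apply: le_trans (le_normr_Rintegral measurableT iB) _.
  apply: le_Rintegral => //; [exact: integ_norm iB|exact: ibZ|].
  move=> x _; rewrite -mulrBl normrM (ger0_norm (b_ge0 _ _)).
  have [->|bx] := eqVneq (b s x) 0; first by rewrite !mulr0.
  by rewrite ler_wpM2r// ltW// hs// b_in.
have B1 := bound t h1 b_eq.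
have B2 := bound 0; rewrite scale0r in B2; have {}B2 := B2 h2 erefl.
rewrite -(ler_pM2r J0) -{1}(gtr0_norm J0) -normrM mulrBl.
rewrite D_eq in B1.
have := ler_distD (\int[mu]_x (D x * b 0 x)) (D a * J) (D 0 * J).
move=> h; apply: le_trans h _; rewrite (distrC _ (D 0 * J)) mulrAC mulr_natr mulr2n.
by apply: lerD.
Qed.

End constancy.

(** * Regularity of the radial profile *)

Section radial_solution.
Context {R : realType} {n : nat}.
Local Notation N := n.+1.
Local Notation mu := (@lebesgue_rV R N).
Variables (p : R) (v : R -> R) (u : 'rV[R]_N -> R) (g : 'rV[R]_N -> 'rV[R]_N).
Hypotheses (p1 : 1 < p) (pN : p < N%:R).
Hypotheses (cv : continuous v) (vE : forall t, v (- t) = v t)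
  (uE : forall x, u x = v (enorm x)).
Hypotheses (ug : D1p_gradient p u g)
  (weak : forall h k, D1p_gradient p h k ->
    \int[mu]_x (enorm (g x) `^ (p - 2) * dotr (g x) (k x)) =
    \int[mu]_x (`|u x| `^ (@pstar R N p - 2) * u x * h x)).
Local Notation q := (@pstar R N p).
Local Notation f := (fun t => spow (q - 1) (v t)).
Variable W : R -> R.
Hypotheses (W0 : W 0 = 0) (dW : forall t, is_derive t (1 : R) W (t ^+ n * f t)).
Local Notation w := (flux_profile n W).
Local Notation slope := (fun t => spow (p - 1)^-1 (w t)).

Let q1 : 1 < q.
Proof. exact: pstar_gt1. Qed.

Let cf : continuous f.
Proof.
move=> t; apply: (@continuous_comp _ _ _ v (spow (q - 1))); first exact: cv.
by apply: spow_continuous; rewrite subr_gt0.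
Qed.

Let fE t : f (- t) = f t. Proof. by rewrite /= vE. Qed.

Let cw : continuous w. Proof. exact: (flux_profile_continuous W0 dW cf fE). Qed.

Let w0 : w 0 = 0. Proof. exact: flux_profile0. Qed.

Let cslope : continuous slope.
Proof.
move=> t; apply: (@continuous_comp _ _ _ w (spow (p - 1)^-1)); first exact: cw.
by apply: spow_continuous; rewrite invr_gt0 subr_gt0.
Qed.

Let slopeN t : slope (- t) = - slope t.
Proof. by rewrite /= (flux_profileN W0 dW fE) spowN. Qed.

Let slope0 : slope 0 = 0. Proof. by rewrite /= w0 spow0. Qed.

Lemma pflux_slope (x : 'rV[R]_N) : pflux p (rfield slope x) = rfield w x.
Proof.
have p10 : p - 1 != 0 by rewrite subr_eq0 gt_eqF.
rewrite /pflux enorm_rfield// /rfield scalerA mulrA.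
have -> : p - 2 = p - 1 - 1 by ring.
by rewrite spow_powR spowK.
Qed.

(** The truncation is tested in the weak equation for u and in the identity
    - div X = f. The right-hand sides coincide, so the monotone integrand
    zeta (|g|^(p-2) g - |G|^(p-2) G) . (g - G) has integral 0. *)
Lemma gradient_ae (rho : R) : 0 < rho ->
  \forall x \ae mu, enorm x <= rho -> g x = rfield slope x.
Proof.
move=> rho0; have [T [c [c0 dT T1 T0 T01]]] := @step_exists R.
have [e [de ee e0]] := truncation_primitive (c := c) dT T0 rho0 cv vE cslope slopeN.
have hD := trunc_D1p dT T0 T01 p1 pN rho0 cv vE uE cslope slopeN ug de ee e0.
set h := trunc _ _ _ _ in hD; set k := trunc_grad _ _ _ _ in hD.
have r0 : 0 < 2 * rho by rewrite mulr_gt0.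
have [_ hk kp] := hD; have [_ _ gp] := ug.
have ch : continuous h by exact: (trunc_continuous dT cv uE de).
have h0 x : 2 * rho <= enorm x -> h x = 0 by exact: (@trunc_out _ _ _ T0 _ u rho0 _ e0 x).
have k0 x : 2 * rho <= enorm x -> k x = 0 by apply: (trunc_grad_out T0 _ _ rho0).
have E1 : \int[mu]_x dotr (pflux p (g x)) (k x) = \int[mu]_x (f (enorm x) * h x).
  rewrite (@Rint_ext _ _ _ (fun x => enorm (g x) `^ (p - 2) * dotr (g x) (k x))); last first.
    by move=> x; rewrite dotrZl.
  rewrite (weak hD); apply: Rint_ext => x; congr (_ * _).
  have -> : q - 2 = q - 1 - 1 by ring.
  by rewrite spow_powR uE.
have E2 := radial_flux_identity dT T1 T0 cf fE W0 dW r0 hk ch h0 k0.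
have i1 := integ_pflux_dotr p1 gp kp.
have i2 := integ_rfield_dotr hk k0 cw w0.
pose F x := dotr (pflux p (g x)) (k x) - dotr (rfield w x) (k x).
have FE x : F x = cutoff T rho x *
    dotr (pflux p (g x) - pflux p (rfield slope x)) (g x - rfield slope x).
  by rewrite /F -pflux_slope -dotrBl /k /trunc_grad dotrZr.
have : \forall x \ae mu, F x = 0.
  apply: ge0_Rintegral_eq0_ae; first exact: integB.
    by move=> x; rewrite FE mulr_ge0 ?(cutoff_ge0 T01)// pflux_mono.
  by rewrite RintB// E1 E2 subrr.
apply: filterS => x; rewrite FE => /eqP Fx xr.
have xr' : `|enorm x| <= rho by rewrite ger0_norm ?enorm_ge0.
move: Fx; rewrite cutoffE (cutoff1_in T1)// mul1r => /eqP.
exact: (pflux_mono_eq p1).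
Qed.

(** u and the C^1 function Y(|x|) have the same weak gradient, so they differ by a
    constant. *)
Lemma profile_derive (t : R) : is_derive t (1 : R) v (slope t).
Proof.
have [Y [Y0 dY]] := continuous_antiderivative cslope.
have YE := primitive_even dY slopeN.
have cY s : {for s, continuous Y} by exact: is_derive_continuous (dY s).
have ceY : continuous (fun x : 'rV[R]_N => Y (enorm x)).
  move=> x; apply: (@continuous_comp _ _ _ (@enorm R N) Y); last exact: cY.
  exact: enorm_continuous.
have cu : continuous u.
  rewrite (_ : u = fun x => v (enorm x)); last exact/funext.
  move=> x; apply: (@continuous_comp _ _ _ (@enorm R N) v); last exact: cv.
  exact: enorm_continuous.
pose D (x : 'rV[R]_N) := u x - Y (enorm x).
have cD : continuous D by move=> x; exact: (continuousB (cu x) (ceY x)).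
have hD phi : test_function phi -> \int[mu]_x (D x * partial ord0 phi x) = 0.
  move=> tphi; have [_ [_ gl wg] _] := ug.
  have cdphi := test_partial (i := ord0) tphi.
  have := tphi => /test_functionP[sphi [M phiM]].
  have dphiM := supp_box_derive (fun x => smooth_expr_derive ord0 x sphi) phiM.
  have cphi := smooth_expr_continuous sphi.
  have cG : continuous (fun x : 'rV[R]_N => rfield slope x 0 ord0).
    exact: rfield_continuous cslope slope0.
  have iu : integ (fun x => u x * partial ord0 phi x).
    by apply: (L1locM_supp _ _ dphiM) => //; exact: continuous_L1loc.
  have iY : integ (fun x => Y (enorm x) * partial ord0 phi x).
    by apply: (L1locM_supp _ _ dphiM) => //; exact: continuous_L1loc.
  rewrite (@Rint_ext _ _ _ (fun x => u x * partial ord0 phi x - Y (enorm x) * partial ord0 phi x)); last first.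
    by move=> x; rewrite mulrBl.
  rewrite RintB// wg//.
  rewrite (classical_ibp (fun x => is_derive_radial dY YE x ord0) ceY cG tphi).
  apply/eqP; rewrite opprK addrC subr_eq0; apply/eqP.
  have ig : integ (fun x => g x 0 ord0 * phi x) by exact: (L1locM_supp (gl ord0) cphi phiM).
  have iG : integ (fun x => rfield slope x 0 ord0 * phi x).
    by apply: (L1locM_supp _ cphi phiM); exact: continuous_L1loc.
  congr fine; apply: ae_eq_integral => //; [exact: measurable_int iG|exact: measurable_int ig|].
  (* The Euclidean ball of radius rho contains the cube of half-side M. *)
  pose rho := N%:R * `|M| + 1.
  have rho0 : 0 < rho by rewrite ltr_pwDr// mulr_ge0.
  apply: filterS (gradient_ae rho0) => x hx _ /=; congr (_%:E).
  have [bx|/notin_box[j xj]] := pselect (box M x); last by rewrite (phiM x j)// !mulr0.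
  rewrite hx//; apply: (le_trans (enorm_le_sum x)).
  apply: (@le_trans _ _ (\sum_(i < N) `|M|)); last first.
    by rewrite sumr_const card_ord -mulr_natl lerDl.
  apply: ler_sum => i _; apply: le_trans (ler_norm M).
  by move/boxP: bx => /(_ i).
have vY s : v s = Y s + v 0.
  have := zero_weak_partial_cst s cD hD.
  have E0 : enorm (0 : 'rV[R]_N) = 0 by exact: enorm0.
  rewrite /D !uE enorm_axis E0 Y0 subr0.
  have -> : v `|s| = v s by have [s0|s0] := leP 0 s; [rewrite (ger0_norm s0)|rewrite (ltr0_norm s0) vE].
  have -> : Y `|s| = Y s by have [s0|s0] := leP 0 s; [rewrite (ger0_norm s0)|rewrite (ltr0_norm s0) YE].
  by move=> <-; ring.
apply: (@is_derive_ext _ _ (fun s => Y s + v 0)); first by move=> s; rewrite (vY s).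
apply: is_derive_conv (is_derive_funD (dY t) (is_derive_cst (v 0) t (1 : R))) _.
by rewrite addr0.
Qed.

End radial_solution.

Lemma radial_solution_profile (R : realType) (n : nat) (p : R) (u : 'rV[R]_n.+1 -> R) :
  1 < p -> p < n.+1%:R -> continuous u -> radial u -> weak_solution p u ->
  exists v w : R -> R,
  [/\ forall x, u x = v (enorm x),
      forall t, is_derive t (1 : R) v (spow (p - 1)^-1 (w t)),
      continuous w /\ w 0 = 0 &
      forall t, t != 0 ->
        is_derive t (1 : R) w (- spow (@pstar R n.+1 p - 1) (v t) - n%:R * w t / t)].
Proof.
move=> p1 pN cu [v0 uv0] [g ug weak].
(* Reading the profile along a whole axis makes it even. *)
pose v t := u (t *: delta_mx 0 ord0).
have vE t : v (- t) = v t by rewrite /v !uv0 !enorm_axis normrN.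
have uE x : u x = v (enorm x) by rewrite /v !uv0 enorm_axis ger0_norm ?enorm_ge0.
have cv : continuous v.
  move=> t; apply: (@continuous_comp _ _ _ (fun t : R => t *: (delta_mx 0 ord0 : 'rV[R]_n.+1)) u); last exact: cu.
  exact: scalel_continuous.
have q1 : 0 < @pstar R n.+1 p - 1 by rewrite subr_gt0 pstar_gt1.
have cf : continuous (fun t : R => spow (@pstar R n.+1 p - 1) (v t)).
  move=> t; apply: (@continuous_comp _ _ _ v (spow _)); first exact: cv.
  exact: spow_continuous.
have ctf : continuous (fun t : R => t ^+ n * spow (@pstar R n.+1 p - 1) (v t)).
  by move=> t; exact: (continuousM (@exprn_continuous R n t) (cf t)).
have [W [W0 dW]] := continuous_antiderivative ctf.
exists v, (flux_profile n W); split => //.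
- by move=> t; exact: (profile_derive p1 pN cv vE uE ug weak W0 dW).
- split; last exact: flux_profile0.
  by apply: (flux_profile_continuous W0 dW cf) => t; rewrite vE.
- by move=> t t0; exact: (is_derive_flux_profile dW).
Qed.

(** * The ordinary differential equation *)

Section calculus.
Context {R : realType}.
Implicit Types (F : R -> R) (a b s t : R).

Lemma derive0_cst_itv F a b : (forall x, x \in `]a, b[%R -> is_derive x (1 : R) F 0) ->
  forall s t, s \in `]a, b[%R -> t \in `]a, b[%R -> F s = F t.
Proof.
move=> dF s t; wlog st : s t / s <= t.
  by move=> h; have [/h//|/ltW /h h' si ti] := leP s t; rewrite h'.
rewrite !in_itv/= => /andP[as_ _] /andP[_ tb].
have sub x : x \in `[s, t]%R -> x \in `]a, b[%R.
  rewrite !in_itv/= => /andP[sx xt].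
  by rewrite (lt_le_trans as_)//= (le_lt_trans xt).
have h1 x : x \in `]s, t[%R -> is_derive x (1 : R) F ((fun=> 0 : R) x).
  by move=> xst; apply: dF; apply: sub; exact: (subset_itv_oo_cc xst).
have h2 : {within `[s, t], continuous F}.
  by apply: derivable_within_continuous => x xst; have [] := dF _ (sub _ xst).
have [c _ E] := MVT_segment st h1 h2.
by move/eqP: E; rewrite mul0r subr_eq0 => /eqP.
Qed.

Lemma continuous_right_eq0 F a b : a < b -> {for a, continuous F} ->
  (forall t, a < t -> t < b -> F t = 0) -> F a = 0.
Proof.
move=> ab cF h; apply/eqP; rewrite -normr_le0; apply/ler_addgt0Pr => d d0; rewrite add0r.
have /cvgrPdist_lt /(_ _ d0) /nbhs_ballP[e /= e0 he] := cF.
pose t := a + Num.min (e / 2) ((b - a) / 2).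
have m0 : 0 < Num.min (e / 2) ((b - a) / 2).
  by rewrite lt_min !divr_gt0// subr_gt0.
have me : Num.min (e / 2) ((b - a) / 2) < e.
  by rewrite gt_min ltr_pdivrMr// ltr_pMr// ltr1n.
have mb : Num.min (e / 2) ((b - a) / 2) < b - a.
  have : (b - a) / 2 < b - a by rewrite ltr_pdivrMr// ltr_pMr ?subr_gt0// ltr1n.
  by rewrite gt_min => ->; rewrite orbT.
have Ft : F t = 0 by apply: h; rewrite /t ?ltrDl//; lra.
have := he t; rewrite Ft subr0 => h'; apply/ltW/h'.
by rewrite -ball_normE/= /t opprD addNKr normrN gtr0_norm.
Qed.

End calculus.

Section profile_ode.
Context {R : realType}.
Variables (n : nat) (p : R) (v w : R -> R).
Local Notation N := n.+1.
Local Notation q := (@pstar R N p).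
Local Notation e1 := ((p - 1)^-1).
Local Notation p' := (e1 + 1).
Local Notation beta := ((N%:R - p) / p).
Local Notation sigma := (p / (N%:R - p)).
Local Notation kappa := (N%:R * (p - 1) / (N%:R - p)).
Hypotheses (p1 : 1 < p) (pN : p < N%:R).
Hypotheses (dv : forall t, is_derive t (1 : R) v (spow e1 (w t)))
  (cw : continuous w) (w0 : w 0 = 0)
  (dw : forall t, t != 0 ->
     is_derive t (1 : R) w (- spow (q - 1) (v t) - n%:R * w t / t)).

Let p0 : 0 < p. Proof. exact: lt_trans p1. Qed.
Let pB : 0 < p - 1. Proof. by rewrite subr_gt0. Qed.
Let NB : 0 < N%:R - p. Proof. by rewrite subr_gt0. Qed.
Let N0 : 0 < N%:R :> R. Proof. by rewrite ltr0n. Qed.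
Let e1_gt0 : 0 < e1. Proof. by rewrite invr_gt0. Qed.
Let q1 : 1 < q.
Proof. exact: pstar_gt1. Qed.
Let nN : n%:R = N%:R - 1 :> R. Proof. by rewrite -natr1; ring. Qed.
Let cv t : {for t, continuous v}. Proof. exact: is_derive_continuous (dv t). Qed.

Lemma is_derive_expn_mul_w t : t != 0 ->
  is_derive t (1 : R) (fun s => s ^+ n * w s) (- t ^+ n * spow (q - 1) (v t)).
Proof.
move=> t0; apply: is_derive_conv (is_derive_funM (is_derive_expn n t) (dw t0)) _.
have -> : n%:R * t ^+ n.-1 = n%:R * t ^+ n / t.
  by case: n => [|k] /=; [rewrite !mul0r|rewrite exprS; field].
by field.
Qed.

(** r^N times the density of the Pohozaev identity: kinetic and potential energy
    on the sphere of radius r plus the flux of u against the infinitesimal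
    dilation. Criticality of p* makes it a first integral. *)
Definition pohozaev t : R :=
  t ^+ N * ((p - 1) / p * `|w t| `^ p' + `|v t| `^ q / q) + beta * (t ^+ n * w t * v t).

Lemma flux_slope t : spow e1 (w t) * w t = `|w t| `^ p'.
Proof. by rewrite spow_mul// gt_eqF// addr_gt0. Qed.

Lemma source_mul t : spow (q - 1) (v t) * v t = `|v t| `^ q.
Proof. by rewrite spow_mul ?subrK// gt_eqF// (lt_trans ltr01). Qed.

Lemma is_derive_pohozaev t : t != 0 -> is_derive t (1 : R) pohozaev 0.
Proof.
move=> t0.
have p'1 : 1 < p' by rewrite ltrDr.
have dA := is_derive_fun_comp (F := fun x => `|x| `^ p') (f := w)
  (is_derive_norm_powR (w t) p'1) (dw t0).
have dB := is_derive_fun_comp (F := fun x => `|x| `^ q) (f := v)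
  (is_derive_norm_powR (v t) q1) (dv t).
have dC := is_derive_funM (is_derive_expn_mul_w t0) (dv t).
have cst (c : R) := is_derive_cst c t (1 : R).
apply: is_derive_conv (is_derive_funD (is_derive_funM (is_derive_expn N t)
  (is_derive_funD (is_derive_funM (cst ((p - 1) / p)) dA) (is_derive_funM dB (cst q^-1))))
  (is_derive_funM (cst beta) dC)) _.
rewrite /= addrK !mul0r !mulr0 !add0r !addr0.
rewrite (_ : beta * _ = beta * t ^+ n * (spow e1 (w t) * w t)
  - beta * t ^+ n * (spow (q - 1) (v t) * v t)); last by ring.
rewrite -!flux_slope -!source_mul.
move: (spow e1 (w t)) (spow (q - 1) (v t)) => a b.
rewrite (_ : t ^+ N = t * t ^+ n) ?exprS// nN /pstar.
have NB0 := lt0r_neq0 NB; have pB0 := lt0r_neq0 pB; have p00 := lt0r_neq0 p0.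
have N00 := lt0r_neq0 N0.
field.
by rewrite nat1r t0 p00 pB0 NB0 N00.
Qed.

Lemma pohozaev_continuous : continuous pohozaev.
Proof.
have p'1 : 1 < p' by rewrite ltrDr.
move=> t.
have cA : {for t, continuous (fun t => `|w t| `^ p')}.
  apply: (@continuous_comp _ _ _ w (fun x => `|x| `^ p')); first exact: cw.
  exact: is_derive_continuous (is_derive_norm_powR (w t) p'1).
have cB : {for t, continuous (fun t => `|v t| `^ q)}.
  apply: (@continuous_comp _ _ _ v (fun x => `|x| `^ q)); first exact: cv.
  exact: is_derive_continuous (is_derive_norm_powR (v t) q1).
have cst (c : R) := @cst_continuous R R c t.
have c1 : {for t, continuous (fun t => (p - 1) / p * `|w t| `^ p' + `|v t| `^ q / q)}.
  exact: (continuousD (continuousM (cst ((p - 1) / p)) cA) (continuousM cB (cst q^-1))).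
have c2 : {for t, continuous (fun t : R => t ^+ n * w t * v t)}.
  have c4 : {for t, continuous (fun t : R => t ^+ n)} by exact: exprn_continuous.
  exact: (continuousM (continuousM c4 (@cw t)) (@cv t)).
have c3 : {for t, continuous (fun t : R => t ^+ N)} by exact: exprn_continuous.
exact: (continuousD (continuousM c3 c1) (continuousM (cst beta) c2)).
Qed.

Lemma pohozaev_eq0 t : 0 <= t -> pohozaev t = 0.
Proof.
move=> t0.
have P0 : pohozaev 0 = 0 by rewrite /pohozaev w0 expr0n !(mul0r, mulr0) addr0.
have h1 x : x \in `]0, t[%R -> is_derive x (1 : R) pohozaev ((fun=> 0 : R) x).
  by rewrite in_itv/= => /andP[x0 _]; apply: is_derive_pohozaev; rewrite gt_eqF.
have h2 : {within `[0, t], continuous pohozaev}.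
  exact: continuous_subspaceT pohozaev_continuous.
have [c _ /eqP] := MVT_segment t0 h1 h2.
by rewrite mul0r P0 subr0 => /eqP.
Qed.

(** The form in which the first integral enters the derivative of the quotient
    below. *)
Lemma pohozaev_div t : 0 < t ->
  `|v t| `^ q + kappa * `|w t| `^ p' + N%:R * (w t * v t / t) = 0.
Proof.
move=> t0; have := pohozaev_eq0 (ltW t0); rewrite /pohozaev.
have tn : t ^+ n != 0 by rewrite expf_neq0// gt_eqF.
have NB0 := lt0r_neq0 NB; have p00 := lt0r_neq0 p0.
have N00 := lt0r_neq0 N0; have t00 := lt0r_neq0 t0.
have -> : q = N%:R * p / (N%:R - p) by [].
move: (`|v t| `^ _) (`|w t| `^ _) => B A.
rewrite exprS => h.
have : N%:R * p / (N%:R - p) / (t * t ^+ n) * (t * t ^+ n * ((p - 1) / p * A + B / (N%:R * p / (N%:R - p)))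
  + beta * (t ^+ n * w t * v t)) = 0.
  by rewrite h mulr0.
move: tn; move: (t ^+ n) => T Tn <-.
move: N%:R N00 NB0 => m N00 NB0.
by field; rewrite Tn p00 NB0 N00 t00.
Qed.

Section positive_interval.
Variables (a b : R).
Hypotheses (a0 : 0 <= a) (ab : a < b) (vpos : forall t, a < t -> t < b -> 0 < v t).

(** For the explicit solutions w is a multiple of r v^kappa. In general the
    logarithmic derivative of w v^(-kappa) / r is, by the equation, a multiple of
    the vanishing Pohozaev quantity. *)
Lemma quotient_cst : exists Q, forall t, a < t -> t < b -> w t = Q * t * v t `^ kappa.
Proof.
pose F t := w t * (v t `^ (- kappa) * t^-1).
have dF x : x \in `]a, b[%R -> is_derive x (1 : R) F 0.
  rewrite in_itv/= => /andP[ax xb].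
  have x0 : 0 < x by exact: le_lt_trans ax.
  have vx := vpos ax xb.
  have dV : is_derive x (1 : R) (fun y : R => y^-1) (- x ^- 2).
    have := @is_deriveV R id x 1 1 (lt0r_neq0 x0) (is_derive_id _ _).
    by rewrite [_ *: 1]mulr1.
  have dvk := is_derive_fun_comp (F := fun y => y `^ (- kappa)) (f := v)
    (is_derive1_powR (- kappa) vx) (dv x).
  apply: is_derive_conv (is_derive_funM (dw (lt0r_neq0 x0)) (is_derive_funM dvk dV)) _.
  have -> : v x `^ (- kappa - 1) = v x `^ (- kappa) / v x.
    by rewrite powRB ?powRr1 ?(ltW vx)// (gt_eqF vx) implybT.
  have P := pohozaev_div x0; move: P; rewrite -flux_slope -source_mul.
  move: (spow e1 (w x)) (spow (q - 1) (v x)) (v x `^ (- kappa)) => A B C P.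
  have -> : (- B - n%:R * w x / x) * (C / x) + w x * (- kappa * (C / v x) * A / x + C * - x ^- 2)
    = - (C / (x * v x)) * (B * v x + kappa * (A * w x) + N%:R * (w x * v x / x)).
    rewrite nN; move: (lt0r_neq0 x0) (lt0r_neq0 vx) (lt0r_neq0 NB).
    by move: N%:R => m x00 vx0 NB0; field; rewrite x00 vx0 NB0.
  by rewrite P mulr0.
have [m1 m2] : a < (a + b) / 2 /\ (a + b) / 2 < b by move: ab; split; lra.
exists (F ((a + b) / 2)) => t at_ tb.
have t0 : 0 < t by exact: le_lt_trans at_.
have vt := vpos at_ tb.
rewrite -(derive0_cst_itv dF (s := t)) ?in_itv/= ?at_ ?m1//.
rewrite /F powRN; field.
by rewrite (gt_eqF t0) gt_eqF// powR_gt0.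
Qed.

(** With the previous lemma v' = spow e1 (w) is a separable equation: the power
    -sigma of v has derivative proportional to r^(1/(p-1)). *)
Lemma inverse_power_affine : exists Q K, forall t, a < t -> t < b ->
  w t = Q * t * v t `^ kappa /\
  v t `^ (- sigma) = K - (p - 1) / (N%:R - p) * spow e1 Q * t `^ p'.
Proof.
have [Q wQ] := quotient_cst.
pose C := (p - 1) / (N%:R - p) * spow e1 Q.
pose F t := v t `^ (- sigma) + C * t `^ p'.
have dF x : x \in `]a, b[%R -> is_derive x (1 : R) F 0.
  rewrite in_itv/= => /andP[ax xb].
  have x0 : 0 < x by exact: le_lt_trans ax.
  have vx := vpos ax xb.
  have dvk := is_derive_fun_comp (F := fun y => y `^ (- sigma)) (f := v)
    (is_derive1_powR (- sigma) vx) (dv x).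
  apply: is_derive_conv (is_derive_funD dvk (is_derive_funM (is_derive_cst C x (1 : R))
    (is_derive1_powR p' x0))) _.
  have -> : spow e1 (w x) = spow e1 Q * x `^ e1 * v x `^ (kappa * e1).
    by rewrite wQ// !spowMr ?powR_gt0// -powRrM.
  have -> : v x `^ (- sigma - 1) = (v x `^ (kappa * e1))^-1.
    rewrite -powRN; congr (_ `^ _).
    have := lt0r_neq0 NB; have := lt0r_neq0 pB.
    by move: N%:R => m pB0 NB0; field; rewrite NB0 pB0.
  have vk : v x `^ (kappa * e1) != 0 by rewrite gt_eqF// powR_gt0.
  rewrite /= mul0r add0r addrK /C.
  move: (v x `^ (kappa * e1)) vk (x `^ e1) (spow e1 Q) => A A0 B D.
  have := lt0r_neq0 NB; have := lt0r_neq0 pB.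
  by move: N%:R => m pB0 NB0; field; rewrite NB0 pB0 A0.
have [m1 m2] : a < (a + b) / 2 /\ (a + b) / 2 < b by move: ab; split; lra.
exists Q, (F ((a + b) / 2)) => t at_ tb; split; first exact: wQ.
rewrite -(derive0_cst_itv dF (s := t)) ?in_itv/= ?at_ ?m1//.
by rewrite /F /C addrK.
Qed.

(** v^(-sigma) is bounded on a bounded interval, so v stays away from 0. *)
Lemma endpoint_gt0 : 0 < v a /\ 0 < v b.
Proof.
have [Q [K h]] := inverse_power_affine.
pose C := (p - 1) / (N%:R - p) * spow e1 Q.
have s0 : 0 < sigma by rewrite divr_gt0.
pose B := `|K| + `|C| * b `^ p' + 1.
have B0 : 0 < B by rewrite ltr_pwDr// addr_ge0// mulr_ge0// powR_ge0.
have vB t : a < t -> t < b -> B `^ (- sigma^-1) <= v t.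
  move=> at_ tb; have vt := vpos at_ tb.
  have t0 : 0 <= t by rewrite (le_trans a0)// ltW.
  have [_ E] := h t at_ tb.
  have zB : v t `^ (- sigma) <= B.
    rewrite E -/C; have : - (C * t `^ p') <= `|C| * b `^ p'.
      rewrite (le_trans (ler_norm _))// normrN normrM ler_wpM2l//.
      rewrite ger0_norm ?powR_ge0//; apply: ge0_ler_powR; rewrite ?nnegrE ?(ltW tb)//.
        by rewrite addr_ge0// ltW.
      exact: le_trans t0 (ltW tb).
    by move: (ler_norm K); rewrite /B; lra.
  have -> : v t = (v t `^ (- sigma)) `^ (- sigma^-1).
    by rewrite -powRrM mulrNN mulfV ?gt_eqF// powRr1// ltW.
  rewrite !powRN lef_pV2 ?posrE ?powR_gt0//; last by rewrite invr_gt0 powR_gt0.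
  rewrite -powRN.
  by apply: ge0_ler_powR; rewrite ?nnegrE ?powR_ge0// ltW// invr_gt0.
have Bp : 0 < B `^ (- sigma^-1) by exact: powR_gt0.
have [m1 m2] : a < (a + b) / 2 /\ (a + b) / 2 < b by move: ab; split; lra.
have lim c : a <= c -> c <= b ->
  (forall e, 0 < e -> exists t, [/\ a < t, t < b & `|c - t| < e]) -> 0 < v c.
  move=> ac cb near_c; rewrite ltNge; apply/negP => vc.
  have /cvgrPdist_lt /(_ _ Bp) /nbhs_ballP[e /= e0 he] := @cv c.
  have [t [at_ tb ct]] := near_c _ e0.
  have : `|v c - v t| < B `^ (- sigma^-1) by apply: he; rewrite -ball_normE.
  rewrite ltr_norml => /andP[h1 _].
  by have := vB _ at_ tb; move: h1 vc; lra.
have mid e : 0 < e -> 0 < Num.min (e / 2) ((b - a) / 2) /\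
    (Num.min (e / 2) ((b - a) / 2) < e /\ Num.min (e / 2) ((b - a) / 2) < b - a).
  move=> e0; have ba : 0 < b - a by rewrite subr_gt0.
  split; first by rewrite lt_min !divr_gt0.
  have h1 : (b - a) / 2 < b - a by rewrite ltr_pdivrMr// ltr_pMr// ltr1n.
  have h2 : e / 2 < e by rewrite ltr_pdivrMr// ltr_pMr// ltr1n.
  by rewrite !gt_min h1 h2 orbT.
split; apply: lim => //; rewrite ?(ltW ab)// => e e0; have [h1 [h2 h3]] := mid _ e0.
- exists (a + Num.min (e / 2) ((b - a) / 2)); split; [lra|lra|].
  by rewrite opprD addNKr normrN gtr0_norm.
- exists (b - Num.min (e / 2) ((b - a) / 2)); split; [lra|lra|].
  by rewrite opprB addrC subrK gtr0_norm.
Qed.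

End positive_interval.

(** A zero nearest to a point of positivity would be an endpoint of an interval
    of positivity. *)
Lemma profile_gt0 t0 : 0 <= t0 -> 0 < v t0 -> forall t, 0 <= t -> 0 < v t.
Proof.
move=> t00 vt0 t1 t10; rewrite ltNge; apply/negP => vt1.
have closed_nonpos : closed [set s : R | v s <= 0].
  rewrite (_ : mkset _ = v @^-1` [set y | y <= 0])//.
  apply: preimage_closed; last exact: closed_le.
  by move=> s _; exact: cv.
have [lt10|lt01|E] := ltgtP t1 t0; last by move: vt1; rewrite E leNgt vt0.
- pose A := `[t1, t0]%classic `&` [set s : R | v s <= 0].
  have cA : compact A.
    by apply: (subclosed_compact _ (@segment_compact R t1 t0));
      [apply: closedI => //; exact: interval_closed|exact: subIsetl].
  have A1 : A t1 by split => //=; rewrite in_itv/= lexx ltW.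
  have [c] := compact_EVT_max (ex_intro _ t1 A1) cA (@continuous_subspaceT _ _ _ id (fun=> cvg_id)).
  rewrite inE => -[/=]; rewrite in_itv/= => /andP[tc ct] vc hc.
  have ct0 : c < t0 by rewrite lt_neqAle ct andbT; apply: contraTneq vc => ->; rewrite -ltNge.
  have [|+ _] := @endpoint_gt0 c t0 (le_trans t10 tc) ct0.
    move=> s cs st; rewrite ltNge; apply/negP => vs.
    have : s <= c by apply: hc; rewrite inE; split => //=; rewrite in_itv/= (ltW st) (le_trans tc (ltW cs)).
    by rewrite leNgt cs.
  by rewrite ltNge vc.
- pose A := `[t0, t1]%classic `&` [set s : R | v s <= 0].
  have cA : compact A.
    by apply: (subclosed_compact _ (@segment_compact R t0 t1));
      [apply: closedI => //; exact: interval_closed|exact: subIsetl].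
  have A1 : A t1 by split => //=; rewrite in_itv/= lexx ltW.
  have [c] := compact_EVT_min (ex_intro _ t1 A1) cA (@continuous_subspaceT _ _ _ id (fun=> cvg_id)).
  rewrite inE => -[/=]; rewrite in_itv/= => /andP[tc ct] vc hc.
  have ct0 : t0 < c by rewrite lt_neqAle tc andbT; apply: contraTneq vc => <-; rewrite -ltNge.
  have [|_] := @endpoint_gt0 t0 c t00 ct0.
    move=> s cs st; rewrite ltNge; apply/negP => vs.
    have : c <= s by apply: hc; rewrite inE; split => //=; rewrite in_itv/= (ltW cs) (le_trans (ltW st) ct).
    by rewrite leNgt st.
  by rewrite ltNge vc.
Qed.

Hypothesis vpos : forall t, 0 <= t -> 0 < v t.
Local Notation K := (v 0 `^ (- sigma)).

(** The two constants are read off at the origin: continuity of v gives the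
    additive one, and dividing the Pohozaev relation by v^q and letting r tend to
    0 gives 1 + N Q K = 0. *)
Lemma inverse_power_profile t : 0 <= t ->
  v t `^ (- sigma) = K + (p - 1) / (N%:R - p) * (N%:R * K) `^ (- e1) * t `^ p'.
Proof.
rewrite le_eqVlt => /predU1P[<-|t0].
  by rewrite powR0 ?mulr0 ?addr0// gt_eqF// addr_gt0.
have vpos' b s : 0 < s -> s < b -> 0 < v s by move=> s0 _; apply: vpos; exact: ltW.
have t1 : 0 < t + 1 by rewrite addr_gt0.
have [Q [K1 h]] := @inverse_power_affine 0 (t + 1) (lexx _) t1 (vpos' _).
pose C := (p - 1) / (N%:R - p) * spow e1 Q.
have p'0 : 0 < p' by rewrite addr_gt0.
have K0 : 0 < K by rewrite powR_gt0// vpos.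
have cz : {for 0, continuous (fun s => v s `^ (- sigma))}.
  apply: (@continuous_comp _ _ _ v (fun y => y `^ (- sigma))); first exact: cv.
  by apply: powR_continuous_pos; exact: vpos.
have cp : {for 0, continuous (fun s : R => `|s| `^ p')}.
  by apply: is_derive_continuous; apply: is_derive_norm_powR; rewrite ltrDr.
have cst (c : R) := @cst_continuous R R c 0.
have z0 : `|0 : R| `^ p' = 0 by rewrite normr0 powR0// gt_eqF.
(* F is continuous at 0 and vanishes to the right of 0; likewise below. *)
have KE : K = K1.
  pose F s := v s `^ (- sigma) + C * `|s| `^ p' - K1.
  have cF : {for 0, continuous F}.
    exact: (continuousB (continuousD cz (continuousM (cst C) cp)) (cst K1)).
  have : F 0 = 0.
    apply: (continuous_right_eq0 t1 cF) => s s0 st.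
    by rewrite /F ger0_norm ?(ltW s0)//; have [_ ->] := h s s0 st; rewrite -/C; ring.
  by rewrite /F z0 mulr0 addr0 => /eqP; rewrite subr_eq0 => /eqP.
have QE : 1 + N%:R * Q * K = 0.
  pose F s := 1 + kappa * `|Q| `^ p' * `|s| `^ p' + N%:R * Q * v s `^ (- sigma).
  have cF : {for 0, continuous F}.
    exact: (continuousD (continuousD (cst 1) (continuousM (cst (kappa * `|Q| `^ p')) cp))
      (continuousM (cst (N%:R * Q)) cz)).
  have : F 0 = 0.
    apply: (continuous_right_eq0 t1 cF) => s s0 st.
    have vs := vpos (ltW s0).
    have [ws _] := h s s0 st.
    have := pohozaev_div s0; rewrite ws.
    have vk : 0 < v s `^ kappa by rewrite powR_gt0.
    rewrite !normrM (gtr0_norm vs) (gtr0_norm vk) !powRM ?mulr_ge0// ?(ltW vk)//.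
    have e1' : kappa * p' = q.
      rewrite /pstar; have := lt0r_neq0 NB; have := lt0r_neq0 pB.
      by move: N%:R => m pB0 NB0; field; rewrite NB0 pB0.
    have e2 : q = kappa + 1 + sigma.
      rewrite /pstar; have := lt0r_neq0 NB.
      by move: N%:R => m NB0; field.
    have E1 : (v s `^ kappa) `^ p' = v s `^ q by rewrite -powRrM e1'.
    have E2 : v s `^ kappa * v s = v s `^ q * v s `^ (- sigma).
      rewrite -powRD ?(gt_eqF vs) ?implybT// e2 addrK powRD ?(gt_eqF vs) ?implybT//.
      by rewrite powRr1// ltW.
    rewrite E1 -[Q * s * _ * _]mulrA E2.
    have vq : v s `^ q != 0 by rewrite gt_eqF// powR_gt0.
    move=> H; apply: (mulfI vq); rewrite mulr0 -H /F.
    by field; rewrite nat1r gt_eqF// gt_eqF.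
  by rewrite /F z0 mulr0 addr0.
have [_ ->] := h t t0 (ltr_pwDr ltr01 (lexx t)).
rewrite -KE; congr (_ + _); rewrite -mulNr -mulrN; congr (_ * _ * _).
have NK : 0 < N%:R * K by rewrite mulr_gt0.
have -> : Q = - (N%:R * K)^-1.
  apply: (mulfI (lt0r_neq0 NK)); rewrite mulrN mulfV ?gt_eqF//.
  by move: QE; lra.
rewrite spowN opprK spow_pos ?invr_gt0//.
move: (N%:R * K) NK => M M0.
by rewrite -(powR_inv1 (ltW M0)) -powRrM mulN1r.
Qed.

Lemma bubble_formula : exists2 lambda : R, 0 < lambda & forall t, 0 <= t ->
  v t = (lambda `^ (1 / (p - 1)) * N%:R `^ (1 / p)
         * ((N%:R - p) / (p - 1)) `^ ((p - 1) / p)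
       / (lambda `^ (p / (p - 1)) + t `^ (p / (p - 1)))) `^ ((N%:R - p) / p).
Proof.
have v0 : 0 < v 0 by exact: vpos.
have K0 : 0 < K by exact: powR_gt0.
pose c := N%:R `^ (1 / p) * ((N%:R - p) / (p - 1)) `^ ((p - 1) / p).
have r0 : 0 < (N%:R - p) / (p - 1) by rewrite divr_gt0.
have c0 : 0 < c by rewrite mulr_gt0 ?powR_gt0.
have pB0 := lt0r_neq0 pB; have p00 := lt0r_neq0 p0; have NB0 := lt0r_neq0 NB.
have p'E : p / (p - 1) = p' by field.
have L0 : 0 < c * K by rewrite mulr_gt0.
(* At r = 0 the formula reads v^(-sigma) = lambda / c, hence this lambda. *)
exists (c * K) => // t t0.
rewrite p'E mul1r.
rewrite (_ : (c * K) `^ e1 * _ * _ = (c * K) `^ e1 * c); last by rewrite /c mulrA.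
have cp : c `^ p' = N%:R `^ e1 * ((N%:R - p) / (p - 1)).
  rewrite powRM ?powR_ge0// -!powRrM.
  have -> : 1 / p * p' = e1 by field; rewrite p00 pB0.
  have -> : (p - 1) / p * p' = 1 by field; rewrite p00 pB0.
  by rewrite powRr1// ltW.
have D0 : 0 < (c * K) `^ p' + t `^ p' by rewrite ltr_wpDr ?powR_ge0// powR_gt0.
have E1 : (c * K) `^ p' = (c * K) `^ e1 * (c * K).
  rewrite powRD ?(gt_eqF L0) ?implybT//.
  by rewrite powRr1// ltW.
have key : v t `^ (- sigma) = ((c * K) `^ p' + t `^ p') / ((c * K) `^ e1 * c).
  rewrite inverse_power_profile//.
  have L1 : 0 < (c * K) `^ e1 by exact: powR_gt0.
  have N1 : 0 < N%:R `^ e1 by exact: powR_gt0.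
  have K1 : 0 < K `^ e1 by exact: powR_gt0.
  have c1 : 0 < c `^ e1 by exact: powR_gt0.
  have cp' : c `^ e1 * c = N%:R `^ e1 * ((N%:R - p) / (p - 1)).
    by rewrite -cp powRD ?(gt_eqF c0) ?implybT// [c `^ 1]powRr1// ltW.
  rewrite E1 (powRN (N%:R * K)) (powRM e1 (ltW N0) (ltW K0)).
  have cKe : (c * K) `^ e1 = c `^ e1 * K `^ e1 by rewrite powRM ?(ltW c0) ?(ltW K0).
  have -> : (c * K) `^ e1 * c = N%:R `^ e1 * ((N%:R - p) / (p - 1)) * K `^ e1.
    by rewrite cKe mulrAC cp'.
  rewrite (_ : (c * K) `^ e1 * (c * K) = (c * K) `^ e1 * c * K); last by rewrite mulrA.
  have -> : (c * K) `^ e1 * c = N%:R `^ e1 * ((N%:R - p) / (p - 1)) * K `^ e1.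
    by rewrite cKe mulrAC cp'.
  move: (N%:R `^ e1) N1 (K `^ e1) K1 (t `^ p') => A A0 B B0 C.
  move: K K0 => k k0.
  have := lt0r_neq0 A0; have := lt0r_neq0 B0; move: NB0.
  move: N%:R => m NB0 B00 A00; field.
  by rewrite A00 B00 NB0 pB0.
have -> : v t = (v t `^ (- sigma)) `^ (- beta).
  rewrite -powRrM; have -> : - sigma * - beta = 1 by field; rewrite nat1r p00 NB0.
  by rewrite powRr1// ltW// vpos.
rewrite key (powRN _ beta).
have S0 : 0 < (c * K) `^ e1 * c by rewrite mulr_gt0// powR_gt0.
apply: (mulIf (x := (((c * K) `^ p' + t `^ p') / ((c * K) `^ e1 * c)) `^ beta)).
  by rewrite gt_eqF// powR_gt0// divr_gt0.
rewrite mulVf; last by rewrite gt_eqF// powR_gt0// divr_gt0.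
rewrite -powRM ?divr_ge0 ?(ltW S0) ?(ltW D0)//.
rewrite (_ : _ / _ * _ = 1) ?powR1//.
by field; rewrite !gt_eqF// powR_gt0.
Qed.

End profile_ode.

(** * Classification *)

Theorem proposition1p3 (R : realType) (N : nat) (p : R) (u : 'rV[R]_N -> R) :
  1 < p -> p < N%:R ->
  D1p p u -> ~ (\forall x \ae lebesgue_rV N, u x = 0) ->
  continuous u -> radial u -> weak_solution p u ->
  exists2 lambda : R, 0 < lambda &
    let U (x : 'rV[R]_N) :=
      (lambda `^ (1 / (p - 1)) * N%:R `^ (1 / p)
         * ((N%:R - p) / (p - 1)) `^ ((p - 1) / p)
       / (lambda `^ (p / (p - 1)) + enorm x `^ (p / (p - 1))))
      `^ ((N%:R - p) / p) in
    (forall x, u x = U x) \/ (forall x, u x = - U x).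
Proof.
case: N u => [|n] u p1 pN _ u0 cu ru wu.
  by move: pN; rewrite ltNge (le_trans ler01 (ltW p1)).
have [v [w [uE dv [cw w0] dw]]] := radial_solution_profile p1 pN cu ru wu.
have [x0 ux0] : exists x0, u x0 != 0.
  apply: contrapT => /forallNP h; apply: u0; apply: aeW => x.
  by apply/eqP/negPn/negP; exact: h.
have [vx|vx] : 0 < v (enorm x0) \/ v (enorm x0) < 0.
  by move: ux0; rewrite uE neq_lt => /orP[]; [right|left].
- have vpos := profile_gt0 p1 pN dv cw w0 dw (enorm_ge0 x0) vx.
  have [lambda l0 E] := bubble_formula p1 pN dv cw w0 dw vpos.
  by exists lambda => //; left => x; rewrite uE E// enorm_ge0.
- have dv' t : is_derive t (1 : R) (fun t => - v t) (spow (p - 1)^-1 (- w t)).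
    by rewrite spowN; exact: is_derive_funN (dv t).
  have cw' : continuous (fun t => - w t) by move=> t; exact: (continuousN (cw t)).
  have w0' : - w 0 = 0 by rewrite w0 oppr0.
  have dw' t : t != 0 -> is_derive t (1 : R) (fun t => - w t)
      (- spow (@pstar R n.+1 p - 1) (- v t) - n%:R * - w t / t).
    move=> t0; apply: is_derive_conv (is_derive_funN (dw t t0)) _.
    by rewrite spowN mulrN mulNr !opprK opprD !opprK.
  have vx' : 0 < - v (enorm x0) by rewrite oppr_gt0.
  have vpos := profile_gt0 p1 pN dv' cw' w0' dw' (enorm_ge0 x0) vx'.
  have [lambda l0 E] := bubble_formula p1 pN dv' cw' w0' dw' vpos.
  by exists lambda => //; right => x; rewrite uE -E ?opprK// enorm_ge0.
Qed.
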